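(* Let $L=L_0\oplus L_1$ be a Lie superalgebra over a field of characteristic $p\geq 3$, with bracket $(\,,)$ and universal enveloping algebra $U(L)$; in case $p=3$ assume also that $((y,y),y)=0$ for every $y\in L_1$. The following conditions are equivalent: (1) $U(L)$ is bounded Lie Engel; (2) $U(L)$ is PI, $L_0$ is abelian, $\operatorname{ad} x$ is nilpotent for every $x\in L_0$, and either $(L_1,L_1)=0$, or $\dim L_1\leq 1$ and $(L_0,L_1)=0$; (3) $U(L)$ is PI, $L_0$ is abelian, $L$ is nilpotent, and either $(L_1,L_1)=0$, or $\dim L_1\leq 1$ and $(L_0,L_1)=0$.
   Context: A Lie superalgebra over a field $\mathbb{F}$ of characteristic different from $2$ is a $\mathbb{Z}_2$-graded vector space $L=L_0\oplus L_1$ with a bilinear bracket $(\,,)$ satisfying $(L_i,L_j)\subseteq L_{i+j}$, $(a,b)=-(-1)^{|a||b|}(b,a)$ and $(a,(b,c))=((a,b),c)+(-1)^{|a||b|}(b,(a,c))$ for homogeneous $a,b,c$, where $|a|\in\mathbb{Z}_2$ is the degree of $a$. Here $L$ may be infinite-dimensional. The adjoint map of $x\in L$ (the bracket with $x$, as a linear map $L\to L$) is denoted $\operatorname{ad} x$. For subspaces $H,K\subseteq L$, $(H,K)$ denotes the linear span of all $(h,k)$, $h\in H$, $k\in K$. ''$L_0$ is abelian'' means $(L_0,L_0)=0$. $L$ is nilpotent if $\gamma_n(L)=0$ for some $n$, where $\gamma_1(L)=L$ and $\gamma_{n+1}(L)=(\gamma_n(L),L)$. The enveloping algebra $U(L)$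 is the quotient of the tensor algebra of $L$ by the ideal generated by all $a\otimes b-(-1)^{|a||b|}b\otimes a-(a,b)$, with $a,b\in L$ homogeneous. An associative algebra is PI if it satisfies a nontrivial polynomial identity over the ground field. For an associative algebra $R$, put $[a,b]=ab-ba$ (the ordinary commutator, not a supercommutator) and $[a_1,\ldots,a_{k+1}]=[[a_1,\ldots,a_k],a_{k+1}]$. $R$ is bounded Lie Engel (i.e. satisfies the Engel condition) if there is an integer $n\ge 1$ such that $[x,\underbrace{y,\ldots,y}_{n}]=0$ for all $x,y\in R$. *)

(* Defs.v *)
From HB Require Import structures.
From mathcomp Require Import all_boot all_algebra.
From mathcomp Require Import boolp.
From mathcomp Require Import finmap.
From mathcomp.multinomials Require Import monalg.

Set Implicit Arguments.
Unset Strict Implicit.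
Unset Printing Implicit Defensive.

Import GRing.Theory.
Local Open Scope ring_scope.
Local Open Scope quotient_scope.

Definition lspan (F : fieldType) (V : lmodType F) (S : V -> Prop) (x : V) :=
  exists (n : nat) (c : 'I_n -> F) (v : 'I_n -> V),
    (forall i, S (v i)) /\ x = \sum_i c i *: v i.

Definition subspace (F : fieldType) (V : lmodType F) (S : V -> Prop) :=
  S 0 /\ forall (c : F) x y, S x -> S y -> S (c *: x + y).

Definition dim_le (F : fieldType) (V : lmodType F) (S : V -> Prop) (n : nat) :=
  exists e : 'I_n -> V,
    (forall i, S (e i)) /\
    forall x, S x -> exists c : 'I_n -> F, x = \sum_i c i *: e i.

(* The grading group Z_2 is [bool] with [addb]; [false] is the even degree.
   The notion is the intended one only when 2 != 0 in F. *)
HB.mixin Record isLieSuperalgebra (F : fieldType) L of GRing.Lmodule F L := {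
  sbracket : L -> L -> L;
  hom : bool -> L -> Prop;
  hom_subspace : forall i, subspace (hom i);
  hom_sum : forall x, exists x0 x1,
    [/\ hom false x0, hom true x1 & x = x0 + x1];
  hom_direct : forall x, hom false x -> hom true x -> x = 0;
  sbracketPl : forall (c : F) x y z,
    sbracket (c *: x + y) z = c *: sbracket x z + sbracket y z;
  sbracketPr : forall (c : F) x y z,
    sbracket z (c *: x + y) = c *: sbracket z x + sbracket z y;
  hom_sbracket : forall i j a b,
    hom i a -> hom j b -> hom (i (+) j) (sbracket a b);
  sbracketC : forall i j a b, hom i a -> hom j b ->
    sbracket a b = - ((-1) ^+ (i && j) *: sbracket b a);
  sbracketJ : forall i j a b c, hom i a -> hom j b ->
    sbracket a (sbracket b c) =
      sbracket (sbracket a b) c + (-1) ^+ (i && j) *: sbracket b (sbracket a c)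
}.

#[short(type="lieSuperalgType")]
HB.structure Definition LieSuperalgebra (F : fieldType) :=
  {L of GRing.Lmodule F L & isLieSuperalgebra F L}.

Section LieNotions.
Variables (F : fieldType) (L : lieSuperalgType F).

Definition even_part : L -> Prop := hom false.
Definition odd_part : L -> Prop := hom true.

Definition ad (x : L) : L -> L := sbracket x.

Definition bracket_sp (H K : L -> Prop) : L -> Prop :=
  lspan (fun z => exists h k, [/\ H h, K k & z = sbracket h k]).

Definition trivial_sp (H : L -> Prop) := forall z, H z -> z = 0.

(* [lcs n] is gamma_(n+1)(L). *)
Fixpoint lcs (n : nat) : L -> Prop :=
  if n is m.+1 then bracket_sp (lcs m) (fun=> True) else fun=> True.

Definition nilpotent_alg := exists n, trivial_sp (lcs n).

Definition ad_nilpotent (x : L) := exists n, forall y, iter n (ad x) y = 0.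

End LieNotions.

Arguments even_part {F} L _.
Arguments odd_part {F} L _.
Arguments nilpotent_alg {F} L.

(* [idealr] already provides 1 \notin I and stability under left products. *)
HB.mixin Record isRightStable (R : nzRingType) (S : R -> bool) := {
  right_stable_subproof : forall a u : R, S u -> S (u * a)
}.

#[short(type="ideal2")]
HB.structure Definition Ideal2 (R : nzRingType) :=
  {S of Idealr R S & isRightStable R S}.

(* An alias, as {ideal_quot I} carries a ring structure only for commutative rings. *)
Definition quot_alg (R : nzRingType) (I : ideal2 R) : Type := {ideal_quot I}.

Section QuotientAlgebra.
Variables (F : fieldType) (A : algType F) (I : ideal2 A).

HB.instance Definition _ := GRing.Zmodule.on (quot_alg I).

Definition qpi (x : A) : quot_alg I := \pi_({ideal_quot I}) x.

Let qrep (x : quot_alg I) : A := repr (x : {ideal_quot I}).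

Let qrepK x : qpi (qrep x) = x. Proof. exact: reprK. Qed.

Lemma qpi_eq x y : (qpi x = qpi y) <-> (x - y \in I).
Proof. by rewrite Quotient.idealrBE; split=> [/eqP|/eqP]. Qed.

Lemma qpi_is_zmod : zmod_morphism qpi.
Proof. exact: (raddfB (\pi_({ideal_quot I}))). Qed.

HB.instance Definition _ :=
  GRing.isZmodMorphism.Build A (quot_alg I) qpi qpi_is_zmod.

Lemma qpi_eq0 x : (qpi x = 0) <-> (x \in I).
Proof. by rewrite -(raddf0 qpi) qpi_eq subr0. Qed.

Definition qone : quot_alg I := qpi 1.
Definition qmul (x y : quot_alg I) := qpi (qrep x * qrep y).
Definition qscale (c : F) (x : quot_alg I) := qpi (c *: qrep x).

Let qrep_pi x : qrep (qpi x) - x \in I.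
Proof. by apply/qpi_eq; rewrite qrepK. Qed.

Lemma qmulE x y : qmul (qpi x) (qpi y) = qpi (x * y).
Proof.
apply/qpi_eq; rewrite -[_ * _](subrK (qrep (qpi x) * y)) -mulrBr -addrA -mulrBl.
by apply: rpredD; [apply: idealMr | apply: right_stable_subproof]; exact: qrep_pi.
Qed.

Lemma qscaleE c x : qscale c (qpi x) = qpi (c *: x).
Proof.
apply/qpi_eq; rewrite -scalerBr -mulr_algl; apply: idealMr; exact: qrep_pi.
Qed.

Let qind (P : quot_alg I -> Prop) : (forall x, P (qpi x)) -> forall x, P x.
Proof. by move=> h x; rewrite -(qrepK x). Qed.

Fact qmulA : associative qmul.
Proof.
elim/qind=> x; elim/qind=> y; elim/qind=> z.
by rewrite !qmulE mulrA.
Qed.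

Fact qmul1r : left_id qone qmul.
Proof. by elim/qind=> x; rewrite qmulE mul1r. Qed.

Fact qmulr1 : right_id qone qmul.
Proof. by elim/qind=> x; rewrite qmulE mulr1. Qed.

Fact qmulDl : left_distributive qmul +%R.
Proof.
elim/qind=> x; elim/qind=> y; elim/qind=> z.
by rewrite -raddfD !qmulE mulrDl raddfD.
Qed.

Fact qmulDr : right_distributive qmul +%R.
Proof.
elim/qind=> x; elim/qind=> y; elim/qind=> z.
by rewrite -raddfD !qmulE mulrDr raddfD.
Qed.

Fact qone_neq0 : qone != 0.
Proof. by apply/eqP=> /qpi_eq0; rewrite idealr1. Qed.

HB.instance Definition _ := GRing.Zmodule_isNzRing.Build (quot_alg I)
  qmulA qmul1r qmulr1 qmulDl qmulDr qone_neq0.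

Fact qscaleA a b v : qscale a (qscale b v) = qscale (a * b) v.
Proof. by elim/qind: v => v; rewrite !qscaleE scalerA. Qed.

Fact qscale1 : left_id 1 qscale.
Proof. by elim/qind=> v; rewrite qscaleE scale1r. Qed.

Fact qscaleDr : right_distributive qscale +%R.
Proof.
move=> c; elim/qind=> x; elim/qind=> y.
by rewrite -raddfD !qscaleE scalerDr raddfD.
Qed.

Fact qscaleDl v : {morph qscale^~ v : a b / a + b}.
Proof. by move=> a b; elim/qind: v => v; rewrite !qscaleE scalerDl raddfD. Qed.

HB.instance Definition _ := GRing.Zmodule_isLmodule.Build F (quot_alg I)
  qscaleA qscale1 qscaleDr qscaleDl.

Fact qscaleAl (c : F) (x y : quot_alg I) : c *: (x * y) = (c *: x) * y.
Proof.
elim/qind: x => x; elim/qind: y => y.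
by rewrite [LHS](congr1 _ (qmulE x y)) [LHS]qscaleE scalerAl -qmulE -qscaleE.
Qed.

HB.instance Definition _ := GRing.Lmodule_isLalgebra.Build F (quot_alg I)
  qscaleAl.

Fact qscaleAr (c : F) (x y : quot_alg I) : c *: (x * y) = x * (c *: y).
Proof.
elim/qind: x => x; elim/qind: y => y.
by rewrite [LHS](congr1 _ (qmulE x y)) [LHS]qscaleE scalerAr -qmulE -qscaleE.
Qed.

HB.instance Definition _ := GRing.Lalgebra_isAlgebra.Build F (quot_alg I)
  qscaleAr.

Fact qpi_is_monoid_morphism : monoid_morphism qpi.
Proof. by split=> // x y; rewrite -qmulE. Qed.

HB.instance Definition _ :=
  GRing.isMonoidMorphism.Build A (quot_alg I) qpi qpi_is_monoid_morphism.

Fact qpi_is_scalable : scalable qpi.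
Proof. by move=> c x; rewrite -qscaleE. Qed.

HB.instance Definition _ :=
  GRing.isScalable.Build F A (quot_alg I) *:%R qpi qpi_is_scalable.

Lemma qpi_surj (x : quot_alg I) : exists a, x = qpi a.
Proof. by exists (qrep x); rewrite qrepK. Qed.

Definition qlift (B : nzRingType) (f : A -> B) (x : quot_alg I) : B :=
  f (qrep x).

Lemma qliftE (B : nzRingType) (f : {rmorphism A -> B}) :
  (forall x, x \in I -> f x = 0) -> forall x, qlift f (qpi x) = f x.
Proof.
by move=> f0 x; apply/eqP; rewrite -subr_eq0 -rmorphB f0 //; exact: qrep_pi.
Qed.

End QuotientAlgebra.

Inductive ideal_gen (R : nzRingType) (S : R -> Prop) : R -> Prop :=
| IdealGen x of S x : ideal_gen S x
| Ideal0 : ideal_gen S 0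
| IdealB x y of ideal_gen S x & ideal_gen S y : ideal_gen S (x - y)
| IdealMl a x of ideal_gen S x : ideal_gen S (a * x)
| IdealMr a x of ideal_gen S x : ideal_gen S (x * a).

Lemma ideal_gen_ker (R B : nzRingType) (S : R -> Prop) (f : R -> B) :
    zmod_morphism f -> {morph f : x y / x * y} ->
    (forall x, S x -> f x = 0) -> forall x, ideal_gen S x -> f x = 0.
Proof.
move=> fB fM fS x; elim=> {x} [//||x y _ fx _ fy|a x _ fx|a x _ fx].
- by rewrite -[0 in LHS](subrr 0) fB subrr.
- by rewrite fB fx fy subrr.
- by rewrite fM fx mulr0.
- by rewrite fM fx mul0r.
Qed.

Section GeneratedIdeal.
Variables (R : nzRingType) (S : R -> Prop).

Definition ideal_pred : {pred R} := fun x => `[< ideal_gen S x >].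

Lemma ideal_predP x : reflect (ideal_gen S x) (x \in ideal_pred).
Proof. exact: asboolP. Qed.

Lemma ideal_pred_zmod : zmod_closed ideal_pred.
Proof.
split; first by apply/ideal_predP; exact: Ideal0.
by move=> x y /ideal_predP Ix /ideal_predP Iy; apply/ideal_predP; exact: IdealB.
Qed.

Lemma ideal_pred_proper : ~ ideal_gen S 1 -> ring_quotient.proper_ideal ideal_pred.
Proof.
move=> n1; split; first by apply/ideal_predP.
by move=> a x /ideal_predP Ix; apply/ideal_predP; exact: IdealMl.
Qed.

Lemma ideal_pred_right a u : ideal_pred u -> ideal_pred (u * a).
Proof. by move=> /ideal_predP Iu; apply/ideal_predP; exact: IdealMr. Qed.

End GeneratedIdeal.

(* An alias, as {malg F[K]} is an algType only for commutative K. *)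
Definition free_alg (F : fieldType) (X : choiceType) : Type :=
  {malg F[{fmonom X}]}.

Section FreeAlgebra.
Variables (F : fieldType) (X : choiceType).

HB.instance Definition _ := GRing.Lalgebra.on (free_alg F X).

Fact free_alg_scalerAr (c : F) (x y : free_alg F X) :
  c *: (x * y) = x * (c *: y).
Proof.
apply/malgP=> k; rewrite mcoeffZ.
rewrite (mcoeffMlw _ (fsubset_refl (msupp x)) (msuppZ_le c y)) mcoeffMl mulr_sumr.
apply: eq_bigr => k1 _; rewrite mulr_sumr; apply: eq_bigr => k2 _.
by rewrite mcoeffZ mulrnAr mulrCA.
Qed.

HB.instance Definition _ :=
  GRing.Lalgebra_isAlgebra.Build F (free_alg F X) free_alg_scalerAr.

Definition fvar (x : X) : free_alg F X := << fmu x >>.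

Definition fbar (f : free_alg F X) : F := mcoeff (mone : {fmonom X}) f.

HB.instance Definition _ :=
  GRing.isZmodMorphism.Build (free_alg F X) F fbar (raddfB (mcoeff mone)).
HB.instance Definition _ := GRing.isMonoidMorphism.Build (free_alg F X) F fbar
  (rmorph1 (mcoeff mone), rmorphM (mcoeff mone)).

Lemma fbar_fvar x : fbar (fvar x) = 0.
Proof.
rewrite /fbar /fvar mcoeffU; case: eqP => // /(congr1 val).
by rewrite /= fmU fm1.
Qed.

Lemma fbarZ c f : fbar (c *: f) = c * fbar f.
Proof. exact: mcoeffZ. Qed.

End FreeAlgebra.

(* The value of a noncommutative polynomial f at v : X -> R. *)
Definition nc_eval (F : fieldType) (X : choiceType) (R : algType F)
    (v : X -> R) (f : free_alg F X) : R :=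
  mmap (in_alg R) (fun m : {fmonom X} => \prod_(x <- m) v x) f.

Definition is_PI (F : fieldType) (R : algType F) :=
  exists2 f : free_alg F nat, f != 0 & forall v : nat -> R, nc_eval v f = 0.

Arguments is_PI {F} R.

Section Engel.
Variable R : pzRingType.

Definition comm (a b : R) : R := a * b - b * a.

(* [lcomm a [:: a_2; ...; a_k]] is [a, a_2, ..., a_k], nested to the left. *)
Definition lcomm (a : R) (s : seq R) : R := foldl comm a s.

Definition bounded_engel :=
  exists2 n : nat, (0 < n)%N & forall x y : R, lcomm x (nseq n y) = 0.

End Engel.

Arguments bounded_engel : clear implicits.

Section TensorAlgebra.
Variables (F : fieldType) (V : lmodType F).

(* T(V) is the free algebra on the set V modulo linearity of V -> T(V). *)
Inductive lin_rel : free_alg F V -> Prop :=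
| LinRel (c : F) (x y : V) :
    lin_rel (fvar F (c *: x + y) - (c *: fvar F x + fvar F y)).

Lemma fbar_lin_rel f : lin_rel f -> fbar f = 0.
Proof.
by case=> c x y; rewrite rmorphB rmorphD /= fbarZ !fbar_fvar mulr0 addr0 subrr.
Qed.

Lemma fbar_lin_ideal f : ideal_gen lin_rel f -> fbar f = 0.
Proof.
apply: (ideal_gen_ker _ _ fbar_lin_rel); [exact: raddfB | exact: rmorphM].
Qed.

Lemma lin_ideal_proper : ~ ideal_gen lin_rel 1.
Proof. by move=> /fbar_lin_ideal /eqP; rewrite rmorph1 oner_eq0. Qed.

Definition lin_ideal : {pred free_alg F V} := ideal_pred lin_rel.

HB.instance Definition _ :=
  GRing.isZmodClosed.Build (free_alg F V) lin_ideal (ideal_pred_zmod _).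
HB.instance Definition _ :=
  isProperIdeal.Build (free_alg F V) lin_ideal
    (ideal_pred_proper lin_ideal_proper).
HB.instance Definition _ :=
  isRightStable.Build (free_alg F V) lin_ideal (@ideal_pred_right _ _).

Definition tensor_alg : Type := quot_alg lin_ideal.

HB.instance Definition _ := GRing.Algebra.on tensor_alg.

Definition tens (x : V) : tensor_alg := qpi lin_ideal (fvar F x).

Lemma tens_is_linear : linear tens.
Proof.
move=> c x y; rewrite /tens -linearP; apply/qpi_eq/ideal_predP.
exact/IdealGen/LinRel.
Qed.

HB.instance Definition _ :=
  GRing.isLinear.Build F V tensor_alg *:%R tens tens_is_linear.

Definition tbar : tensor_alg -> F := @qlift F _ lin_ideal F (@fbar F V).

Lemma tbarE f : tbar (qpi lin_ideal f) = fbar f.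
Proof. by apply: qliftE => {}f /ideal_predP; exact: fbar_lin_ideal. Qed.

Lemma tbar_is_zmod : zmod_morphism tbar.
Proof.
move=> x y; have [a ->] := qpi_surj x; have [b ->] := qpi_surj y.
by rewrite -raddfB !tbarE raddfB.
Qed.

Lemma tbar_is_monoid : monoid_morphism tbar.
Proof.
split; first by rewrite -(rmorph1 (qpi lin_ideal)) tbarE rmorph1.
move=> x y; have [a ->] := qpi_surj x; have [b ->] := qpi_surj y.
by rewrite -rmorphM !tbarE rmorphM.
Qed.

HB.instance Definition _ :=
  GRing.isZmodMorphism.Build tensor_alg F tbar tbar_is_zmod.
HB.instance Definition _ :=
  GRing.isMonoidMorphism.Build tensor_alg F tbar tbar_is_monoid.

Lemma tbarZ c x : tbar (c *: x) = c * tbar x.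
Proof.
by have [a ->] := qpi_surj x; rewrite -linearZ !tbarE fbarZ.
Qed.

Lemma tbar_tens x : tbar (tens x) = 0.
Proof. by rewrite tbarE fbar_fvar. Qed.

End TensorAlgebra.

Section Enveloping.
Variables (F : fieldType) (L : lieSuperalgType F).

Inductive env_rel : tensor_alg L -> Prop :=
| EnvRel (i j : bool) (a b : L) of hom i a & hom j b :
    env_rel (tens a * tens b - (-1) ^+ (i && j) *: (tens b * tens a)
             - tens (sbracket a b)).

Lemma env_ideal_proper : ~ ideal_gen env_rel 1.
Proof.
have rel0 f : env_rel f -> tbar f = 0.
  case=> i j a b _ _.
  by rewrite !rmorphB /= tbarZ !rmorphM /= !tbar_tens !mul0r mulr0 !subr0.
move=> /(ideal_gen_ker _ _ rel0) /eqP; rewrite rmorph1 oner_eq0 => H.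
suff: false by []; apply: H; [exact: raddfB | exact: rmorphM].
Qed.

Definition env_ideal : {pred tensor_alg L} := ideal_pred env_rel.

HB.instance Definition _ :=
  GRing.isZmodClosed.Build (tensor_alg L) env_ideal (ideal_pred_zmod _).
HB.instance Definition _ :=
  isProperIdeal.Build (tensor_alg L) env_ideal
    (ideal_pred_proper env_ideal_proper).
HB.instance Definition _ :=
  isRightStable.Build (tensor_alg L) env_ideal (@ideal_pred_right _ _).

Definition env_alg : Type := quot_alg env_ideal.

HB.instance Definition _ := GRing.Algebra.on env_alg.

End Enveloping.

(* Main.v *)
(* (1) => (2): in characteristic p the Engel condition means that for some m all the powers u^(p^m)
   of elements of U(L) are central.  Extending supersymmetric multilinear forms from the words of degree n to U(L),
   which is a dual form of the Poincare-Birkhoff-Witt theorem, gives the functionals showing that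
   suitable products in U(L) do not vanish; centrality then forces (L_0,L_0) = 0 and, once (y,y) <> 0
   for some odd y, also (L_0,L_1) = 0 and L_1 = F y.
   (2) => (3), with (L_1,L_1) = 0: U(L) acts on the right on the alternating forms on L_1.  Evaluating
   a multilinear identity on wedge products l /\ d, with l killing a finite-dimensional space, yields
   subspaces A of L_0 and V of L_1, of finite codimension, such that (A,V) is finite-dimensional.
   Commuting nilpotent operators on a space of dimension k have product 0 as soon as there are k of
   them, so all long words in ad L_0 kill L_1.
   (3) => (1), with (L_1,L_1) = 0: U(L) is the sum of the commutative subalgebra generated by L_0,
   whose p^m-th powers are central, and of the ideal J generated by L_1, so it is enough that J is nil
   of bounded index.  Modulo the nilpotent ideal generated by a finite-dimensional L_0-stable space
   containing (A,V), U(L) is a finitely generated right module over a supercommutative algebra, and a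
   fixed power of every element of J acts on it by a matrix whose entries are sums of homogeneous
   elements z with z^p = 0. *)

(* [L] may be infinite-dimensional, and no basis of U(L) is ever constructed: whatever must be
   nonzero or independent is detected by linear functionals, and U(L) enters through the interface
   [enveloping], i.e. generation by words and extension of functionals compatible with the
   relations. The assumption for p = 3 serves the straightening of three equal odd letters; for
   larger p it follows from the Jacobi identity. The identity is evaluated on factors v_i a_i, v_i
   odd and a_i even, one variable being specialised to a single odd v. Each factor contracts and
   then takes a Lie derivative, so l stays outside the form except where it is composed with some ad
   a_i. The a_i being fixed and finite in number, such terms are nilpotent perturbations and can be
   inverted away. Peeling off variables ends either with a nonzero partial value, to which this
   applies, or with L_1 = 0. For (3) => (1) exponents must be uniform: they depend on the bound for
   words in ad L_0 and on the sizes of finite complements of A and V, never on the element. If dim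
   L_1 <= 1 and (L_0,L_1) = 0, then U(L) is commutative. *)
From HB Require Import structures.
From mathcomp Require Import all_boot all_algebra.
From mathcomp Require Import boolp wochoice ring.
From mathcomp Require Import finmap.
From mathcomp.multinomials Require Import monalg.
Require Import Defs.

Set Implicit Arguments.
Unset Strict Implicit.
Unset Printing Implicit Defensive.

Import GRing.Theory.
Local Open Scope ring_scope.

(** * Spans and separating functionals *)

Section Spans.
Variables (F : fieldType) (V : lmodType F).
Implicit Types (S P : V -> Prop) (x y : V).

(** The same set as [lspan] (see [lspanE]), built by adding one generator at a time, so that
    arguments on spans become inductions instead of manipulations of indexed sums. *)
Inductive span S : V -> Prop :=
| span0 : span S 0
| spanP (c : F) x y of S x & span S y : span S (c *: x + y).

Lemma subspaceD P x y : subspace P -> P x -> P y -> P (x + y).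
Proof. by case=> _ h Px Py; rewrite -[x]scale1r; apply: h. Qed.

Lemma subspaceZ P c x : subspace P -> P x -> P (c *: x).
Proof. by case=> h0 h Px; rewrite -[_ *: _]addr0; apply: h. Qed.

Lemma subspaceN P x : subspace P -> P x -> P (- x).
Proof. by move=> hP Px; rewrite -scaleN1r; apply: subspaceZ. Qed.

Lemma subspaceB P x y : subspace P -> P x -> P y -> P (x - y).
Proof. by move=> hP Px Py; apply: subspaceD => //; apply: subspaceN. Qed.

Lemma subspace_sum P (I : eqType) (r : seq I) (E : I -> V) : subspace P ->
  (forall i, i \in r -> P (E i)) -> P (\sum_(i <- r) E i).
Proof.
move=> hP hE; elim: r hE => [|i r ih] hE; first by rewrite big_nil; case: hP.
rewrite big_cons; apply: subspaceD => //; first by apply: hE; rewrite mem_head.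
by apply: ih => j jr; apply: hE; rewrite inE jr orbT.
Qed.

Lemma span_id S x : S x -> span S x.
Proof. by move=> Sx; rewrite -[x]scale1r -[_ *: _]addr0; apply: spanP => //; exact: span0. Qed.

Lemma span_min S P : subspace P -> (forall x, S x -> P x) -> forall x, span S x -> P x.
Proof. by case=> h0 h hS x; elim=> // c {}x y Sx _ Py; apply: h => //; apply: hS. Qed.

Lemma span_subspace S : subspace (span S).
Proof.
split=> [|c x y Sx Sy]; first exact: span0.
elim: Sx => [|d {}x x' Sx _ ih]; first by rewrite scaler0 add0r.
by rewrite scalerDr scalerA -addrA; apply: spanP.
Qed.

Lemma span_sub S S' : (forall x, S x -> span S' x) -> forall x, span S x -> span S' x.
Proof. by move=> h; apply: span_min => //; exact: span_subspace. Qed.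

Lemma span_mono S S' : (forall x, S x -> S' x) -> forall x, span S x -> span S' x.
Proof. by move=> h; apply: span_sub => x /h; exact: span_id. Qed.

Lemma lspanE S x : lspan S x <-> span S x.
Proof.
split=> [[n [c [v [Sv ->]]]]|].
  apply: subspace_sum => [|i _]; first exact: span_subspace.
  by apply: subspaceZ (span_subspace _) _; apply: span_id.
elim=> [|c {}x y Sx _ [n [d [v [Sv ->]]]]].
  by exists 0%N, (fun=> 0), (fun=> 0); split=> [[]//|]; rewrite big_ord0.
exists n.+1, (fun i : 'I_n.+1 => if unlift ord0 i is Some j then d j else c).
exists (fun i : 'I_n.+1 => if unlift ord0 i is Some j then v j else x).
split=> [i|]; first by case: unliftP.
by rewrite big_ord_recl unlift_none; congr (_ + _); apply: eq_bigr => i _; rewrite liftK.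
Qed.

Lemma span_comb S x : span S x -> exists r : seq (F * V),
  (forall i, i \in r -> S i.2) /\ x = \sum_(i <- r) i.1 *: i.2.
Proof.
elim=> [|c {}x y Sx _ [r [hr ->]]]; first by exists [::]; rewrite big_nil.
exists ((c, x) :: r); rewrite big_cons; split=> // i; rewrite inE => /orP[/eqP->//|].
exact: hr.
Qed.

Lemma spanU S P x : subspace P -> span (fun z => P z \/ S z) x ->
  exists p s, [/\ P p, span S s & x = p + s].
Proof.
move=> hP; elim=> [|c {}x y [Px|Sx] _ [p [s [Pp Ss ->]]]].
- by exists 0, 0; split; [case: hP | exact: span0 | rewrite addr0].
- exists (c *: x + p), s; split=> //; last by rewrite addrA.
  by case: hP => _; apply.
- exists p, (c *: x + s); split=> //; first exact: spanP.
  by rewrite addrCA.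
Qed.

Lemma span_cons (e : V) (s : seq V) x : span (fun z => z \in e :: s) x <->
  exists c, span (fun z => z \in s) (x - c *: e).
Proof.
split=> [|[c h]].
  elim=> [|d {}x y]; first by exists 0; rewrite scale0r subr0; exact: span0.
  rewrite inE => /orP[/eqP->|xs] _ [c hc].
    by exists (d + c); rewrite scalerDl opprD addrACA subrr add0r.
  by exists c; rewrite -addrA; apply: spanP.
rewrite -(subrK (c *: e) x) addrC; apply: spanP; first by rewrite mem_head.
by apply: span_mono h => z; rewrite inE orbC => ->.
Qed.

Definition lin (f : V -> F) := forall (c : F) x y, f (c *: x + y) = c * f x + f y.

Lemma lin0 f : lin f -> f 0 = 0.
Proof. by move=> hf; have := hf (-1) 0 0; rewrite scaler0 add0r mulN1r addNr. Qed.

Lemma linD f x y : lin f -> f (x + y) = f x + f y.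
Proof. by move=> hf; rewrite -[x]scale1r hf mul1r scale1r. Qed.

Lemma linZ f c x : lin f -> f (c *: x) = c * f x.
Proof. by move=> hf; rewrite -[_ *: _]addr0 hf lin0 // addr0. Qed.

Lemma linN f x : lin f -> f (- x) = - f x.
Proof. by move=> hf; rewrite -scaleN1r linZ // mulN1r. Qed.

Lemma linB f x y : lin f -> f (x - y) = f x - f y.
Proof. by move=> hf; rewrite linD // linN. Qed.

Lemma lin_sum f (I : Type) (r : seq I) (E : I -> V) : lin f ->
  f (\sum_(i <- r) E i) = \sum_(i <- r) f (E i).
Proof.
move=> hf; elim: r => [|i r ih]; first by rewrite !big_nil lin0.
by rewrite !big_cons linD // ih.
Qed.

Lemma ker_subspace f : lin f -> subspace (fun x => f x = 0).
Proof. by move=> hf; split=> [|c x y hx hy]; rewrite ?lin0 // hf hx hy mulr0 add0r. Qed.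

Lemma lin_span f g S : lin f -> lin g -> (forall x, S x -> f x = g x) ->
  forall x, span S x -> f x = g x.
Proof.
move=> hf hg e x; elim=> [|c {}x y Sx _ ih]; first by rewrite !lin0.
by rewrite hf hg ih e.
Qed.

Lemma span_perm (s t : seq V) x : s =i t ->
  span (fun z => z \in s) x -> span (fun z => z \in t) x.
Proof. by move=> st; apply: span_mono => z; rewrite st. Qed.

(** Steinitz exchange. If [t0 ++ es] without its vector [e] still spans [S], drop [e]; otherwise
    some [x] in [S] has a nonzero coefficient at [e] and can take its place. *)
Lemma span_exchange S (es t0 : seq V) :
    (forall x, S x -> span (fun z => z \in t0 ++ es) x) ->
  exists t, [/\ (forall z, z \in t -> S z), (size t <= size es)%N &
    forall x, S x -> span (fun z => z \in t0 ++ t) x].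
Proof.
elim: es t0 => [|e es ih] t0 hS; first by exists [::].
have [/ih[t [tS ts ht]]|/existsNP[x /not_implyP[Sx nx]]] :=
    pselect (forall x, S x -> span (fun z => z \in t0 ++ es) x).
  by exists t; split=> //; apply: ltnW.
have perm1 y : y \in t0 ++ e :: es = (y \in e :: t0 ++ es).
  by rewrite !(inE, mem_cat) orbCA.
have /(span_perm perm1)/span_cons[c hc] := hS _ Sx.
have c0 : c != 0 by apply: contra_notN nx => /eqP c0; move: hc; rewrite c0 scale0r subr0.
have he : span (fun z => z \in (x :: t0) ++ es) e.
  apply/span_cons; exists c^-1.
  have -> : e - c^-1 *: x = (- c^-1) *: (x - c *: e).
    by rewrite scalerBr !scaleNr scalerA mulVf // scale1r opprK addrC.
  exact/(subspaceZ _ (span_subspace _)).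
have [t [tS ts ht]] : exists t, [/\ (forall z, z \in t -> S z), (size t <= size es)%N &
    forall y, S y -> span (fun z => z \in (x :: t0) ++ t) y].
  apply: ih => y /hS; apply: span_sub => z; rewrite perm1 inE => /orP[/eqP->//|zt].
  by apply: span_id; rewrite inE zt orbT.
exists (x :: t); split=> // [z|y /ht].
  by rewrite inE => /orP[/eqP->//|/tS].
by apply: span_perm => z; rewrite !(inE, mem_cat) orbCA.
Qed.
End Spans.

Section WellOrder.
Variable T : eqType.

(** Used twice: to choose a basis greedily, and to order the letters when words are straightened. *)
Definition worder : rel T := sval (well_ordering_principle T).

Let woR : well_order worder := svalP (well_ordering_principle T).

Lemma worder_min (P : T -> Prop) x : P x -> exists2 z, P z & forall y, P y -> worder z y.
Proof.
move=> Px; have [|z [[/asboolP Pz lz] _]] := woR (A := fun x => `[< P x >]).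
  by exists x; apply/asboolP.
by exists z => // y Py; apply: lz; apply/asboolP.
Qed.

Lemma worder_refl x : worder x x.
Proof. by have [z -> h] := worder_min (erefl x); apply: h. Qed.

Lemma worder_total x y : worder x y || worder y x.
Proof.
have [z [->|->] h] := worder_min (P := fun z => z = x \/ z = y) (or_introl (erefl x)).
  by rewrite h //; right.
by rewrite [X in _ || X]h ?orbT //; left.
Qed.

Lemma worder_anti x y : worder x y -> worder y x -> x = y.
Proof.
move=> xy yx.
have [|z [_ u]] := woR (A := fun z => (z == x) || (z == y)).
  by exists x; rewrite unfold_in eqxx.
have lx : minimum_of worder (fun z => (z == x) || (z == y)) x.
  by split=> [|t]; rewrite unfold_in ?eqxx // => /orP[]/eqP-> //; exact: worder_refl.
have ly : minimum_of worder (fun z => (z == x) || (z == y)) y.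
  by split=> [|t]; rewrite unfold_in ?eqxx ?orbT // => /orP[]/eqP-> //; exact: worder_refl.
by rewrite -(u _ lx) -(u _ ly).
Qed.

Lemma worder_trans x y z : worder x y -> worder y z -> worder x z.
Proof.
move=> xy yz; have [t ht lt] := worder_min (P := fun t => [\/ t = x, t = y | t = z]) (Or31 _ _ (erefl x)).
have lx : worder t x by apply: lt; apply: Or31.
have ly : worder t y by apply: lt; apply: Or32.
have lz : worder t z by apply: lt; apply: Or33.
case: ht => e; rewrite {}e in lx ly lz; first exact: lz.
  by rewrite (worder_anti xy lx).
by rewrite -(worder_anti yz ly).
Qed.

End WellOrder.

(** * Bases modulo a subspace, chosen inside a spanning set *)

Section AdaptedBasis.
Variables (F : fieldType) (V : lmodType F) (E S : V -> Prop).
Hypothesis subE : subspace E.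

(** Greedy choice along [worder]: an element of [S] is kept when it is not in the span of [E] and of
    the smaller elements of [S]. With [S] the set of homogeneous elements the basis is
    homogeneous. *)
Definition abasis x :=
  S x /\ ~ span (fun z => E z \/ (S z /\ (worder z x /\ z != x))) x.

Lemma abasis_span x : S x -> span (fun z => E z \/ abasis z) x.
Proof.
move=> Sx; apply: contrapT => nx.
have [y [Sy ny] ly] := worder_min (P := fun y => S y /\ ~ span (fun z => E z \/ abasis z) y) (conj Sx nx).
apply: (ny); apply: span_id; right; split=> // hy; apply: ny; move: hy.
apply: span_sub => z [Ez|[Sz [zy nzy]]]; first by apply: span_id; left.
apply: contrapT => nz; have yz := ly z (conj Sz nz).
by rewrite (worder_anti zy yz) eqxx in nzy.
Qed.

(** A vector may occur several times in [r]. [cval h r] is the value at [comb r] forced upon a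
    linear extension of [h]. *)
Let comb (r : seq (F * V)) := \sum_(i <- r) i.1 *: i.2.
Let cval (h : V -> F) (r : seq (F * V)) := \sum_(i <- r) i.1 * h i.2.

Lemma worder_max (r : seq (F * V)) : r != [::] ->
  exists2 i, i \in r & forall j, j \in r -> worder j.2 i.2.
Proof.
elim: r => // i [|i' r] ih _.
  by exists i; rewrite ?mem_head // => j; rewrite inE => /eqP->; exact: worder_refl.
have [//|m mr hm] := ih; have [im|mi] := orP (worder_total i.2 m.2).
  exists m; first by rewrite inE mr orbT.
  by move=> j; rewrite inE => /orP[/eqP->//|/hm].
exists i; first exact: mem_head.
by move=> j; rewrite inE => /orP[/eqP->|/hm jm]; [exact: worder_refl | exact: worder_trans mi].
Qed.

(* Coefficient extraction: drop the largest basis vector once its total coefficient is known to vanish. *)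
Lemma comb_ind (P : seq (F * V) -> Prop) : P [::] ->
    (forall r k, (forall i, i \in r -> abasis i.2) -> abasis k ->
      (forall i, i \in r -> worder i.2 k) ->
      P [seq i <- r | i.2 != k] -> P r) ->
  forall r, (forall i, i \in r -> abasis i.2) -> P r.
Proof.
move=> P0 PS r; move: {2}(size r) (leqnn (size r)) => n.
elim: n r => [|n ih] r; first by rewrite leqn0 => /nilP->.
move=> sr hr; have [->//|r0] := eqVneq r [::].
have [m mr hm] := worder_max r0.
apply: (PS r m.2) => //; first exact: hr.
apply: ih => [|i]; last by rewrite mem_filter => /andP[_ /hr].
rewrite -ltnS (leq_trans _ sr) // size_filter -(count_predC (fun i => i.2 == m.2)).
by rewrite -[X in (X < _)%N]add0n ltn_add2r -has_count; apply/hasP; exists m => /=.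
Qed.

Lemma comb_split r (k : V) : comb r =
  (\sum_(i <- r | i.2 == k) i.1) *: k + comb [seq i <- r | i.2 != k].
Proof.
rewrite /comb (bigID (fun i : F * V => i.2 == k)) /= big_filter scaler_suml; congr (_ + _).
by apply: eq_bigr => i /eqP->.
Qed.

Lemma cval_split h r (k : V) : cval h r =
  (\sum_(i <- r | i.2 == k) i.1) * h k + cval h [seq i <- r | i.2 != k].
Proof.
rewrite /cval (bigID (fun i : F * V => i.2 == k)) /= big_filter mulr_suml; congr (_ + _).
by apply: eq_bigr => i /eqP->.
Qed.

(** Independence modulo [E]: if the largest vector [k] of [r] had a nonzero total coefficient, it
    would lie in the span of [E] and of smaller elements, against [abasis]. *)
Lemma comb_cval h r : (forall i, i \in r -> abasis i.2) -> E (comb r) -> cval h r = 0.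
Proof.
move: r; apply: comb_ind => [_|r k hr [Sk nk] rk ih]; first by rewrite /cval big_nil.
rewrite (comb_split r k) (cval_split h r k); set C := (\sum_(_ <- _ | _) _).
have [->|C0 hE] := eqVneq C 0; first by rewrite scale0r add0r mul0r add0r.
case: nk; set T := (X in span X _); have -> : k = C^-1 *: (C *: k + comb [seq i <- r | i.2 != k])
   - C^-1 *: comb [seq i <- r | i.2 != k].
  by rewrite scalerDr scalerA mulVf // scale1r addrK.
apply: (subspaceB (span_subspace _)); apply: (subspaceZ _ (span_subspace _)).
  by apply: span_id; left.
apply: subspace_sum => [|i]; first exact: span_subspace.
rewrite mem_filter => /andP[ik ir]; apply: (subspaceZ _ (span_subspace _)).
by apply: span_id; right; split; [case: (hr _ ir) | split; [exact: rk ir | exact: ik]].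
Qed.

Lemma cval_comb r : (forall i, i \in r -> abasis i.2) ->
  (forall h, cval h r = 0) -> comb r = 0.
Proof.
move: r; apply: comb_ind => [_|r k hr _ rk ih]; first by rewrite /comb big_nil.
move=> hc; have hC : \sum_(i <- r | i.2 == k) i.1 = 0.
  have := hc (fun x => (x == k)%:R); rewrite (cval_split _ r k) eqxx mulr1.
  rewrite [X in _ + X]/cval big_filter [X in _ + X]big1 ?addr0 // => i /negPf->.
  by rewrite mulr0.
rewrite (comb_split r k) hC scale0r add0r; apply: ih => h.
by rewrite -[RHS](hc h) (cval_split h r k) hC mul0r add0r.
Qed.

Hypothesis spanS : forall x, span S x.

Lemma abasis_comb x : exists e r,
  [/\ E e, (forall i : F * V, i \in r -> abasis i.2) & x = e + comb r].
Proof.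
have : span (fun z => E z \/ abasis z) x by apply: span_sub (spanS x) => y /abasis_span.
by case/(spanU subE) => e [s [Ee /span_comb[r [hr ->]] ->]]; exists e, r.
Qed.

(** The graph [G] of the extension is total because the basis spans modulo [E], and single-valued by
    [comb_cval]; choice turns it into a function. *)
Lemma abasis_ext (h : V -> F) : exists l : V -> F,
  [/\ lin l, (forall x, E x -> l x = 0) & forall x, abasis x -> l x = h x].
Proof.
pose G x v := exists e r, [/\ E e, (forall i : F * V, i \in r -> abasis i.2),
  x = e + comb r & v = cval h r].
have Glin c x v y w : G x v -> G y w -> G (c *: x + y) (c * v + w).
  move=> [e [r [Ee hr -> ->]]] [e' [r' [Ee' hr' -> ->]]].
  exists (c *: e + e'), ([seq (c * i.1, i.2) | i <- r] ++ r'); split.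
  - by case: subE => _; apply.
  - by move=> i; rewrite mem_cat => /orP[/mapP[j /hr jr ->]|/hr'].
  - rewrite scalerDr addrACA /comb big_cat big_map /=; congr (_ + (_ + _)).
    by rewrite scaler_sumr; apply: eq_bigr => i _; rewrite scalerA.
  - rewrite /cval big_cat big_map /=; congr (_ + _).
    by rewrite mulr_sumr; apply: eq_bigr => i _; rewrite mulrA.
have G0 v : G 0 v -> v = 0.
  move=> [e [r [Ee hr /eqP er ->]]]; apply: comb_cval => //.
  by move: er; rewrite eq_sym addr_eq0 => /eqP er; rewrite -[comb r]opprK -er; apply: subspaceN.
have Gu x v w : G x v -> G x w -> v = w.
  move=> gv gw; apply/eqP; rewrite -subr_eq0; apply/eqP/G0.
  by have := Glin (-1) _ _ _ _ gw gv; rewrite scaleN1r addNr mulN1r addrC.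
have Gex x : exists v, G x v.
  by have [e [r [Ee hr ->]]] := abasis_comb x; exists (cval h r), e, r.
have [l hl] := choice Gex; exists l; split.
- by move=> c x y; apply: (Gu _ _ _ (hl _)); apply: Glin.
- move=> x Ex; apply: (Gu _ _ _ (hl _)); exists x, [::].
  by rewrite /comb /cval !big_nil addr0.
- move=> x Bx; apply: (Gu _ _ _ (hl _)); exists 0, [:: (1, x)].
  rewrite /comb /cval !big_seq1 scale1r mul1r add0r; split=> //; first by case: subE.
  by move=> i; rewrite inE => /eqP->.
Qed.

Lemma abasis_sep x : ~ E x -> exists l : V -> F,
  [/\ lin l, (forall y, E y -> l y = 0) & l x = 1].
Proof.
have [e [r [Ee hr ex]]] := abasis_comb x => nx.
have [h0|/existsNP[h /eqP hh]] := pselect (forall h, cval h r = 0).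
  by case: nx; rewrite ex cval_comb // addr0.
have [l [hl lE lB]] := abasis_ext h.
have lx : l x = cval h r.
  rewrite ex linD // lE // add0r lin_sum // /cval big_seq [RHS]big_seq; apply: eq_bigr => i ir.
  by rewrite linZ // lB //; apply: hr.
exists (fun y => (l x)^-1 * l y); split=> [c y z|y /lE ly|]; first by rewrite hl mulrDr mulrCA.
  by rewrite ly mulr0.
by rewrite mulVf // lx.
Qed.
End AdaptedBasis.

Lemma separation (F : fieldType) (V : lmodType F) (E : V -> Prop) (x : V) :
  subspace E -> ~ E x -> exists l : V -> F,
  [/\ lin l, (forall y, E y -> l y = 0) & l x = 1].
Proof. by move=> sE; apply: (abasis_sep (S := fun=> True)) => // y; apply: span_id. Qed.

Lemma separation0 (F : fieldType) (V : lmodType F) (x : V) :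
  (forall l : V -> F, lin l -> l x = 0) -> x = 0.
Proof.
move=> h; apply: contrapT => /(separation (E := fun y => y = 0))[|l [hl _ lx]].
  by split=> // c y z -> ->; rewrite scaler0 addr0.
by have /eqP := h l hl; rewrite lx oner_eq0.
Qed.

(** * The enveloping algebra by generators and relations *)

Lemma zmod_morphism0 (U W : zmodType) (f : U -> W) : zmod_morphism f -> f 0 = 0.
Proof. by move=> fB; rewrite -[in LHS](subrr 0) fB subrr. Qed.

Lemma zmod_morphismD (U W : zmodType) (f : U -> W) : zmod_morphism f -> {morph f : x y / x + y}.
Proof. by move=> fB x y; have := fB x (0 - y); rewrite (fB 0) (zmod_morphism0 fB) !sub0r !opprK. Qed.

Lemma ideal_gen_eq (R : nzRingType) (S S' : R -> Prop) : (forall x, S x <-> S' x) ->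
  forall x, ideal_gen S x <-> ideal_gen S' x.
Proof.
move=> SS' x; split; elim=> {x} [x hx||x y _ hx _ hy|a x _ hx|a x _ hx];
  by [apply: IdealGen; apply/SS' | exact: Ideal0 | exact: IdealB | exact: IdealMl | exact: IdealMr].
Qed.

Section Superalgebra.
Variables (F : fieldType) (L : lieSuperalgType F).
Implicit Types (x y z a b : L) (u v : seq L).

Lemma sbDl x y z : sbracket (x + y) z = sbracket x z + sbracket y z.
Proof. by rewrite -[x]scale1r sbracketPl !scale1r. Qed.

Lemma sbDr x y z : sbracket z (x + y) = sbracket z x + sbracket z y.
Proof. by rewrite -[x]scale1r sbracketPr !scale1r. Qed.

Lemma sb0l z : sbracket 0 z = 0 :> L.
Proof. by have := sbDl 0 0 z; rewrite addr0 => /eqP; rewrite -subr_eq subrr eq_sym => /eqP. Qed.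

Lemma sb0r z : sbracket z 0 = 0 :> L.
Proof. by have := sbDr 0 0 z; rewrite addr0 => /eqP; rewrite -subr_eq subrr eq_sym => /eqP. Qed.

Lemma sbZl (c : F) x z : sbracket (c *: x) z = c *: sbracket x z.
Proof. by rewrite -[c *: x]addr0 sbracketPl sb0l addr0. Qed.

Lemma sbZr (c : F) x z : sbracket z (c *: x) = c *: sbracket z x.
Proof. by rewrite -[c *: x]addr0 sbracketPr sb0r addr0. Qed.

Lemma homD (i : bool) x y : hom i x -> hom i y -> hom i (x + y).
Proof. by move=> hx hy; apply: subspaceD => //; exact: hom_subspace. Qed.
(** Functionals on the tensor algebra are encoded as functions on words: [multilinear] says that
    such a function factors through T(L), and [word_rel] that it respects a defining relation of
    U(L). *)
Definition multilinear (phi : seq L -> F) := forall u (c : F) x y v,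
  phi (u ++ (c *: x + y) :: v) = c * phi (u ++ x :: v) + phi (u ++ y :: v).

Definition word_rel (phi : seq L -> F) u a b v (i j : bool) :=
  phi (u ++ a :: b :: v) =
    (-1) ^+ (i && j) * phi (u ++ b :: a :: v) + phi (u ++ sbracket a b :: v).

(* [env_quotient iota]: the map induced by [iota] makes U a quotient of U(L). *)
Record env_quotient (U : algType F) (iota : L -> U) : Prop := EnvQuotient {
  envP : forall (c : F) x y, iota (c *: x + y) = c *: iota x + iota y;
  envM : forall (i j : bool) a b, hom i a -> hom j b ->
    iota a * iota b = (-1) ^+ (i && j) *: (iota b * iota a) + iota (sbracket a b);
  env_ind : forall P : U -> Prop, subspace P -> P 1 ->
    (forall x t, P t -> P (iota x * t)) -> forall t, P t
}.

(** [env_functional] bounds U from below: no more is divided out than the defining relations, since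
    every functional respecting them descends to U. *)
Record enveloping (U : algType F) (iota : L -> U) : Prop := Enveloping {
  enveloping_quotient :> env_quotient iota;
  env_functional : forall phi : seq L -> F, multilinear phi ->
    (forall u v a b (i j : bool), hom i a -> hom j b -> word_rel phi u a b v i j) ->
    exists Phi : U -> F, lin Phi /\ forall u, Phi (\prod_(x <- u) iota x) = phi u
}.

Lemma free_algE (X : choiceType) (f : free_alg F X) :
  f = \sum_(m <- msupp f) f@_m *: << m >> :> free_alg F X.
Proof.
rewrite {1}[f]monalgE; apply: eq_bigr => m _; apply/malgP => k.
by rewrite mcoeffZ !mcoeffU mulr_natr.
Qed.

Lemma free_alg_monom (X : choiceType) (m : fmonom X) :
  << m >> = \prod_(x <- m) fvar F x :> free_alg F X.
Proof.
case: m => s /=; elim: s => [|x s ih]; rewrite ?big_nil ?big_cons -?ih.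
  by rewrite -fmoneE.
by rewrite /fvar malgM_def fgmulUU mulr1 fmuE; congr << _ >>; rewrite -[RHS]/(fmmul _ _) fmmulE.
Qed.

Lemma free_alg_span (X : choiceType) (P : free_alg F X -> Prop) : subspace P ->
  (forall u : seq X, P (\prod_(x <- u) fvar F x)) -> forall f, P f.
Proof.
move=> sP hP f; rewrite [f]free_algE; apply: subspace_sum => // m _.
by apply: subspaceZ => //; rewrite free_alg_monom.
Qed.

Lemma free_alg_functional (X : choiceType) (phi : seq X -> F) :
  exists ev : free_alg F X -> F,
    lin ev /\ forall u : seq X, ev (\prod_(x <- u) fvar F x) = phi u.
Proof.
exists (mmap idfun (fun m : {fmonom X} => phi m)); split=> [c f g|u].
  rewrite raddfD /=; congr (_ + _).
  rewrite (mmapEw (msuppZ_le c f)) mmapE mulr_sumr; apply: eq_bigr => m _ /=.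
  by rewrite mcoeffZ mulrA.
by rewrite -(free_alg_monom (FMonom u)) mmapU mul1r.
Qed.

Lemma ker_ideal (R : algType F) (ev : R -> F) (S : R -> Prop) : lin ev ->
  (forall f, S f -> forall g h, ev (g * f * h) = 0) ->
  forall f, ideal_gen S f -> forall g h, ev (g * f * h) = 0.
Proof.
move=> lev hS f; elim=> {f} [|g h|f f' _ hf _ hf' g h|a f _ hf g h|a f _ hf g h].
- exact: hS.
- by rewrite mulr0 mul0r lin0.
- by rewrite mulrBr mulrBl linB // hf hf' subrr.
- by rewrite mulrA hf.
- by rewrite mulrA -mulrA hf.
Qed.

(** * The double quotient: free algebra [W], tensor algebra [A], enveloping algebra [B] *)

Section Presentation.
Variables (W A B : algType F) (fv : L -> W) (T : W -> A) (E : A -> B).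
Hypothesis W_span : forall P : W -> Prop, subspace P ->
  (forall u, P (\prod_(x <- u) fv x)) -> forall f, P f.
Hypothesis W_functional : forall phi : seq L -> F, exists ev : W -> F,
  lin ev /\ forall u, ev (\prod_(x <- u) fv x) = phi u.
Hypotheses (TB : zmod_morphism T) (TM : monoid_morphism T) (TZ : scalable T).
Hypotheses (EB : zmod_morphism E) (EM : monoid_morphism E) (EZ : scalable E).
Hypothesis T_surj : forall t, exists f, t = T f.
Hypothesis E_surj : forall t, exists f, t = E f.
Let lrel f := exists (c : F) x y, f = fv (c *: x + y) - (c *: fv x + fv y).
Hypothesis T_eq0 : forall f, T f = 0 <-> ideal_gen lrel f.

Let sgen (i j : bool) a b := T (fv a) * T (fv b)
  - (-1) ^+ (i && j) *: (T (fv b) * T (fv a)) - T (fv (sbracket a b)).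
Let srel t := exists i j a b, [/\ hom i a, hom j b & t = sgen i j a b].
Hypothesis E_eq0 : forall t, E t = 0 <-> ideal_gen srel t.

Let epi f := E (T f).
Let epiB : zmod_morphism epi. Proof. by move=> f g; rewrite /epi TB EB. Qed.
Let epi0 : epi 0 = 0. Proof. exact: zmod_morphism0. Qed.
Let epiD : {morph epi : x y / x + y}. Proof. exact: zmod_morphismD. Qed.
Let epiM : {morph epi : x y / x * y}. Proof. by move=> f g; rewrite /epi TM.2 EM.2. Qed.
Let epi1 : epi 1 = 1. Proof. by rewrite /epi TM.1 EM.1. Qed.
Let epiZ : scalable epi. Proof. by move=> c f; rewrite /epi TZ EZ. Qed.
Let epi_surj t : exists f, t = epi f.
Proof. by have [s ->] := E_surj t; have [f ->] := T_surj s; exists f. Qed.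
Let iota x := epi (fv x).

Let epi_prod u : epi (\prod_(x <- u) fv x) = \prod_(x <- u) iota x.
Proof. exact: (big_morph _ epiM epi1). Qed.

Let iotaP (c : F) x y : iota (c *: x + y) = c *: iota x + iota y.
Proof.
rewrite -epiZ -epiD; apply/eqP; rewrite -subr_eq0 -epiB; apply/eqP.
rewrite /epi (_ : T _ = 0) ?zmod_morphism0 //.
by apply/T_eq0/IdealGen; exists c, x, y.
Qed.

Let iotaM (i j : bool) a b : hom i a -> hom j b ->
  iota a * iota b = (-1) ^+ (i && j) *: (iota b * iota a) + iota (sbracket a b).
Proof.
move=> ha hb; apply/eqP; rewrite -subr_eq0 opprD addrA -!epiM -epiZ -!epiB; apply/eqP.
by apply/E_eq0/IdealGen; exists i, j, a, b; split=> //; rewrite /sgen !TB TZ !TM.2.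
Qed.

Let env_ind' (P : B -> Prop) : subspace P -> P 1 ->
  (forall x t, P t -> P (iota x * t)) -> forall t, P t.
Proof.
move=> sP P1 Pl t; have [f ->] := epi_surj t.
apply: (W_span (P := fun f => P (epi f))) => [|u].
  by split=> [|c x y Px Py]; [rewrite epi0; case: sP | rewrite epiD epiZ; case: sP => _; apply].
rewrite epi_prod; elim: u => [|x u ih]; first by rewrite big_nil.
by rewrite big_cons; apply: Pl.
Qed.

Section Functional.
Variable phi : seq L -> F.
Hypothesis phi_lin : multilinear phi.
Hypothesis phi_rel : forall u v a b (i j : bool), hom i a -> hom j b -> word_rel phi u a b v i j.

Variable ev : W -> F.
Hypotheses (ev_lin : lin ev) (ev_prod : forall u, ev (\prod_(x <- u) fv x) = phi u).

Let ev_word f : (forall u v, ev ((\prod_(x <- u) fv x) * f * \prod_(x <- v) fv x) = 0) ->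
  forall g h, ev (g * f * h) = 0.
Proof.
move=> hf; apply: W_span => [|u h].
  split=> [h|c x y hx hy h]; first by rewrite !mul0r lin0.
  by rewrite !mulrDl -!scalerAl ev_lin hx hy mulr0 addr0.
move: h; apply: W_span => [|v]; last exact: hf.
split=> [|c x y hx hy]; first by rewrite mulr0 lin0.
by rewrite mulrDr -scalerAr ev_lin hx hy mulr0 addr0.
Qed.

Let ev_lin_rel f : lrel f -> forall g h, ev (g * f * h) = 0.
Proof.
case=> c [x [y ->]]; apply: ev_word => u v.
rewrite mulrBr mulrBl mulrDr mulrDl linB // linD // -scalerAr -scalerAl linZ //.
have e z : (\prod_(x <- u) fv x) * fv z * \prod_(x <- v) fv x
    = \prod_(x <- u ++ z :: v) fv x by rewrite big_cat big_cons /= mulrA.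
by rewrite !e !ev_prod phi_lin subrr.
Qed.

Let ev_eq f f' g h : T f = T f' -> ev (g * f * h) = ev (g * f' * h).
Proof.
move=> /eqP; rewrite -subr_eq0 -TB => /eqP/T_eq0 hf; apply/eqP; rewrite -subr_eq0.
by rewrite -linB // -mulrBl -mulrBr (ker_ideal ev_lin ev_lin_rel hf).
Qed.

(** The ideal lives in [A] but [ev] is defined on [W]. The induction on membership therefore speaks
    of all preimages in [W] and carries a cofactor on each side, which makes the claim stable under
    multiplication. *)
Let ev_epi f : epi f = 0 -> ev f = 0.
Proof.
move=> /E_eq0 hf.
suff hT t : ideal_gen srel t ->
    forall f, T f = t -> forall g h, ev (g * f * h) = 0.
  by rewrite -[f]mul1r -[_ * f]mulr1; apply: hT hf _ _ _ _.
elim=> {t f hf} [t [i [j [a [b [ha hb ->]]]]] f||x y hx ihx hy ihy f|a x hx ih f|a x hx ih f].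
- pose f' := fv a * fv b - (-1) ^+ (i && j) *: (fv b * fv a)
    - fv (sbracket a b).
  have <- : T f' = sgen i j a b by rewrite /f' /sgen !TB TZ !TM.2.
  move=> ef g h; rewrite (ev_eq _ _ ef); move: g h; apply: ev_word => u v.
  rewrite !mulrBr !mulrBl !linB // -scalerAr -scalerAl linZ //.
  have e z : (\prod_(x <- u) fv x) * fv z * \prod_(x <- v) fv x
    = \prod_(x <- u ++ z :: v) fv x by rewrite big_cat big_cons /= mulrA.
  have e2 z z' : (\prod_(x <- u) fv x) * (fv z * fv z') * \prod_(x <- v) fv x
    = \prod_(x <- u ++ z :: z' :: v) fv x by rewrite big_cat !big_cons /= !mulrA.
  by rewrite !e2 e !ev_prod (phi_rel u v ha hb) [_ + phi _]addrC addrK subrr.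
- move=> f f0 g h; have /ev_eq-> : T f = T 0 by rewrite f0 (zmod_morphism0 TB).
  by rewrite mulr0 mul0r lin0.
- have [a ea] := T_surj x; have [b eb] := T_surj y.
  rewrite ea eb -TB => ef g h; rewrite (ev_eq _ _ ef) mulrBr mulrBl linB //.
  by rewrite ihx ?ihy ?subrr.
- have [c ec] := T_surj a; have [b eb] := T_surj x.
  by rewrite ec eb -TM.2 => ef g h; rewrite (ev_eq _ _ ef) mulrA ih.
- have [c ec] := T_surj a; have [b eb] := T_surj x.
  by rewrite ec eb -TM.2 => ef g h; rewrite (ev_eq _ _ ef) mulrA -mulrA ih.
Qed.

Lemma env_functional_ev : exists Phi : B -> F,
  lin Phi /\ forall u, Phi (\prod_(x <- u) iota x) = phi u.
Proof.
have [r hr] := choice epi_surj; exists (fun t => ev (r t)).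
have rE f t : t = epi f -> ev (r t) = ev f.
  move=> et; apply/eqP; rewrite -subr_eq0 -linB //; apply/eqP/ev_epi.
  by rewrite epiB -hr et subrr.
split=> [c x y|u].
  rewrite (@rE (c *: r x + r y)); first by rewrite ev_lin.
  by rewrite epiD epiZ -!hr.
by rewrite (@rE (\prod_(x <- u) fv x)) ?ev_prod ?epi_prod.
Qed.
End Functional.

Lemma presentation_enveloping : enveloping (fun x => E (T (fv x))).
Proof.
split; first by split; [exact: iotaP | exact: iotaM | exact: env_ind'].
move=> phi phi_lin phi_rel; have [ev [ev_lin ev_prod]] := W_functional phi.
exact: (env_functional_ev phi_lin phi_rel ev_lin ev_prod).
Qed.
End Presentation.
End Superalgebra.

Definition env_iota (F : fieldType) (L : lieSuperalgType F) (x : L) : env_alg L :=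
  qpi (@env_ideal F L) (tens x).

Lemma env_alg_enveloping (F : fieldType) (L : lieSuperalgType F) :
  enveloping (U := env_alg L) (@env_iota F L).
Proof.
pose A : algType F := quot_alg (@lin_ideal F L).
pose B : algType F := quot_alg (@env_ideal F L).
have h : enveloping (U := B) (fun x => qpi (@env_ideal F L) (qpi (@lin_ideal F L) (fvar F x))).
  apply: presentation_enveloping.
  - exact: free_alg_span.
  - exact: free_alg_functional.
  - exact: qpi_is_zmod.
  - exact: qpi_is_monoid_morphism.
  - exact: qpi_is_scalable.
  - exact: qpi_is_zmod.
  - exact: qpi_is_monoid_morphism.
  - exact: qpi_is_scalable.
  - exact: qpi_surj.
  - exact: qpi_surj.
  - move=> f; rewrite -(@ideal_gen_eq _ (@lin_rel F L)); first by
      split=> [/qpi_eq0/ideal_predP|] // hf; apply/qpi_eq0/ideal_predP.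
    by move=> g; split=> [[c x y]|[c [x [y ->]]]]; [exists c, x, y | exact: LinRel].
  - move=> f; rewrite -(@ideal_gen_eq _ (@env_rel F L)); first by
      split=> [/qpi_eq0/ideal_predP|] // hf; apply/qpi_eq0/ideal_predP.
    by move=> g; split=> [[i j a b ha hb]|[i [j [a [b [ha hb ->]]]]]];
      [exists i, j, a, b | exact: EnvRel].
exact: h.
Qed.

(** * Straightening of words *)

Section Straightening.
Variables (F : fieldType) (T : eqType) (gt : rel T) (odd : T -> bool).
Variables (W : seq T -> Prop) (c : seq T -> T -> T -> seq T -> F).
Implicit Types (u v m w : seq T) (a b x y : T).

Hypothesis two_neq0 : 2%:R != 0 :> F.
Hypothesis gt_asym : forall a b, gt a b -> ~~ gt b a.
Hypothesis gt_total : forall a b, [\/ gt a b, gt b a | a = b].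
Hypothesis gt_trans : forall a b e, gt a b -> gt b e -> gt a e.
Hypothesis W_swap : forall u a b v, W (u ++ a :: b :: v) -> W (u ++ b :: a :: v).

Definition sgn a b : F := (-1) ^+ (odd a && odd b).

(* [c u a b v] is the prescribed value of [f (u ++ a :: b :: v) - sgn a b * f (u ++ b :: a :: v)];
   the next four hypotheses resolve the ambiguities of the diamond lemma. *)
Hypothesis c_skew : forall u a b v, W (u ++ a :: b :: v) -> c u b a v = - sgn a b * c u a b v.
Hypothesis c_far : forall u a b m x y v, W (u ++ a :: b :: m ++ x :: y :: v) ->
  c u a b (m ++ x :: y :: v) - sgn x y * c u a b (m ++ y :: x :: v) =
  c (u ++ a :: b :: m) x y v - sgn a b * c (u ++ b :: a :: m) x y v.
Hypothesis c_braid : forall u a b e v, W (u ++ a :: b :: e :: v) ->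
  sgn a b * sgn a e * c u b e (a :: v) + sgn a b * c (rcons u b) a e v + c u a b (e :: v) =
  sgn b e * sgn a e * c (rcons u e) a b v + sgn b e * c u a e (b :: v) + c (rcons u a) b e v.
Hypothesis c_triple : forall u a v, odd a -> W (u ++ a :: a :: a :: v) ->
  c u a a (a :: v) = c (rcons u a) a a v.

Lemma sgnC a b : sgn a b = sgn b a. Proof. by rewrite /sgn andbC. Qed.
Lemma sgnK a b : sgn a b * sgn a b = 1.
Proof. by rewrite /sgn -expr2 sqrr_sign. Qed.

Fixpoint adjacent (P : rel T) w : option (seq T * T * T * seq T) :=
  if w is a :: w' then
    if w' is b :: v then
      if P a b then Some ([::], a, b, v) else
      if adjacent P w' is Some (u, x, y, v') then Some (a :: u, x, y, v') else None
    else None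
  else None.

Lemma adjacent_some P w u a b v : adjacent P w = Some (u, a, b, v) ->
  w = u ++ a :: b :: v /\ P a b.
Proof.
elim: w u => [|x w ih] u //; case: w ih => [|y w] ih //.
rewrite [adjacent _ _]/= -/(adjacent P (y :: w)).
case Pxy: (P x y) => E; first by case: E => <- <- <- <-.
case E2: (adjacent P (y :: w)) E => [[[[u' a'] b'] v']|] // [eu ea eb ev].
by subst; have [-> Pab] := ih _ E2.
Qed.

Lemma adjacent_none P u a b v : adjacent P (u ++ a :: b :: v) = None -> P a b = false.
Proof.
elim: u => [|x u ih]; first by rewrite /=; case: ifP.
have [y [w eyw]] : exists y w, u ++ a :: b :: v = y :: w by case: u {ih} => [|y u]; do 2 eexists.
rewrite cat_cons eyw [adjacent _ _]/= -/(adjacent P (y :: w)) -eyw.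
case: (P x y) => //; case: (adjacent P (u ++ _)) ih => [[[[? ?] ?] ?]|] //= ih _; exact: ih.
Qed.

Lemma split2 u a b v u' x y v' : u ++ a :: b :: v = u' ++ x :: y :: v' ->
  [\/ [/\ u = u', a = x, b = y & v = v'],
      [/\ u' = rcons u a, x = b & v = y :: v'],
      [/\ u = rcons u' x, y = a & v' = b :: v] |
      exists m, (u' = u ++ a :: b :: m /\ v = m ++ x :: y :: v') \/
                (u = u' ++ x :: y :: m /\ v' = m ++ a :: b :: v)].
Proof.
elim: u u' => [|z u ih] [|z' u'] /=.
- by move=> [-> -> ->]; constructor 1.
- case: u' => [|t m] /=; first by (move=> [<- -> ->]; constructor 2).
  by move=> [<- <- ->]; constructor 4; exists m; left.
- case: u {ih} => [|t m] /=; first by (move=> [-> <- <-]; constructor 3).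
  by move=> [-> -> <-]; constructor 4; exists m; right.
- move=> [<- /ih[[-> -> -> ->]|[-> -> ->]|[-> -> ->]|[m [[-> ->]|[-> ->]]]]].
  + by constructor 1.
  + by constructor 2.
  + by constructor 3.
  + by constructor 4; exists m; left.
  + by constructor 4; exists m; right.
Qed.

Fixpoint inversions w : nat :=
  if w is x :: w' then (count (gt x) w' + inversions w')%N else 0%N.

Lemma inversions_swap u a b v : gt a b ->
  inversions (u ++ a :: b :: v) = (inversions (u ++ b :: a :: v)).+1.
Proof.
move=> ab; elim: u => [|x u ih] /=.
  by rewrite ab (negPf (gt_asym ab)) add0n add1n addSn addnCA.
by rewrite ih addnS !count_cat /=; congr (_ + _).+1; rewrite (addnCA (gt x a)).
Qed.

Lemma inversions_swap_rcons u z a b v : gt a b ->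
  inversions (u ++ z :: a :: b :: v) = (inversions (u ++ z :: b :: a :: v)).+1.
Proof. by rewrite -!(cat_rcons z); exact: inversions_swap. Qed.

Lemma W_swap_rcons u z a b v : W (u ++ z :: a :: b :: v) -> W (u ++ z :: b :: a :: v).
Proof. by rewrite -!(cat_rcons z); exact: W_swap. Qed.

(** In a word without descents only a repeated odd letter is constrained: a a = - a a + c forces the
    value c / 2. The other sorted words are free and get 0. *)
Definition sorted_value w : F :=
  if adjacent (fun a b => (a == b) && odd a) w is Some (u, a, b, v) then c u a b v / 2%:R else 0.

Fixpoint straighten k w : F :=
  if k is k'.+1 then
    if adjacent gt w is Some (u, a, b, v) then
      sgn a b * straighten k' (u ++ b :: a :: v) + c u a b v
    else sorted_value w
  else sorted_value w.

Definition straight w := straighten (inversions w) w.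

Lemma straight_desc w u a b v : adjacent gt w = Some (u, a, b, v) ->
  straight w = sgn a b * straight (u ++ b :: a :: v) + c u a b v.
Proof.
move=> h; have [e ab] := adjacent_some h.
by rewrite /straight {1}e (inversions_swap _ _ ab) /= h.
Qed.

Lemma straight_sorted w : adjacent gt w = None -> straight w = sorted_value w.
Proof. by rewrite /straight; case: (inversions w) => //= k ->. Qed.

Lemma two_inj (s t : F) : s + s = t + t -> s = t.
Proof. by move=> h; apply: (mulIf two_neq0); rewrite !mulr_natr !mulr2n. Qed.

(** Bergman's diamond lemma, by induction on the number of inversions. [straight] resolves the
    leftmost descent; this pair and the given pair [a], [b] coincide, overlap in one letter
    ([c_braid]) or are disjoint ([c_far]). The hypothesis admits [a = b], which covers squares of
    odd letters. *)
Lemma straight_weak u a b v : ~~ gt b a -> W (u ++ a :: b :: v) ->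
  straight (u ++ a :: b :: v) = sgn a b * straight (u ++ b :: a :: v) + c u a b v.
Proof.
move: {2}(inversions (u ++ a :: b :: v)) (leqnn (inversions (u ++ a :: b :: v))) => n.
elim/ltn_ind: n u a b v => n ih u a b v hn nba Ww.
have {}ih u' a' b' v' : (inversions (u' ++ a' :: b' :: v') < inversions (u ++ a :: b :: v))%N ->
    ~~ gt b' a' -> W (u' ++ a' :: b' :: v') ->
    straight (u' ++ a' :: b' :: v') = sgn a' b' * straight (u' ++ b' :: a' :: v') + c u' a' b' v'.
  by move=> h; apply: (ih (inversions (u' ++ a' :: b' :: v'))) => //; apply: leq_trans h hn.
have ihr u' z a' b' v' : (inversions (u' ++ z :: a' :: b' :: v') < inversions (u ++ a :: b :: v))%N ->
    ~~ gt b' a' -> W (u' ++ z :: a' :: b' :: v') ->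
    straight (u' ++ z :: a' :: b' :: v') =
      sgn a' b' * straight (u' ++ z :: b' :: a' :: v') + c (rcons u' z) a' b' v'.
  by rewrite -!(cat_rcons z); exact: ih.
case E: (adjacent gt (u ++ a :: b :: v)) => [[[[u' x] y] v']|]; last first.
  (* There is no descent, so [a = b]. For an even letter [c_skew] gives [c = 0]; for an odd one it
     has to be shown that the value does not depend on which repeated pair [sorted_value] has
     picked. *)
  have [ab|ba|eab] := gt_total a b.
  - by rewrite (adjacent_none E) in ab.
  - by rewrite ba in nba.
  subst b; have [oa|ea] := boolP (odd a); last first.
    have -> : c u a a v = 0.
      have := c_skew Ww; rewrite /sgn (negPf ea) mulN1r => h.
      by apply: two_inj; rewrite addr0 {1}h addNr.
    by rewrite /sgn (negPf ea) mul1r addr0.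
  have -> : sgn a a = -1 by rewrite /sgn oa.
  apply/eqP; rewrite mulN1r addrC -subr_eq opprK; apply/eqP.
  rewrite straight_sorted // /sorted_value.
  case E': (adjacent _ _) => [[[[u' x] y] v']|]; last first.
    by have := adjacent_none E'; rewrite eqxx oa.
  have [e /andP[/eqP exy ox]] := adjacent_some E'; subst y.
  have half (t : F) : t / 2%:R + t / 2%:R = t by rewrite -mulrDl -mulr2n -[t *+ 2]mulr_natr mulfK.
  rewrite half.
  have [[-> -> _ ->]|[eu ex ev]|[eu ex ev]|[m [[eu ev]|[eu ev]]]] := split2 e => //.
  - by subst; rewrite c_triple //; move: Ww.
  - by subst; rewrite c_triple // -cat_rcons.
  - subst; have := c_far Ww; rewrite /sgn oa ox !mulN1r !opprK => h.
    by apply: two_inj.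
  - subst; move: Ww; rewrite -catA /= => Ww; have := c_far Ww; rewrite /sgn oa ox !mulN1r !opprK => h.
    by apply: two_inj.
have [e xy] := adjacent_some E; have D := straight_desc E.
have [[? ? ? ?]|[eu ex ev]|[eu ex ev]|[m [[eu ev]|[eu ev]]]] := split2 e.
- by subst.
(* The descent [b], [y] overlaps [a], [b] on the right: both reductions of [a b y] are continued to
   [y b a], and [c_braid] equates the accumulated corrections. *)
- subst; move: E D Ww => _; rewrite !cat_rcons => D Ww.
  have ay : gt a y.
    by have [ab|ba|->//] := gt_total a b; [exact: gt_trans xy | rewrite ba in nba].
  have lt1 := inversions_swap_rcons u a v' xy.
  have lt2 := inversions_swap u (b :: v') ay.
  rewrite D ih; last 3 first.
  - by rewrite lt1.
  - exact: gt_asym.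
  - exact: W_swap_rcons.
  rewrite ihr //; last 2 first.
  - by rewrite lt1 lt2 ltnS leqnSn.
  - by apply/W_swap/W_swap_rcons.
  have [ab|ba|eab] := gt_total a b.
  - have lt3 := inversions_swap u (y :: v') ab.
    have lt4 := inversions_swap_rcons u b v' ay.
    rewrite (ihr u b a y v') ?(ih u b y) //; first 1 last.
    - by rewrite lt3 lt4 ltnS leqnSn.
    - exact: gt_asym.
    - by apply/W_swap_rcons/W_swap.
    - by rewrite lt3.
    - exact: gt_asym.
    - exact: W_swap.
    have B := c_braid Ww; rewrite -[c u a b _](addKr
      (sgn a b * sgn a y * c u b y (a :: v') + sgn a b * c (rcons u b) a y v')) B; ring.
  - by rewrite ba in nba.
  - subst b; rewrite D (ih u a y) //; first 1 last.
    - by rewrite lt1.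
    - exact: gt_asym.
    - exact: W_swap_rcons.
    have B := c_braid Ww; rewrite -[c u a a _](addKr
      (sgn a a * sgn a y * c u a y (a :: v') + sgn a a * c (rcons u a) a y v')) B; ring.
- subst; move: E D Ww ih ihr {hn} => _; rewrite !cat_rcons => D Ww ih ihr.
  have xb : gt x b.
    by have [ab|ba|<-//] := gt_total a b; [exact: gt_trans ab | rewrite ba in nba].
  have lt1 := inversions_swap u' (b :: v) xy.
  have lt2 := inversions_swap_rcons u' a v xb.
  rewrite D ihr; last 3 first.
  - by rewrite lt1.
  - exact: gt_asym.
  - exact: W_swap.
  rewrite (ih u' a b) //; last 2 first.
  - by rewrite lt1 lt2 ltnS leqnSn.
  - by apply/W_swap_rcons/W_swap.
  have [ab|ba|eab] := gt_total a b.
  - have lt3 := inversions_swap_rcons u' x v ab.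
    have lt4 := inversions_swap u' (a :: v) xb.
    rewrite (ih u' x b (a :: v)); last 3 first.
    - by rewrite lt3.
    - exact: gt_asym.
    - exact: W_swap_rcons.
    rewrite (ihr u' b x a v); last 3 first.
    - by rewrite lt3 lt4 ltnS leqnSn.
    - exact: gt_asym.
    - by apply/W_swap/W_swap_rcons.
    have B := c_braid Ww; rewrite -[c u' x a _](addKr
      (sgn x a * sgn x b * c u' a b (x :: v) + sgn x a * c (rcons u' a) x b v)) B; ring.
  - by rewrite ba in nba.
  - subst b; rewrite D (ihr u' a x a) //; first 1 last.
    - by rewrite lt1.
    - exact: gt_asym.
    - exact: W_swap.
    have /eqP := c_braid Ww; rewrite -subr_eq0 => /eqP B.
    by apply/eqP; rewrite -subr_eq0 -B; apply/eqP; ring.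
- subst; rewrite D -catA /=.
  have lt1 := inversions_swap (u ++ a :: b :: m) v' xy.
  have W1 := W_swap (u := u ++ a :: b :: m) (a := x) (b := y) (v := v'); rewrite -!catA /= in lt1 W1.
  rewrite ih //; last 2 first.
  - by rewrite lt1.
  - exact: W1.
  have -> : straight (u ++ b :: a :: m ++ x :: y :: v') =
      sgn x y * straight (u ++ b :: a :: m ++ y :: x :: v') + c (u ++ b :: a :: m) x y v'.
    have [ab|ba|eab] := gt_total a b.
    - have := ih (u ++ b :: a :: m) x y v'; rewrite -!catA /=; apply.
      + by rewrite (inversions_swap _ _ ab).
      + exact: gt_asym.
      + exact: W_swap.
    - by rewrite ba in nba.
    - by subst; rewrite D -catA.
  by have /eqP := c_far Ww; rewrite subr_eq => /eqP ->; ring.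
- subst; move: E D Ww ih ihr {hn}; rewrite -!catA /= => _ D Ww ih _.
  have lt1 := inversions_swap u' (m ++ a :: b :: v) xy.
  rewrite D; have := ih (u' ++ y :: x :: m) a b v; rewrite -!catA /= lt1 => ->; last 3 first.
  - done.
  - done.
  - exact: W_swap.
  have -> : straight (u' ++ x :: y :: m ++ b :: a :: v) =
      sgn x y * straight (u' ++ y :: x :: m ++ b :: a :: v) + c u' x y (m ++ b :: a :: v).
    have [ab|ba|eab] := gt_total a b.
    - apply: ih; last 2 first.
      + exact: gt_asym.
      + by have := W_swap (u := u' ++ x :: y :: m) (a := a) (b := b) (v := v); rewrite -!catA; apply.
      + by have := inversions_swap (u' ++ x :: y :: m) v ab; rewrite -!catA /= => ->.
    - by rewrite ba in nba.
    - by subst.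
  by have /eqP := c_far Ww; rewrite subr_eq => /eqP ->; ring.
Qed.

Lemma straight_rel u a b v : W (u ++ a :: b :: v) ->
  straight (u ++ a :: b :: v) = sgn a b * straight (u ++ b :: a :: v) + c u a b v.
Proof.
move=> Ww; have [nba|ba] := boolP (gt b a); last exact: straight_weak.
rewrite (straight_weak (gt_asym nba) (W_swap Ww)) (c_skew Ww) sgnC mulrDr !mulrA sgnK.
by rewrite mulrN sgnC sgnK mul1r mulN1r subrK.
Qed.
End Straightening.

(** * Extending supersymmetric forms to the enveloping algebra *)

Section Multilinear.
Variables (F : fieldType) (L : lieSuperalgType F) (phi : seq L -> F).
Hypothesis phi_lin : multilinear phi.
Implicit Types (u v : seq L) (x y : L).

Lemma multilinear_lin u v : lin (fun x => phi (u ++ x :: v)).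
Proof. by move=> c x y; apply: phi_lin. Qed.

Lemma mlD u x y v : phi (u ++ (x + y) :: v) = phi (u ++ x :: v) + phi (u ++ y :: v).
Proof. exact: (linD _ _ (multilinear_lin u v)). Qed.

Lemma mlZ u (c : F) x v : phi (u ++ (c *: x) :: v) = c * phi (u ++ x :: v).
Proof. exact: (linZ _ _ (multilinear_lin u v)). Qed.

Lemma mlN u x v : phi (u ++ (- x) :: v) = - phi (u ++ x :: v).
Proof. exact: (linN _ (multilinear_lin u v)). Qed.

Lemma ml0 u v : phi (u ++ 0 :: v) = 0.
Proof. exact: (lin0 (multilinear_lin u v)). Qed.
End Multilinear.

Section PBW.
Variables (F : fieldType) (L : lieSuperalgType F).
Hypothesis two_neq0 : 2%:R != 0 :> F.
Hypothesis odd_cube : forall y : L, hom true y -> sbracket (sbracket y y) y = 0.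
Implicit Types (u v w : seq L) (a b x y z : L) (phi : seq L -> F).

Let homogeneous x := exists i, hom i x.
Let E0 x := x = 0.
Let E0_sub : subspace E0.
Proof. by split=> // c x y -> ->; rewrite /E0 scaler0 addr0. Qed.

Let homogeneous_span x : span homogeneous x.
Proof.
have [x0 [x1 [h0 h1 ->]]] := hom_sum x.
by apply: (subspaceD (span_subspace _)); apply: span_id; [exists false | exists true].
Qed.

Definition hbasis : L -> Prop := abasis E0 homogeneous.
Definition deg x : bool := `[<hom true x>].

Lemma hbasis_neq0 x : hbasis x -> x <> 0.
Proof. by case=> _ h x0; apply: h; rewrite x0; exact: span0. Qed.

Lemma hbasis_deg i x : hbasis x -> hom i x -> deg x = i.
Proof.
move=> Bx; case: i => hx; first exact/asboolP.
by apply/asboolPn => /(hom_direct _ hx); exact: hbasis_neq0.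
Qed.

Lemma hbasis_hom x : hbasis x -> hom (deg x) x.
Proof. by move=> Bx; have [[i hi] _] := Bx; rewrite (hbasis_deg Bx hi). Qed.

(** In an expansion of [x] the basis vectors of the other degree add up to an element of both
    degrees, hence to 0. *)
Lemma hom_span i x : hom i x -> span (fun z => hbasis z /\ hom i z) x.
Proof.
have split_span y : span (fun z => E0 z \/ hbasis z) y -> exists y0 y1,
    [/\ span (fun z => hbasis z /\ hom i z) y0, span (fun z => hbasis z /\ hom (~~ i) z) y1
      & y = y0 + y1].
  elim=> [|c {}y y' [->|By] _ [y0 [y1 [h0 h1 ->]]]].
  - by exists 0, 0; split; [exact: span0 | exact: span0 | rewrite addr0].
  - by exists y0, y1; split=> //; rewrite scaler0 add0r.
  have [[j hj] _] := By; have [e|ne] := eqVneq i j.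
    by exists (c *: y + y0), y1; split=> //; [apply: spanP => //; rewrite e | rewrite addrA].
  exists y0, (c *: y + y1); split=> //; last by rewrite addrCA.
  by apply: spanP => //; split=> //; case: i j ne hj {h0 h1} => [] [].
have homS j z : span (fun z => hbasis z /\ hom j z) z -> hom j z.
  by apply: span_min => [|t []//]; exact: hom_subspace.
move=> hx; have [|y0 [y1 [h0 h1 e]]] := split_span x.
  apply: span_sub (homogeneous_span x) => z; exact: abasis_span.
suff e1 : y1 = 0 by rewrite e e1 addr0.
have h1' : hom i y1.
  by rewrite -[y1](addKr y0) -e addrC; apply: subspaceB => //; [exact: hom_subspace | exact: homS].
have := homS _ _ h1; clear -h1'; case: i h1' => h1 h0; first exact: hom_direct _ h0 h1.
exact: hom_direct _ h1 h0.
Qed.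

Lemma hbasis_span x : span hbasis x.
Proof.
by apply: span_sub (homogeneous_span x) => z [i /hom_span]; apply: span_mono => t [].
Qed.

(** Linearity of [ext] in [h] is what makes an extension slot by slot ([mext]) linear in every
    slot. *)
Lemma hbasis_extension : exists ext : (L -> F) -> L -> F,
  [/\ forall h, lin (ext h), forall h x, hbasis x -> ext h x = h x &
      forall (c : F) h h' x, ext (fun k => c * h k + h' k) x = c * ext h x + ext h' x].
Proof.
have [ext hext] := choice (abasis_ext E0_sub homogeneous_span).
exists ext; split=> [h|h x|c h h' x]; have [lh _ eh] := hext h => //; first exact: eh.
have [lh' _ eh'] := hext h'; have [lc _ ec] := hext (fun k => c * h k + h' k).
have l : lin (fun x => c * ext h x + ext h' x).
  by move=> d y z; rewrite lh lh' !mulrDr mulrCA addrACA.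
apply: (lin_span lc l _ (hbasis_span x)) => y By.
by rewrite ec // eh // eh'.
Qed.

Section MultilinearExtension.
Variable ext : (L -> F) -> L -> F.
Hypothesis ext_lin : forall h, lin (ext h).
Hypothesis ext_basis : forall h x, hbasis x -> ext h x = h x.
Hypothesis ext_linr : forall (c : F) h h' x,
  ext (fun k => c * h k + h' k) x = c * ext h x + ext h' x.

Fixpoint mext (g : seq L -> F) u : F :=
  if u is x :: u' then ext (fun k => mext (fun w => g (k :: w)) u') x else g [::].

Lemma mext_multilinear g : multilinear (mext g).
Proof.
move=> u c x y v; elim: u g => [|z u ih] g; first exact: ext_lin.
rewrite /= -ext_linr; congr (ext _ _); apply/funext => k; exact: ih.
Qed.

Lemma mext_basis g u : (forall x, x \in u -> hbasis x) -> mext g u = g u.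
Proof.
elim: u g => [//|x u ih] g hu; rewrite /= ext_basis; last by apply: hu; rewrite mem_head.
by rewrite ih // => y yu; apply: hu; rewrite inE yu orbT.
Qed.
End MultilinearExtension.

Definition all_basis u := forall x, x \in u -> hbasis x.

Lemma all_basis_cat u v : all_basis (u ++ v) <-> all_basis u /\ all_basis v.
Proof.
split=> [h|[hu hv] x]; first by split=> x xu; apply: h; rewrite mem_cat xu ?orbT.
by rewrite mem_cat => /orP[/hu|/hv].
Qed.

Lemma all_basis_cons x u : all_basis (x :: u) <-> hbasis x /\ all_basis u.
Proof.
split=> [h|[hx hu] y]; last by rewrite inE => /orP[/eqP->|/hu].
by split=> [|y yu]; apply: h; rewrite inE ?eqxx ?yu ?orbT.
Qed.

Section RelationDefect.
Variables (phi : seq L -> F) (i j : bool).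
Hypothesis phi_lin : multilinear phi.

Definition defect u a b v : F := phi (u ++ a :: b :: v)
  - (-1) ^+ (i && j) * phi (u ++ b :: a :: v) - phi (u ++ sbracket a b :: v).

Lemma defectP u a b v : defect u a b v = 0 <-> word_rel phi u a b v i j.
Proof.
rewrite /defect /word_rel; split=> [/eqP|->]; first by rewrite subr_eq0 subr_eq addrC => /eqP.
by ring.
Qed.

Lemma defect_linl u b v : lin (fun a => defect u a b v).
Proof.
move=> c x y; rewrite /defect sbracketPl !phi_lin.
by rewrite -!(cat_rcons b) !phi_lin; ring.
Qed.

Lemma defect_linr u a v : lin (fun b => defect u a b v).
Proof.
move=> c x y; rewrite /defect sbracketPr !phi_lin.
by rewrite -!(cat_rcons a) !phi_lin; ring.
Qed.

Lemma defect_lin_pre u1 u2 a b v : lin (fun x => defect (u1 ++ x :: u2) a b v).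
Proof. by move=> c x y; rewrite /defect -!catA !phi_lin; ring. Qed.

Lemma defect_lin_post u a b v1 v2 : lin (fun x => defect u a b (v1 ++ x :: v2)).
Proof.
have e1 y z s : u ++ y :: z :: v1 ++ s = (u ++ y :: z :: v1) ++ s by rewrite -catA.
have e2 y s : u ++ y :: v1 ++ s = (u ++ y :: v1) ++ s by rewrite -catA.
by move=> c x y; rewrite /defect !e1 !e2 !phi_lin; ring.
Qed.

(** The defect is linear in every letter. First [a] and [b] are expanded in basis vectors of their
    own degree, then the suffix and the prefix letter by letter, [v1] and [u1] collecting the
    letters already expanded. *)
Lemma word_rel_basis n :
  (forall u a b v, all_basis (u ++ a :: b :: v) -> hom i a -> hom j b ->
     size (u ++ a :: b :: v) = n -> word_rel phi u a b v i j) ->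
  forall u a b v, hom i a -> hom j b -> size (u ++ a :: b :: v) = n ->
    word_rel phi u a b v i j.
Proof.
move=> hB.
have zero_span (f : L -> F) S x : lin f -> (forall y, S y -> f y = 0) -> span S x -> f x = 0.
  by move=> lf hS; apply: (span_min (ker_subspace lf)).
have ab u v : all_basis (u ++ v) -> forall a b, hom i a -> hom j b ->
    size (u ++ a :: b :: v) = n -> defect u a b v = 0.
  move=> /all_basis_cat[Bu Bv] a b ha hb sn.
  apply: (zero_span _ _ _ (defect_linl u b v) _ (hom_span ha)) => x [Bx hx].
  apply: (zero_span _ _ _ (defect_linr u x v) _ (hom_span hb)) => y [By hy].
  apply/defectP/hB => //; last by rewrite -sn !size_cat.
  apply/all_basis_cat; split=> //; apply/all_basis_cons; split=> //.
  exact/all_basis_cons.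
have post u : all_basis u -> forall v2 v1, all_basis v1 -> forall a b, hom i a -> hom j b ->
    size (u ++ a :: b :: v1 ++ v2) = n -> defect u a b (v1 ++ v2) = 0.
  move=> Bu; elim=> [|x v2 ih] v1 Bv a b ha hb sn.
    by rewrite cats0 in sn *; apply: ab => //; apply/all_basis_cat.
  apply: (zero_span _ _ _ (defect_lin_post u a b v1 v2) _ (hbasis_span x)) => y By.
  rewrite -cat_rcons; apply: ih => //; last by rewrite -sn !size_cat /= !size_cat size_rcons /= addSnnS.
  by rewrite -cats1; apply/all_basis_cat; split=> // z; rewrite inE => /eqP->.
have pre v u2 : forall u1, all_basis u1 -> forall a b, hom i a -> hom j b ->
    size ((u1 ++ u2) ++ a :: b :: v) = n -> defect (u1 ++ u2) a b v = 0.
  elim: u2 => [|x u2 ih] u1 Bu a b ha hb sn.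
    by rewrite cats0 in sn *; apply: (post u1 Bu v [::]).
  apply: (zero_span _ _ _ (defect_lin_pre u1 u2 a b v) _ (hbasis_span x)) => y By.
  rewrite -cat_rcons; apply: ih => //; last by rewrite -sn !size_cat size_rcons /= addSnnS.
  by rewrite -cats1; apply/all_basis_cat; split=> // z; rewrite inE => /eqP->.
by move=> u a b v ha hb sn; apply/defectP; apply: (pre v u [::]).
Qed.
End RelationDefect.

Definition compatible n phi := multilinear phi /\
  forall u v a b (i j : bool), hom i a -> hom j b -> (size (u ++ a :: b :: v) <= n)%N ->
    word_rel phi u a b v i j.

Definition after x y := worder y x && (y != x).

(** On words of length n + 1 the bracket terms [c] have length n and are known, so straightening
    defines the values on basis words and [mext] extends them. The consistency conditions come from
    skew symmetry, from the relations in length n, from the Jacobi identity and, for three equal odd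
    letters, from [odd_cube]. *)
Lemma compatible_step n phi : compatible n phi -> exists phi',
  compatible n.+1 phi' /\ forall u, (size u <= n)%N -> phi' u = phi u.
Proof.
move=> [ml rel].
pose c u a b v := phi (u ++ sbracket a b :: v).
pose W u := all_basis u /\ size u = n.+1.
have Wl u a b v : W (u ++ a :: b :: v) -> [/\ hbasis a, hbasis b,
    hom (deg a) a, hom (deg b) b & (size u + size v).+1 = n].
  move=> [/all_basis_cat[_ /all_basis_cons[Ba /all_basis_cons[Bb _]]] sn].
  split=> //; try exact: hbasis_hom.
  by move: sn; rewrite size_cat /= !addnS => -[].
have Wsw u a b v : W (u ++ a :: b :: v) -> W (u ++ b :: a :: v).
  move=> [/all_basis_cat[Bu /all_basis_cons[Ba /all_basis_cons[Bb Bv]]] sn].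
  split; last by rewrite -sn !size_cat.
  apply/all_basis_cat; split=> //; apply/all_basis_cons; split=> //.
  exact/all_basis_cons.
have f_rel := straight_rel (c := c) (W := W) (gt := after) (odd := deg) two_neq0.
pose f := straight after deg c.
have {}f_rel u a b v : W (u ++ a :: b :: v) ->
    f (u ++ a :: b :: v) = sgn F deg a b * f (u ++ b :: a :: v) + c u a b v.
  apply: f_rel => {u a b v}.
  - move=> a b /andP[ba nba]; apply/negP => /andP[ab _].
    by rewrite (worder_anti ba ab) eqxx in nba.
  - move=> a b; have [<-|nab] := eqVneq a b; first by constructor 3.
    by have [h|h] := orP (worder_total a b); [constructor 2 | constructor 1];
      rewrite /after h // eq_sym.
  - move=> a b e /andP[ba nba] /andP[eb neb]; apply/andP; split; first exact: worder_trans eb ba.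
    by apply: contra_neq nba => ea; subst; exact: worder_anti.
  - exact: Wsw.
  - move=> u a b v /Wl[_ _ ha hb _]; rewrite /c (sbracketC _ _ _ _ hb ha).
    by rewrite (mlN ml) (mlZ ml) /sgn andbC mulNr.
  - move=> u a b m x y v Ww; rewrite /c.
    have [_ _ ha hb sn] := Wl _ _ _ _ Ww.
    have Ww' : W ((u ++ a :: b :: m) ++ x :: y :: v) by rewrite -catA.
    have [_ _ hx hy _] := Wl _ _ _ _ Ww'.
    have e1 z w : u ++ z :: m ++ w = (u ++ z :: m) ++ w by rewrite -catA.
    have r1 : word_rel phi (u ++ sbracket a b :: m) x y v (deg x) (deg y).
      by apply: rel; rewrite // -sn -e1 size_cat /= addnS.
    have r2 : word_rel phi u a b (m ++ sbracket x y :: v) (deg a) (deg b).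
      by apply: rel; rewrite // -sn !size_cat /= !addnS !size_cat /= !addnS.
    rewrite /word_rel -!catA /= in r1 r2; rewrite -!catA /= r1 r2 /sgn; ring.
  - move=> u a b e v Ww; rewrite /c.
    have [_ _ ha hb sn] := Wl _ _ _ _ Ww.
    have Ww' : W (rcons u a ++ b :: e :: v) by rewrite cat_rcons.
    have [_ _ _ he _] := Wl _ _ _ _ Ww'.
    have sz x y : (size (u ++ x :: y :: v) <= n)%N by rewrite -sn !size_cat /= !addnS.
    have r1 := rel u v _ _ _ _ (hom_sbracket _ _ _ _ ha hb) he (sz _ _).
    have r2 := rel u v _ _ _ _ ha (hom_sbracket _ _ _ _ hb he) (sz _ _).
    have r3 := rel u v _ _ _ _ hb (hom_sbracket _ _ _ _ ha he) (sz _ _).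
    have J : phi (u ++ sbracket a (sbracket b e) :: v) =
        phi (u ++ sbracket (sbracket a b) e :: v) +
        (-1) ^+ (deg a && deg b) * phi (u ++ sbracket b (sbracket a e) :: v).
      by rewrite (sbracketJ _ _ _ _ _ ha hb) (mlD ml) (mlZ ml).
    rewrite /word_rel in r1 r2 r3; rewrite !cat_rcons r1 r2 r3 J /sgn.
    by case: (deg a); case: (deg b); case: (deg e); rewrite /= ?expr0 ?expr1; ring.
  (* The values with [a,a] before and after a differ by the value with [[a,a],a], which is 0 by
     [odd_cube]. *)
  - move=> u a v oa Ww; rewrite /c cat_rcons.
    have [_ _ ha _ sn] := Wl _ _ _ _ Ww; rewrite oa in ha.
    have := rel u v _ _ _ _ (hom_sbracket _ _ _ _ ha ha) ha.
    rewrite /word_rel /= expr0 mul1r (odd_cube ha) (ml0 ml) addr0; apply.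
    by rewrite -sn !size_cat /= !addnS.
have [ext [ext_lin ext_basis ext_linr]] := hbasis_extension.
pose phi' u := if (size u <= n)%N then phi u else mext ext f u.
exists phi'; split; last by move=> u; rewrite /phi' => ->.
have ml' : multilinear phi'.
  move=> u d x y v; rewrite /phi' !size_cat /=; case: ifP => _; first exact: ml.
  exact: mext_multilinear.
split=> // u v a b i j ha hb; rewrite leq_eqVlt => /orP[/eqP sn|sn]; last first.
  rewrite /word_rel /phi' !size_cat /= in sn *.
  rewrite !ifT //; last by move: sn; rewrite !addnS; exact: ltnW.
  by apply: rel => //; rewrite size_cat.
apply: (word_rel_basis ml' _ ha hb sn) => {u v a b ha hb sn} u a b v Bw ha hb sn.
have Ww : W (u ++ a :: b :: v) by [].
have [Ba Bb _ _ sn'] := Wl _ _ _ _ Ww.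
rewrite /word_rel /phi' sn ltnn ifF; last by move: sn; rewrite !size_cat /= => ->; rewrite ltnn.
rewrite ifT; last by rewrite size_cat /= -sn' addnS.
rewrite !mext_basis //; last by case: (Wsw _ _ _ _ Ww).
by rewrite f_rel // /sgn (hbasis_deg Ba ha) (hbasis_deg Bb hb).
Qed.

(* Dual form of the Poincare-Birkhoff-Witt theorem: [phi] is a functional on U(L). *)
Lemma pbw_extension n psi : multilinear psi ->
  (forall u v a b (i j : bool), hom i a -> hom j b -> size (u ++ a :: b :: v) = n ->
     psi (u ++ a :: b :: v) = (-1) ^+ (i && j) * psi (u ++ b :: a :: v)) ->
  exists phi, [/\ multilinear phi,
    forall u v a b (i j : bool), hom i a -> hom j b -> word_rel phi u a b v i j,
    forall u, size u = n -> phi u = psi u &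
    forall u, (size u < n)%N -> phi u = 0].
Proof.
move=> ml sym; pose phi0 u := if (size u == n)%N then psi u else 0.
have c0 : compatible n phi0.
  split=> [u c x y v|u v a b i j ha hb].
    rewrite /phi0 !size_cat /=; case: ifP => _; first exact: ml.
    by rewrite mulr0 addr0.
  rewrite /word_rel /phi0 leq_eqVlt => /orP[/eqP sn|sn].
    have sn' : size (u ++ b :: a :: v) = n by rewrite -sn !size_cat.
    rewrite sn sn' eqxx (sym _ _ _ _ _ _ ha hb sn) ifF ?addr0 //.
    by apply/negbTE; rewrite -sn !size_cat /= !addnS neq_ltn ltnSn.
  rewrite !ifF ?mulr0 ?addr0 //; apply/negbTE; rewrite neq_ltn; apply/orP; left.
  - by move: sn; rewrite !size_cat /= !addnS; exact: ltnW.
  - by move: sn; rewrite !size_cat.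
  - exact: sn.
have [next hnext] : exists next : nat -> (seq L -> F) -> seq L -> F, forall m phi,
    compatible m phi -> compatible m.+1 (next m phi) /\
      forall u, (size u <= m)%N -> next m phi u = phi u.
  have ex (mp : nat * (seq L -> F)) : exists phi', compatible mp.1 mp.2 ->
      compatible mp.1.+1 phi' /\ forall u, (size u <= mp.1)%N -> phi' u = mp.2 u.
    case: (pselect (compatible mp.1 mp.2)) => [/compatible_step[phi' h]|h].
      by exists phi'.
    by exists phi0 => /h.
  by have [f hf] := choice ex; exists (fun m phi => f (m, phi)) => m phi; exact: (hf (m, phi)).
(* Stage k is compatible up to length n + k and later stages agree with it on those words. The limit
   reads a word [u] at stage [size u], which is late enough. *)
pose Phi := fix Phi k := if k is k'.+1 then next (n + k')%N (Phi k') else phi0.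
have cPhi k : compatible (n + k)%N (Phi k).
  by elim: k => [|k ih]; rewrite ?addn0 // addnS; have [] := hnext _ _ ih.
have ePhi k l u : (size u <= n + k)%N -> (k <= l)%N -> Phi l u = Phi k u.
  move=> su; elim: l => [|l ih]; first by rewrite leqn0 => /eqP->.
  rewrite leq_eqVlt => /orP[/eqP->//|kl]; rewrite -ih //=.
  have [_ ->//] := hnext _ _ (cPhi l); apply: leq_trans su _.
  by rewrite leq_add2l.
exists (fun u => Phi (size u) u); split=> [u c x y v|u v a b i j ha hb|u su|u su].
- by rewrite !size_cat /=; have [h _] := cPhi (size u + (size v).+1)%N; exact: h.
- rewrite /word_rel; have -> : Phi (size (u ++ sbracket a b :: v)) (u ++ sbracket a b :: v) =
      Phi (size (u ++ a :: b :: v)) (u ++ sbracket a b :: v).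
    by symmetry; apply: ePhi; rewrite ?leq_addl // !size_cat /= !addnS.
  rewrite !size_cat /=; have [_ h] := cPhi (size u + (size v).+2)%N.
  by apply: h => //; rewrite size_cat leq_addl.
- by rewrite (@ePhi 0%N) ?addn0 ?su // /= /phi0 su eqxx.
- rewrite (@ePhi 0%N) ?addn0 ?(ltnW su) //= /phi0 ifF //.
  by apply/negbTE; rewrite neq_ltn su.
Qed.
End PBW.

(** * Engel condition and central powers *)

Section Commutators.
Variables (R : nzRingType) (p : nat).
Hypothesis charR : p \in [pchar R].
Implicit Types x y u : R.

Lemma lcomm_cat x s t : lcomm x (s ++ t) = lcomm (lcomm x s) t.
Proof. exact: foldl_cat. Qed.

Lemma lcomm_binomial x u n : lcomm x (nseq n u) =
  \sum_(i < n.+1) ((-1) ^+ i * u ^+ i * x * u ^+ (n - i)) *+ 'C(n, i).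
Proof.
elim: n => [|n ih]; first by rewrite big_ord_recl big_ord0 /= !mul1r mulr1 addr0.
rewrite -addn1 nseqD lcomm_cat {}ih addn1 [LHS]/= /comm.
rewrite big_distrl big_distrr /= big_ord_recl [in RHS]big_ord_recl.
rewrite [X in _ - X]big_ord_recr [in RHS]big_ord_recr /=.
rewrite !bin0 !binn !subn0 !subnn !mulr1n !expr0 !mulr1 !mul1r.
rewrite -[x * _ * u]mulrA -exprSr -addrA; congr (_ + _).
have sgn_u k : (-1) ^+ k * u = u * (-1) ^+ k.
  by rewrite -signr_odd; case: odd; rewrite ?mulr1 ?mul1r ?mulrN1 ?mulN1r.
have step k y : (-1) ^+ bump 0 k * u ^+ bump 0 k * y = - (u * ((-1) ^+ k * u ^+ k * y)).
  rewrite /bump /= add1n !exprS mulN1r !mulNr; congr (- _).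
  by rewrite !mulrA -sgn_u -!mulrA.
rewrite opprD addrA step; congr (_ + _).
rewrite -sumrN -big_split /=; apply: eq_bigr => i _.
rewrite {2}/bump /= add1n binS mulrnDr mulrnAl mulrnAr subSS.
congr (_ + _); first by rewrite -!mulrA -exprSr /bump /= add1n -subSn.
by rewrite -mulNrn -[in RHS]mulrA step !mulrA.
Qed.

Hypothesis odd_p : odd p.

(** The inner binomial coefficients vanish in characteristic p, and the last term has sign -1
    because p is odd. *)
Lemma lcomm_prime x u : lcomm x (nseq p u) = comm x (u ^+ p).
Proof.
have pr : prime p := pcharf_prime charR.
rewrite lcomm_binomial; case: p pr charR odd_p => // q pr chq oq.
rewrite big_ord_recl big_ord_recr /= bin0 /bump /= add1n binn subnn !mulr1n !expr0 !mul1r mulr1.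
rewrite big1 ?add0r => [|i _]; last first.
  rewrite /bump /= add1n -mulr_natr (_ : _%:R = 0) ?mulr0 //.
  by apply/eqP; rewrite -(dvdn_pcharf chq) prime_dvd_bin //= ltnS ltn_ord.
by rewrite -signr_odd oq expr1 mulN1r mulNr.
Qed.

Lemma lcomm_pexp m x u : lcomm x (nseq (p ^ m) u) = comm x (u ^+ (p ^ m)).
Proof.
elim: m u => [|m ih] u; first by rewrite expn0 expr1.
have iter k y : lcomm y (nseq (k * p) u) = lcomm y (nseq k (u ^+ p)).
  elim: k y => [//|k ihk] y; rewrite mulSn nseqD lcomm_cat lcomm_prime ihk.
  by [].
by rewrite expnSr iter ih -exprM mulnC.
Qed.

Lemma lcomm0 s : lcomm (0 : R) s = 0.
Proof. by elim: s => //= u s; rewrite /comm mul0r mulr0 subr0. Qed.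

Lemma engel_central : bounded_engel R -> exists m, forall u x : R, u ^+ (p ^ m) * x = x * u ^+ (p ^ m).
Proof.
(* The Engel index n serves as exponent itself, since n <= p^n. *)
case=> n _ hn; exists n => u x; apply/esym/eqP; rewrite -subr_eq0; apply/eqP.
rewrite -[LHS]/(comm x _) -lcomm_pexp.
have /subnKC <- : (n <= p ^ n)%N.
  by apply/ltnW/ltn_expl/prime_gt1/(pcharf_prime charR).
by rewrite nseqD lcomm_cat hn lcomm0.
Qed.

Lemma central_engel N : (0 < N)%N ->
  (exists m, N = p ^ m)%N -> (forall u x : R, u ^+ N * x = x * u ^+ N) -> bounded_engel R.
Proof.
move=> N0 [m e] hN; exists N => // x y; rewrite e lcomm_pexp -e /comm hN subrr //.
Qed.
End Commutators.

Section PolynomialIdentity.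
Variables (F : fieldType) (R : algType F).

Lemma nc_evalE (v : nat -> R) (f : free_alg F nat) :
  nc_eval v f = \sum_(m <- msupp f) f@_m *: \prod_(x <- m) v x.
Proof. by apply: eq_bigr => m _; rewrite mulr_algl. Qed.

(** The identity is x_0 x_1^N - x_1^N x_0, whose two words differ because N > 0. *)
Lemma central_PI N : (0 < N)%N -> (forall u x : R, u ^+ N * x = x * u ^+ N) -> is_PI R.
Proof.
move=> N0 hN; pose w1 : {fmonom nat} := FMonom (0%N :: nseq N 1%N).
pose w2 : {fmonom nat} := FMonom (rcons (nseq N 1%N) 0%N).
exists (<< w1 >> - << w2 >> : free_alg F nat) => [|v].
  apply/eqP => /(congr1 (mcoeff w1)); rewrite mcoeffB !mcoeffU mcoeff0 eqxx.
  have -> : (w2 == w1) = false.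
    apply/negbTE; rewrite -val_eqE /=; by case: N N0 {hN w1 w2}.
  by rewrite subr0 => /eqP; rewrite oner_eq0.
rewrite /nc_eval raddfB /= !mmapU /= !scale1r !mul1r big_cons.
have e s : \prod_(x <- nseq s 1%N) v x = v 1%N ^+ s.
  by elim: s => [|s ih]; rewrite ?big_nil //= big_cons ih exprS.
by rewrite -cats1 big_cat big_seq1 /= e hN subrr.
Qed.
End PolynomialIdentity.

(** * Consequences of the Engel condition *)

Section EnvelopingFacts.
Variables (F : fieldType) (L : lieSuperalgType F) (U : algType F) (iota : L -> U).
Hypothesis env : env_quotient iota.
Implicit Types x y : L.

Lemma envD x y : iota (x + y) = iota x + iota y.
Proof. by rewrite -[x]scale1r (envP env) !scale1r. Qed.

Lemma env0 : iota 0 = 0.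
Proof. by have := envD 0 0; rewrite addr0 => /eqP; rewrite -subr_eq subrr eq_sym => /eqP. Qed.

Lemma envZ (c : F) x : iota (c *: x) = c *: iota x.
Proof. by rewrite -[c *: x]addr0 (envP env) env0 addr0. Qed.

Lemma envN x : iota (- x) = - iota x.
Proof. by rewrite -scaleN1r envZ scaleN1r. Qed.

Lemma env_even (i : bool) x y : hom false x -> hom i y ->
  iota x * iota y = iota y * iota x + iota (sbracket x y).
Proof. by move=> hx hy; rewrite (envM env hx hy) expr0 scale1r. Qed.

Lemma env_even_any x y : hom false x ->
  iota x * iota y = iota y * iota x + iota (sbracket x y).
Proof.
move=> hx; have [y0 [y1 [h0 h1 ->]]] := hom_sum y.
rewrite sbDr !envD mulrDr mulrDl (env_even hx h0) (env_even hx h1).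
by rewrite addrACA.
Qed.

Lemma env_odd x y : hom true x -> hom true y ->
  iota x * iota y + iota y * iota x = iota (sbracket x y).
Proof. by move=> hx hy; rewrite (envM env hx hy) expr1 scaleN1r addrAC addNr add0r. Qed.
End EnvelopingFacts.

Section Parity.
Variables (F : fieldType) (L : lieSuperalgType F).
Implicit Types x y : L.

Lemma even_proj : exists pr : L -> L,
  [/\ forall (c : F) x y, pr (c *: x + y) = c *: pr x + pr y, forall x, hom false (pr x),
      forall x, hom true (x - pr x), forall x, hom false x -> pr x = x &
      forall x, hom true x -> pr x = 0].
Proof.
have [pr hpr] := choice (fun x : L => hom_sum x).
have pr0 x : hom false (pr x) by have [x1 []] := hpr x.
have pr1 x : hom true (x - pr x).
  by have [x1 [_ h1 e]] := hpr x; rewrite {1}e addrC addKr.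
have uniq x y : hom false y -> hom true (x - y) -> pr x = y.
  move=> hy hxy; apply/eqP; rewrite -subr_eq0; apply/eqP.
  apply: (hom_direct _); first exact: (subspaceB (hom_subspace _)).
  have -> : pr x - y = (x - y) - (x - pr x) by rewrite opprB [RHS]addrC addrA subrK.
  exact: (subspaceB (hom_subspace _)).
exists pr; split=> // [c x y|x hx|x hx]; apply: uniq => //.
- exact: (hom_subspace false).2.
- have -> : c *: x + y - (c *: pr x + pr y) = c *: (x - pr x) + (y - pr y).
    by rewrite scalerBr opprD addrACA.
  exact: (hom_subspace true).2.
- by rewrite subrr; case: (hom_subspace (s := L) true).
- by case: (hom_subspace (s := L) false).
- by rewrite subr0.
Qed.

Lemma even_sep (z : L) : hom false z -> z <> 0 ->
  exists l : L -> F, [/\ lin l, forall x, hom true x -> l x = 0 & l z != 0].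
Proof.
move=> hz z0; have [l [ll lz]] : exists l : L -> F, lin l /\ l z != 0.
  have [[l hl]|h] := pselect (exists l : L -> F, lin l /\ l z != 0); first by exists l.
  case: z0; apply: separation0 => l ll; apply: contrapT => /eqP lz; apply: h.
  by exists l.
have [pr [lpr _ _ pr0 pr1]] := even_proj.
exists (fun x => l (pr x)); split=> [c x y|x hx|].
- by rewrite lpr ll.
- by rewrite pr1 // lin0.
- by rewrite pr0.
Qed.
End Parity.

Section DerivationForm.
Variables (F : fieldType) (L : lieSuperalgType F) (lam mu : L -> F).
Hypotheses (lam_lin : lin lam) (mu_lin : lin mu).
Hypothesis lam_odd : forall x, hom true x -> lam x = 0.

Definition lprod (u : seq L) : F := \prod_(x <- u) lam x.

(** The sum over the positions of [mu] at that position times [lam] at all the others: up to a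
    factorial, the polarisation of the polynomial mu lam^(n-1). When [lam] vanishes on odd elements
    this is supersymmetric, and on a word with exactly one odd letter only the term with [mu] there
    survives. *)
Fixpoint dform (u : seq L) : F :=
  if u is x :: u' then mu x * lprod u' + lam x * dform u' else 0.

Lemma lprod_multilinear : multilinear lprod.
Proof.
move=> u c x y v; rewrite /lprod !big_cat /= !big_cons lam_lin; ring.
Qed.

Lemma dform_multilinear : multilinear dform.
Proof.
move=> u c x y v; elim: u => [|z u ih] /=.
  by rewrite mu_lin lam_lin; ring.
by rewrite ih lprod_multilinear; ring.
Qed.

Lemma dform_sym (u v : seq L) a b (i j : bool) : hom i a -> hom j b ->
  dform (u ++ a :: b :: v) = (-1) ^+ (i && j) * dform (u ++ b :: a :: v).
Proof.
have lsym w : lprod (w ++ a :: b :: v) = lprod (w ++ b :: a :: v).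
  by rewrite /lprod !big_cat /= !big_cons; ring.
case: (boolP (i && j)) => [/andP[-> ->] ha hb|_ _ _].
  have l0 w : lprod (w ++ a :: b :: v) = 0.
    by rewrite /lprod big_cat /= !big_cons lam_odd // mul0r mulr0.
  elim: u => [|z u ih] /=; first by rewrite /lprod !big_cons !lam_odd //; ring.
  by rewrite ih -lsym l0; ring.
elim: u => [|z u ih] /=; first by rewrite /lprod !big_cons; ring.
by rewrite ih lsym; ring.
Qed.

Lemma lprod_nseq n z : lprod (nseq n z) = lam z ^+ n.
Proof. by rewrite /lprod; elim: n => [|n ih]; rewrite ?big_nil //= big_cons ih exprS. Qed.

Lemma dform_nseq n z : dform (nseq n.+1 z) = mu z * lam z ^+ n *+ n.+1.
Proof.
have cons u x : dform (x :: u) = mu x * lprod u + lam x * dform u by [].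
elim: n => [|n ih]; first by rewrite /= /lprod big_nil; ring.
by rewrite -[nseq n.+2 z]/(z :: nseq n.+1 z) cons lprod_nseq ih mulrnAr mulrCA -exprS -mulrS.
Qed.

End DerivationForm.

Section Engel.
Variables (F : fieldType) (p : nat).
Hypotheses (charF : p \in [pchar F]) (odd_p : odd p).
Variables (L : lieSuperalgType F) (U : algType F) (iota : L -> U).
Hypothesis env : enveloping iota.
Hypothesis odd_cube : forall y : L, hom true y -> sbracket (sbracket y y) y = 0.
Implicit Types x y z : L.

Lemma two_neq0 : 2%:R != 0 :> F.
Proof.
rewrite -(dvdn_pcharf charF) (dvdn_prime2 (pcharf_prime charF)) //.
by apply/eqP => p2; move: odd_p; rewrite p2.
Qed.

Lemma dform_functional lam mu n : lin lam -> lin mu -> (forall x, hom true x -> lam x = 0) ->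
  exists Phi : U -> F, [/\ lin Phi,
    forall u, size u = n -> Phi (\prod_(x <- u) iota x) = dform lam mu u &
    forall u, (size u < n)%N -> Phi (\prod_(x <- u) iota x) = 0].
Proof.
move=> ll lm lo.
have [|phi [ml rel e0 e1]] := pbw_extension two_neq0 odd_cube (n := n) (dform_multilinear ll lm).
  by move=> u v a b i j ha hb _; exact: dform_sym.
have [Phi [lP eP]] := env_functional env ml rel.
by exists Phi; split=> // u su; rewrite eP; [exact: e0 | exact: e1].
Qed.

Lemma env_inj x : iota x = 0 -> x = 0.
Proof.
move=> hx; apply: separation0 => mu lm.
(* With [lam = 0] and words of length 1 the form is [mu] itself. *)
have [||Phi [lP e _]] := dform_functional (lam := fun=> 0) 1 _ lm => //.
  by move=> *; rewrite mulr0 addr0.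
have := e [:: x] erefl; rewrite big_seq1 hx lin0 // /= /lprod big_nil => ->.
by ring.
Qed.

Lemma prod_nseq (t : L) n : \prod_(x <- nseq n t) iota x = iota t ^+ n.
Proof. by elim: n => [|n ih]; rewrite ?big_nil //= big_cons ih exprS. Qed.

Variable m : nat.
Let Q := (p ^ m)%N.
Hypothesis central : forall u x : U, u ^+ Q * x = x * u ^+ Q.

Let charU : p \in [pchar U] := rmorph_pchar (in_alg U) charF.

Lemma env_lcomm x y n : hom false x ->
  lcomm (iota y) (nseq n (iota x)) = (-1) ^+ n *: iota (iter n (ad x) y).
Proof.
move=> hx; elim: n => [|n ih]; first by rewrite scale1r.
rewrite -addn1 nseqD lcomm_cat ih addn1 [LHS]/= /comm -scalerAl -scalerAr -scalerBr exprS.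
rewrite mulN1r scaleNr -scalerN; congr (_ *: _).
by rewrite /= /ad (env_even_any env (iter n (sbracket x) y) hx) opprD addrA subrr sub0r.
Qed.

Lemma engel_ad x y : hom false x -> iter Q (ad x) y = 0.
Proof.
move=> hx; apply: env_inj; have := env_lcomm y Q hx.
rewrite (lcomm_pexp charU odd_p) /comm -central subrr => /esym/(congr1 ( *:%R ((-1) ^+ Q))).
by rewrite scalerA -expr2 sqrr_sign scale1r scaler0.
Qed.

Lemma even_non_nilpotent z N : hom false z -> iota z ^+ N = 0 -> z = 0.
Proof.
move=> hz hN; apply: contrapT => z0; have [lam [ll lo lz]] := even_sep hz z0.
(* The form takes the value n lam(z)^n at z^n. The length n = pN + 1 exceeds N and is 1 modulo p, so
   the factor n does not vanish. *)
have [Phi [lP e _]] := dform_functional (p * N).+1 ll ll lo.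
have := e (nseq (p * N).+1 z); rewrite size_nseq => /(_ erefl).
rewrite prod_nseq dform_nseq -exprS -mulr_natr -natr1 natrM (pcharf0 charF) mul0r add0r mulr1.
rewrite -[(p * N).+1]addn1 addnC exprD.
have /subnK <- : (N <= p * N)%N by rewrite leq_pmull // prime_gt0 // (pcharf_prime charF).
rewrite (exprD (iota z)) hN !mulr0 lin0 // => /esym/eqP.
by rewrite !(mulf_eq0, expf_eq0) (negPf lz) !andbF.
Qed.

(** Let W = X Z^(Q-1) Y. As Y and Z commute, [Y,W] = - Z^Q Y, and Z^Q is central, so bracketing Q
    times gives (- Z^Q)^Q Y. This is [Y, W^Q] = 0, hence Z^(Q^2) Y = 0. Multiplying Z = XY - YX by
    the central Z^(Q^2) gives Z^(Q^2+1) = 0, and z = 0 by [even_non_nilpotent]. *)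
Lemma heisenberg_free x y : hom false x -> hom false y ->
  sbracket (sbracket x y) y = 0 -> sbracket x y = 0.
Proof.
move=> hx hy hzy; set z := sbracket x y in hzy *.
have hz : hom false z := hom_sbracket _ _ _ _ hx hy.
set X := iota x; set Y := iota y; set Z := iota z.
have XY : X * Y = Y * X + Z := env_even env hx hy.
have ZY : Z * Y = Y * Z by rewrite (env_even env hz hy) hzy (env0 env) addr0.
have Q0 : (0 < Q)%N by rewrite expn_gt0 prime_gt0 // (pcharf_prime charF).
pose W := X * Z ^+ Q.-1 * Y.
have YZ k : Y * Z ^+ k = Z ^+ k * Y by apply: commrX; apply/esym.
have cYW : comm Y W = - (Z ^+ Q * Y).
  rewrite /comm /W !mulrA -[Y * X](addrK Z) -XY mulrBl mulrBl -exprS prednK //.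
  by rewrite -[X * Y * _]mulrA YZ !mulrA addrAC subrr sub0r.
clearbody W.
have lYW n : lcomm Y (nseq n W) = (- Z ^+ Q) ^+ n * Y.
  elim: n => [|n ih]; first by rewrite mul1r.
  rewrite -addn1 nseqD lcomm_cat ih addn1 [LHS]/= /comm.
  have cW : W * (- Z ^+ Q) ^+ n = (- Z ^+ Q) ^+ n * W.
    by apply: commrX; rewrite /GRing.comm mulrN mulNr central.
  rewrite [W * (_ * Y)]mulrA cW -!mulrA -mulrBr.
  by rewrite -[Y * W - _]/(comm Y W) cYW -mulNr mulrA -exprSr.
have := lYW Q; rewrite (lcomm_pexp charU odd_p) /comm -central subrr => /esym h.
have {}h : Z ^+ (Q * Q) * Y = 0.
  rewrite exprNn -mulrA in h; rewrite exprM.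
  have := congr1 ( *%R ((-1) ^+ Q)) h.
  by rewrite mulr0 mulrA -expr2 sqrr_sign mul1r.
apply: (@even_non_nilpotent z (Q * Q).+1) => //.
have cX : Z ^+ (Q * Q) * X = X * Z ^+ (Q * Q) by rewrite exprM central.
have -> : Z ^+ (Q * Q).+1 = Z ^+ (Q * Q) * (X * Y) - Z ^+ (Q * Q) * (Y * X).
  by rewrite -mulrBr XY addrAC subrr add0r exprSr.
by rewrite mulrA cX -mulrA h mulr0 mulrA h mul0r subrr.
Qed.

Lemma even_abelian x y : hom false x -> hom false y -> sbracket x y = 0.
Proof.
move=> hx hy; apply: contrapT => nxy.
have ex : exists n, iter n (ad y) x == 0 by exists Q; rewrite engel_ad.
have hit n : hom false (iter n (ad y) x).
  by elim: n => // n ih; exact: (hom_sbracket _ _ _ _ hy ih).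
(* For the least n with (ad y)^n x = 0, if n >= 2, the elements (ad y)^(n-2) x and y satisfy the
   hypothesis of [heisenberg_free], so already (ad y)^(n-1) x = 0. *)
case: (ex_minnP ex) => n /eqP hn min.
case: n hn min => [|[|n]] hn min.
- by apply: nxy; rewrite -[x]/(iter 0 (ad y) x) hn sb0l.
- by apply: nxy; rewrite (sbracketC _ _ _ _ hx hy) -[sbracket y x]/(iter 1 (ad y) x) hn scaler0 oppr0.
have e : sbracket (iter n (ad y) x) y = - iter n.+1 (ad y) x.
  by rewrite (sbracketC _ _ _ _ (hit n) hy) expr0 scale1r.
have := heisenberg_free (hit n) hy; rewrite e -scaleN1r sbZl.
rewrite (sbracketC _ _ _ _ (hit n.+1) hy) -[sbracket y _]/(iter n.+2 (ad y) x) hn.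
rewrite scaler0 oppr0 scaler0 => /(_ erefl) /eqP; rewrite scaleN1r oppr_eq0 => h.
by have := min _ h; rewrite ltnn.
Qed.

Section OddSquare.
Variable y : L.
Hypotheses (hy : hom true y) (yy : sbracket y y <> 0).
Let t := sbracket y y.
Let ht : hom false t := hom_sbracket _ _ _ _ hy hy.
Let k := Q./2.
Let T_even x : hom false x -> iota t * iota x = iota x * iota t.
Proof. by move=> hx; rewrite (env_even env ht hx) even_abelian // (env0 env) addr0. Qed.

(** The exponent Q = 2k + 1 is odd and the square of [iota y] is half of [iota t], so this product
    is a multiple of the central power [iota y ^+ Q]. *)
Let yT_central u : iota y * iota t ^+ k * u = u * (iota y * iota t ^+ k).
Proof.
have e : iota y * iota t ^+ k = (2%:R ^+ k : F) *: iota y ^+ Q.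
  have -> : Q = (2 * k).+1 by rewrite mul2n -add1n -[LHS](odd_double_half Q) oddX odd_p orbT.
  rewrite exprS exprM scalerAr; congr (_ * _).
  rewrite -exprZn -(env_odd env hy hy) -expr2; congr (_ ^+ _).
  by rewrite scaler_nat mulr2n.
by rewrite e -scalerAl central scalerAr.
Qed.

(** As t commutes with x, the product [x,y] t^k is the commutator of x with the central y t^k, hence
    0. Its value under the functional of [dform] is mu([x,y]) lam(t)^k with lam(t) nonzero and mu
    arbitrary. *)
Lemma odd_square_even x : hom false x -> sbracket x y = 0.
Proof.
move=> hx; apply: separation0 => mu lm.
have hxy : hom true (sbracket x y) := hom_sbracket _ _ _ _ hx hy.
have [lam [ll lo lt]] := even_sep ht yy.
have [Phi [lP e _]] := dform_functional k.+1 ll lm lo.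
have := e (sbracket x y :: nseq k t); rewrite /= size_nseq => /(_ erefl).
rewrite big_cons lprod_nseq (lo _ hxy) mul0r addr0 prod_nseq.
have -> : iota (sbracket x y) * iota t ^+ k = 0.
  have -> : iota (sbracket x y) = iota x * iota y - iota y * iota x.
    by rewrite (env_even env hx hy) addrAC subrr add0r.
  have cT : iota t ^+ k * iota x = iota x * iota t ^+ k.
    by apply/esym/commrX/esym/T_even.
  by rewrite mulrBl -!mulrA -cT [in X in _ - X]mulrA yT_central subrr.
rewrite lin0 // => /esym/eqP; rewrite mulf_eq0 expf_eq0 (negPf lt) andbF orbF.
by move=> /eqP.
Qed.

(** With s = [y,v], centrality of y t^k gives v t^(k+1) = y s t^k, an equality of two words of
    length k + 2. If v were not a multiple of y, take mu with mu(y) = 0 and mu(v) = 1: the form is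
    lam(t)^(k+1) on the left and 0 on the right. *)
Lemma odd_square_dim v : (forall x z, hom false x -> hom true z -> sbracket x z = 0) ->
  hom true v -> exists c, v = c *: y.
Proof.
move=> h01 hv; apply: contrapT => nv.
have [||mu [lm my mv]] := separation (E := fun x => exists c, x = c *: y) (x := v).
- split=> [|c _ _ [d ->] [e ->]]; first by exists 0; rewrite scale0r.
  by exists (c * d + e); rewrite scalerDl scalerA.
- by [].
have {}my : mu y = 0 by apply: my; exists 1; rewrite scale1r.
have [lam [ll lo lt]] := even_sep ht yy.
have [Phi [lP e _]] := dform_functional k.+2 ll lm lo.
pose s := sbracket y v; have hs : hom false s := hom_sbracket _ _ _ _ hy hv.
have Tv : iota t * iota v = iota v * iota t.
  by rewrite (env_even env ht hv) h01 // (env0 env) addr0.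
have Tvk : iota t ^+ k * iota v = iota v * iota t ^+ k by apply/esym/commrX/esym.
have key : iota v * iota t ^+ k.+1 = iota y * (iota s * iota t ^+ k).
  have h1 : iota y * iota v * iota t ^+ k = iota v * iota y * iota t ^+ k.
    by rewrite -mulrA -Tvk mulrA yT_central mulrA.
  have h2 : iota s * iota t ^+ k = 2%:R *: (iota y * iota v * iota t ^+ k).
    by rewrite -(env_odd env hy hv) mulrDl -h1 scaler_nat mulr2n.
  have yy2 : 2%:R *: (iota y * iota y) = iota t.
    by rewrite -(env_odd env hy hy) scaler_nat mulr2n.
  rewrite h2 -scalerAr !mulrA -[_ * _ * iota t ^+ k]mulrA scalerAl yy2.
  by rewrite exprS !mulrA Tv.
have dcons u x : dform lam mu (x :: u) = mu x * lprod lam u + lam x * dform lam mu u by [].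
have := e (v :: nseq k.+1 t); rewrite big_cons prod_nseq key dcons lprod_nseq mv mul1r.
have := e (y :: s :: nseq k t); rewrite !big_cons prod_nseq dcons my mul0r.
rewrite (lo _ hy) (lo _ hv) !mul0r !addr0 /= !size_nseq => -> // /(_ erefl)/esym/eqP.
by rewrite expf_eq0 (negPf lt).
Qed.
End OddSquare.

Lemma odd_dichotomy :
  (forall x y, hom true x -> hom true y -> sbracket x y = 0) \/
  exists y, hom true y /\ (forall x z, hom false x -> hom true z -> sbracket x z = 0) /\
    forall v, hom true v -> exists c, v = c *: y.
Proof.
have [[y [hy yy]]|h] := pselect (exists y, hom true y /\ sbracket y y <> 0).
  right; exists y; split=> //.
  have h01 x z : hom false x -> hom true z -> sbracket x z = 0.
    move=> hx hz; have [zz|zz] := pselect (sbracket z z = 0); last exact: (odd_square_even hz zz hx).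
    (* If [z,z] = 0, the squares of y + z and y - z add up to 2 [y,y], so one of them is nonzero and
       [odd_square_even] applies to it. *)
    have [yz|yz] := pselect (sbracket (y + z) (y + z) = 0); last first.
      have := odd_square_even (homD hy hz) yz hx.
      by rewrite sbDr (odd_square_even hy yy hx) add0r.
    have yNz : sbracket (y - z) (y - z) <> 0.
      move=> h; apply: yy; move: yz h; rewrite -scaleN1r !sbDl !sbDr !(sbZl, sbZr) zz !scaler0 !addr0.
      rewrite (sbracketC _ _ _ _ hz hy) expr1 !scaleN1r opprK => h1 h2.
      have : 2%:R *: sbracket y y = 0.
        have := congr2 +%R h1 h2.
        by rewrite addrACA subrr addr0 addrACA subrr !addr0 scaler_nat mulr2n.
      by move=> /eqP; rewrite scaler_eq0 (negPf two_neq0) => /eqP.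
    have hyz : hom true (y - z) by apply: subspaceB (hom_subspace _) _ _.
    have := odd_square_even hyz yNz hx.
    rewrite sbDr (odd_square_even hy yy hx) add0r -scaleN1r sbZr scaleN1r => /eqP.
    by rewrite oppr_eq0 => /eqP.
  split=> // v hv; exact: odd_square_dim.
left=> x y hx hy; have z0 z : hom true z -> sbracket z z = 0.
  by move=> hz; apply: contrapT => hzz; apply: h; exists z.
have := z0 _ (homD hx hy); rewrite !sbDl !sbDr !z0 // add0r addr0.
rewrite (sbracketC _ _ _ _ hy hx) expr1 scaleN1r opprK -mulr2n -scaler_nat => /eqP.
by rewrite scaler_eq0 (negPf two_neq0) => /eqP.
Qed.
End Engel.

(** * Multilinear identities *)

Section Words.
Variable I : finType.

Fixpoint words k : seq (seq I) :=
  if k is k'.+1 then [seq i :: w | i <- enum I, w <- words k'] else [:: [::]].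

Lemma mem_words k w : (w \in words k) = (size w == k).
Proof.
elim: k w => [|k ih] [|i w] //=; first by apply/negbTE/allpairsP => -[[? ?] []].
rewrite eqSS -ih; apply/allpairsP/idP => [[[j u] /= [_ hu [_ ->]]]|hw] //.
by exists (i, w); rewrite mem_enum.
Qed.

Lemma words_uniq k : uniq (words k).
Proof.
elim: k => //= k ih; apply: allpairs_uniq => //; first exact: enum_uniq.
by move=> [i u] [j v] _ _ /= [-> ->].
Qed.
End Words.

Section Multilinearization.
Variables (F : fieldType) (R : algType F).

(** Take a longest word w_0 of the identity, of length d, give each of its positions i its own
    variable y_i, and substitute for a variable x_n the sum of the y_i at whose positions n stands.
    The part in which all y_i occur is multilinear because no word is longer than d, and the
    coefficient at y_0 ... y_(d-1) is that of w_0. *)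
Lemma PI_multilinear : is_PI R -> exists (d : nat) (alpha : seq 'I_d -> F),
  alpha (enum 'I_d) != 0 /\ forall y : 'I_d -> R,
    \sum_(w <- permutations (enum 'I_d)) alpha w *: \prod_(i <- w) y i = 0.
Proof.
case=> f f0 fv.
have [w0 w0f w0max] : exists2 w0 : {fmonom nat}, w0 \in msupp f &
    forall m : {fmonom nat}, m \in msupp f -> (size m <= size w0)%N.
  have hex : exists n, has (fun m : {fmonom nat} => size m == n) (msupp f).
    have : msupp f != fset0 by rewrite msupp_eq0.
    by move=> /fset0Pn[m mf]; exists (size m); apply/hasP; exists m.
  have hub n : has (fun m : {fmonom nat} => size m == n) (msupp f) ->
      (n <= \max_(m <- msupp f) size m)%N.
    move=> /hasP[m mf /eqP <-]; exact: (leq_bigmax_seq (F := fun m : {fmonom nat} => size m)).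
  case: (ex_maxnP hex hub) => n /hasP[w0 w0f /eqP <-] max.
  by exists w0 => // m mf; apply: max; apply/hasP; exists m.
pose d := size w0; pose lam (i : 'I_d) := nth 0%N w0 i.
pose alpha (w : seq 'I_d) := f@_(FMonom (map lam w)).
exists d, alpha; split.
  rewrite /alpha mcoeff_neq0.
  have -> : map lam (enum 'I_d) = w0.
    by rewrite (map_comp (nth 0%N w0) val) val_enum_ord map_nth_iota0 // take_size.
  by rewrite fmK.
pose g (w : seq 'I_d) (y : 'I_d -> R) := \prod_(i <- w) y i.
pose v (y : 'I_d -> R) n := \sum_(i | lam i == n) y i.
have g_v y (s : seq nat) :
    \prod_(x <- s) v y x = \sum_(w <- words 'I_d (size s) | map lam w == s) g w y.
  elim: s => [|x s ih]; first by rewrite big_nil /= big_cons big_nil /= addr0 /g big_nil.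
  rewrite big_cons ih /v [RHS]big_mkcond /= big_allpairs_dep big_enum /= big_distrl [LHS]big_mkcond /=.
  apply: eq_bigr => i _; rewrite -big_mkcond /=; case E: (lam i == x); last first.
    by rewrite big_pred0 // => w; rewrite eqseq_cons E.
  rewrite big_distrr /=; apply: eq_big => w; first by rewrite eqseq_cons E.
  by rewrite /g big_cons.
have g_f y : \sum_(k < d.+1) \sum_(w <- words 'I_d k) alpha w *: g w y = 0.
  rewrite -[RHS](fv (v y)) nc_evalE.
  transitivity (\sum_(k < d.+1) \sum_(w <- words 'I_d k)
      \sum_(m <- msupp f | m == FMonom (map lam w)) f@_m *: g w y).
    apply: eq_bigr => k _; apply: eq_bigr => w _; rewrite /alpha.
    have [mf|nmf] := boolP (FMonom (map lam w) \in msupp f).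
      by rewrite -big_filter filter_pred1_uniq // ?fset_uniq // big_seq1.
    rewrite mcoeff_outdom // scale0r big_seq_cond big_pred0 // => m.
    by apply/negbTE; apply: contraNN nmf => /andP[mf /eqP <-].
  under eq_bigr do rewrite (exchange_big_dep xpredT) //=.
  rewrite exchange_big /=; rewrite big_seq [RHS]big_seq; apply: eq_bigr => m mf.
  have sm : (size m < d.+1)%N by rewrite ltnS; exact: w0max.
  rewrite (bigD1 (Ordinal sm)) //= [X in _ + X]big1 ?addr0 => [|k /negPf nk]; last first.
    rewrite big_seq_cond big_pred0 // => w; rewrite mem_words.
    apply/negbTE; apply: contraFN nk => /andP[/eqP sw /eqP em].
    by rewrite -val_eqE /= -sw em /= size_map.
  rewrite g_v scaler_sumr; apply: eq_bigl => w.
  by rewrite -val_eqE /= eq_sym.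
(* Subtracting the value at [y i] = 0 keeps exactly the words that contain [i]. *)
have g_s (s : seq 'I_d) y : \sum_(k < d.+1)
    \sum_(w <- words 'I_d k | all (fun i => i \in w) s) alpha w *: g w y = 0.
  elim: s y => [|i s ih] y; first by rewrite -[RHS](g_f y); apply: eq_bigr => k _; apply: eq_bigl.
  have := congr2 (fun a b => a - b) (ih y) (ih (fun j => if j == i then 0 else y j)).
  rewrite subr0 => h; rewrite -[RHS]h -sumrB.
  apply: eq_bigr => k _; rewrite big_mkcond [X in X - _]big_mkcond [X in _ - X]big_mkcond /= -sumrB.
  apply: eq_bigr => w _; case: (all _ s); rewrite ?andbT ?andbF ?subr0 //.
  have [iw|niw] := boolP (i \in w).
    suff -> : g w (fun j => if j == i then 0 else y j) = 0 by rewrite scaler0 subr0.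
    rewrite /g; elim: w iw => // j w ihw; rewrite inE big_cons => /orP[/eqP <-|/ihw->].
      by rewrite eqxx mul0r.
    by rewrite mulr0.
  rewrite [X in _ - X](_ : _ = alpha w *: g w y) ?subrr //; congr (_ *: _).
  apply: eq_big_seq => j jw; rewrite ifN //; apply: contraNneq niw => <- //.
move=> y; rewrite -[RHS](g_s (enum 'I_d) y) big_ord_recr /= [X in _ = X + _]big1 ?add0r => [|k _].
  rewrite -[RHS]big_filter; apply: perm_big; apply: uniq_perm.
  - exact: permutations_uniq.
  - by rewrite filter_uniq // words_uniq.
  move=> w; rewrite mem_permutations mem_filter mem_words.
  apply/idP/andP => [pw|[/allP hw /eqP sw]].
    by split; [apply/allP => i; rewrite (perm_mem pw) | rewrite (perm_size pw) size_enum_ord].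
  have [|sz eqi] := uniq_min_size (enum_uniq 'I_d) hw; first by rewrite size_enum_ord sw.
  by rewrite perm_sym; apply: uniq_perm; rewrite ?enum_uniq // -(eq_uniq sz eqi) enum_uniq.
rewrite big_seq_cond big1 // => w /andP[]; rewrite mem_words => /eqP sw /allP hw.
have := uniq_leq_size (enum_uniq 'I_d) hw.
by rewrite size_enum_ord sw leqNgt ltn_ord.
Qed.
End Multilinearization.

(** * Action on alternating forms *)

Section AlternatingForms.
Variables (F : fieldType) (L : lieSuperalgType F).
Implicit Types (d : seq L -> F) (u v m : seq L) (x y z a b : L) (l : L -> F).

(** Exterior calculus on functions of words: [con] is contraction, [lieD a] the Lie derivative (ad a
    inserted in each argument in turn), [wedge l] exterior multiplication by the one-form [l]. No
    degree is fixed; a form may have components of all degrees. *)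
Definition con x d m : F := d (x :: m).

Fixpoint lieD a d m : F :=
  if m is x :: m' then d (sbracket a x :: m') + lieD a (con x d) m' else 0.

Fixpoint wedge l d m : F :=
  if m is x :: m' then l x * d m' - wedge l (con x d) m' else 0.

Definition alternating d := multilinear d /\
  forall u x y v, d (u ++ x :: y :: v) = - d (u ++ y :: x :: v).

Definition fcomb (c : F) d d' m : F := c * d m + d' m.

Lemma lieD_comb a c d d' : lieD a (fcomb c d d') = fcomb c (lieD a d) (lieD a d').
Proof.
apply/funext => m; elim: m d d' => [|x m ih] d d'; first by rewrite /fcomb /= mulr0 addr0.
by rewrite /= (ih (con x d) (con x d')) /fcomb /=; ring.
Qed.

Lemma wedge_comb l c d d' : wedge l (fcomb c d d') = fcomb c (wedge l d) (wedge l d').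
Proof.
apply/funext => m; elim: m d d' => [|x m ih] d d'; first by rewrite /fcomb /= mulr0 addr0.
by rewrite /= (ih (con x d) (con x d')) /fcomb /=; ring.
Qed.

Lemma alternating_comb c d d' : alternating d -> alternating d' -> alternating (fcomb c d d').
Proof.
move=> [ml alt] [ml' alt']; split=> [u e x y v|u x y v]; rewrite /fcomb.
  by rewrite ml ml'; ring.
by rewrite alt alt'; ring.
Qed.

Lemma alternating_con x d : alternating d -> alternating (con x d).
Proof.
move=> [ml alt]; split=> [u c y z v|u y z v]; rewrite /con.
  exact: (ml (x :: u)).
exact: (alt (x :: u)).
Qed.

Lemma alternating0 : alternating (fun=> 0).
Proof. by split=> [u c x y v|u x y v]; rewrite ?mulr0 ?addr0 ?oppr0. Qed.

Lemma con_swap x y d : alternating d -> con x (con y d) = fcomb (-1) (con y (con x d)) (fun=> 0).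
Proof.
move=> [_ alt]; apply/funext => m; rewrite /con /fcomb (alt [::]) /=; ring.
Qed.

Lemma con_linear c x y d : alternating d -> con (c *: x + y) d = fcomb c (con x d) (con y d).
Proof. by move=> [ml _]; apply/funext => m; exact: (ml [::]). Qed.
Lemma lieD0 a : lieD a (fun=> 0) = (fun=> 0).
Proof. by apply/funext => m; elim: m => //= x m ih; rewrite ih addr0. Qed.

Lemma wedge0 l : wedge l (fun=> 0) = (fun=> 0).
Proof. by apply/funext => m; elim: m => //= x m ih; rewrite ih mulr0 subr0. Qed.

Lemma lieD_linear c a b d : alternating d -> lieD (c *: a + b) d = fcomb c (lieD a d) (lieD b d).
Proof.
move=> hd; apply/funext => m; elim: m d hd => [|x m ih] d hd.
  by rewrite /fcomb /= mulr0 addr0.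
rewrite /= ih; last exact: alternating_con.
have [ml _] := hd; rewrite sbracketPl (ml [::]) /fcomb /=; ring.
Qed.

Lemma con_lieD x a d : con x (lieD a d) = fcomb 1 (con (sbracket a x) d) (lieD a (con x d)).
Proof. by apply/funext => m; rewrite /con /fcomb /= mul1r. Qed.

Lemma con_wedge x l d : con x (wedge l d) = fcomb (l x) d (fcomb (-1) (wedge l (con x d)) (fun=> 0)).
Proof. by apply/funext => m; rewrite /con /fcomb /=; ring. Qed.

Lemma alternating_lieD a d : alternating d -> alternating (lieD a d).
Proof.
move=> hd; split=> [u c x y v|u x y v].
  elim: u d hd => [|z u ih] d hd /=.
    have [ml _] := hd; rewrite sbracketPr (ml [::]) con_linear //.
    by rewrite lieD_comb /fcomb /=; ring.
  have [ml _] := hd.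
  by rewrite ih; [rewrite (ml (_ :: u)) /=; ring | exact: alternating_con].
elim: u d hd => [|z u ih] d hd /=; have [_ alt] := hd.
  rewrite con_swap // lieD_comb lieD0 /fcomb /con.
  by rewrite (alt [::] _ y) (alt [::] x) /=; ring.
by rewrite ih; [rewrite (alt (_ :: u)) /=; ring | exact: alternating_con].
Qed.

Lemma alternating_wedge l d : lin l -> alternating d -> alternating (wedge l d).
Proof.
move=> ll hd; split=> [u c x y v|u x y v].
  elim: u d hd => [|z u ih] d hd /=.
    by rewrite ll con_linear // wedge_comb /fcomb; ring.
  have [ml _] := hd.
  by rewrite ih; [rewrite ml; ring | exact: alternating_con].
elim: u d hd => [|z u ih] d hd /=; have [_ alt] := hd.
  by rewrite con_swap // wedge_comb wedge0 /fcomb /con; ring.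
by rewrite ih; [rewrite alt; ring | exact: alternating_con].
Qed.

Lemma lieD_wedge a l d : lieD a (wedge l d) =
  fcomb 1 (wedge (fun x => l (sbracket a x)) d) (wedge l (lieD a d)).
Proof.
apply/funext => m; elim: m d => [|x m ih] d; first by rewrite /fcomb /= mulr0 addr0.
by rewrite /fcomb /= con_wedge con_lieD wedge_comb !lieD_comb lieD0 /fcomb ih /fcomb; ring.
Qed.

Hypothesis even_abel : forall x y, hom false x -> hom false y -> sbracket x y = 0.
Hypothesis odd_abel : forall x y, hom true x -> hom true y -> sbracket x y = 0.

Lemma even_comm a b x : hom false a -> hom false b ->
  sbracket a (sbracket b x) = sbracket b (sbracket a x).
Proof.
by move=> ha hb; rewrite (sbracketJ _ _ _ _ _ ha hb) (even_abel ha hb) sb0l add0r expr0 scale1r.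
Qed.

Lemma lieD_comm a b d : hom false a -> hom false b -> lieD a (lieD b d) = lieD b (lieD a d).
Proof.
move=> ha hb; apply/funext => m; elim: m d => [//|x m ih] d.
rewrite /= !con_lieD !lieD_comb /fcomb ih (even_comm x ha hb) /con; ring.
Qed.

Section Action.
Variable pr : L -> L.
Hypotheses (pr_lin : forall (c : F) x y, pr (c *: x + y) = c *: pr x + pr y)
  (pr_even : forall x, hom false (pr x)) (pr_odd : forall x, hom true (x - pr x))
  (pr_id : forall x, hom false x -> pr x = x) (pr0 : forall x, hom true x -> pr x = 0).

(* Right action of U(L) on alternating forms, dual to its action on the exterior algebra of L_1. *)
Definition act d x := fcomb 1 (lieD (pr x) d) (con (x - pr x) d).

Lemma act_alternating d x : alternating d -> alternating (act d x).
Proof.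
by move=> hd; apply: alternating_comb; [exact: alternating_lieD | exact: alternating_con].
Qed.

Lemma acts_alternating d u : alternating d -> alternating (foldl act d u).
Proof. by elim: u d => //= x u ih d hd; apply/ih/act_alternating. Qed.

Lemma act_comb c d d' x : act (fcomb c d d') x = fcomb c (act d x) (act d' x).
Proof. by apply/funext => m; rewrite /act lieD_comb /fcomb /con; ring. Qed.

Lemma acts_comb c d d' u : foldl act (fcomb c d d') u = fcomb c (foldl act d u) (foldl act d' u).
Proof. by elim: u d d' => //= x u ih d d'; rewrite act_comb ih. Qed.

Lemma act_linear d (c : F) x y : alternating d -> act d (c *: x + y) = fcomb c (act d x) (act d y).
Proof.
move=> hd; rewrite /act pr_lin lieD_linear //.
have -> : c *: x + y - (c *: pr x + pr y) = c *: (x - pr x) + (y - pr y).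
  by rewrite scalerBr opprD addrACA.
by rewrite con_linear //; apply/funext => m; rewrite /fcomb; ring.
Qed.

Lemma act_even d a : alternating d -> hom false a -> act d a = lieD a d.
Proof.
move=> [ml _] ha; rewrite /act pr_id // subrr; apply/funext => m.
by rewrite /fcomb mul1r /con (ml0 ml [::]) addr0.
Qed.

Lemma act_odd d x : alternating d -> hom true x -> act d x = con x d.
Proof.
move=> hd hx; rewrite /act pr0 // subr0; apply/funext => m; rewrite /fcomb mul1r.
suff -> : lieD 0 d = fun=> 0 by rewrite add0r.
have := lieD_linear (-1) 0 0 hd; rewrite scaler0 addr0 => ->.
by apply/funext => n; rewrite /fcomb; ring.
Qed.

(** Odd-odd is the anticommutation of contractions, even-even the commutation of Lie derivatives,
    and the mixed cases are Cartan's formula [con_lieD]. *)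
Lemma act_rel d (i j : bool) a b : alternating d -> hom i a -> hom j b ->
  act (act d a) b = fcomb ((-1) ^+ (i && j)) (act (act d b) a) (act d (sbracket a b)).
Proof.
move=> hd ha hb; have had := act_alternating a hd; have hbd := act_alternating b hd.
have hab : hom (i (+) j) (sbracket a b) := hom_sbracket _ _ _ _ ha hb.
case: i j ha hb hab => [] [] ha hb hab; rewrite /= in hab *.
- rewrite (act_odd had hb) (act_odd hd ha) (act_odd hbd ha) (act_odd hd hb) odd_abel //.
  rewrite con_swap // act_even //; last by case: (hom_subspace (s := L) false).
  have -> : lieD 0 d = fun=> 0; last by [].
  have := lieD_linear (-1) 0 0 hd; rewrite scaler0 addr0 => ->.
  by apply/funext => n; rewrite /fcomb; ring.
- rewrite (act_even had hb) (act_odd hd ha) (act_odd hbd ha) (act_even hd hb) (act_odd hd hab).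
  rewrite con_lieD (sbracketC _ _ _ _ ha hb) expr0 scale1r -scaleN1r.
  have := con_linear (-1) (sbracket b a) 0 hd; rewrite addr0 => ->.
  have -> : con 0 d = fun=> 0 by apply/funext => m; have [ml _] := hd; exact: (ml0 ml [::]).
  by apply/funext => m; rewrite /fcomb; ring.
- rewrite (act_odd had hb) (act_even hd ha) (act_even hbd ha) (act_odd hd hb) (act_odd hd hab).
  by rewrite con_lieD; apply/funext => m; rewrite /fcomb; ring.
- rewrite (act_even had hb) (act_even hd ha) (act_even hbd ha) (act_even hd hb) (act_even hd hab).
  rewrite lieD_comm // even_abel //.
  have -> : lieD 0 d = fun=> 0.
    have := lieD_linear (-1) 0 0 hd; rewrite scaler0 addr0 => ->.
    by apply/funext => n; rewrite /fcomb; ring.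
  by apply/funext => m; rewrite /fcomb; ring.
Qed.

Lemma act_functional (U : algType F) (iota : L -> U) d : enveloping iota -> alternating d ->
  exists Phi : U -> F, lin Phi /\ forall u, Phi (\prod_(x <- u) iota x) = foldl act d u [::].
Proof.
move=> env hd; apply: (env_functional env (phi := fun u => foldl act d u [::])).
  move=> u c x y v; rewrite !foldl_cat /= act_linear; last exact: acts_alternating.
  by rewrite acts_comb.
move=> u v a b i j ha hb; rewrite /word_rel !foldl_cat /=.
rewrite (act_rel (acts_alternating u hd) ha hb) acts_comb //.
Qed.
End Action.
End AlternatingForms.

(** * Finite codimension and commuting nilpotent operators *)

Lemma big_permutations (R : nmodType) (I : eqType) (S : seq I) (G : seq I -> R) :
  uniq S -> S != [::] ->
  \sum_(w <- permutations S) G w =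
  \sum_(k <- S) \sum_(w <- permutations (rem k S)) G (rcons w k).
Proof.
move=> uS S0; rewrite -(big_allpairs_dep (h := fun k w => rcons w k) (r2 := fun k => permutations (rem k S))).
apply: perm_big; apply: uniq_perm; first exact: permutations_uniq.
  apply: allpairs_uniq_dep => //; first by move=> k _; exact: permutations_uniq.
  by move=> [k u] [l v] _ _ /= /eqP; rewrite eqseq_rcons => /andP[/eqP-> /eqP->].
move=> w; rewrite mem_permutations; apply/idP/allpairsPdep.
  case/lastP: w => [|w k]; first by move=> /perm_size; case: S S0 {uS}.
  move=> pw; have kS : k \in S by rewrite -(perm_mem pw) mem_rcons mem_head.
  exists k, w; split=> //; rewrite mem_permutations -(perm_cons k).
  by rewrite -perm_rcons (permPl pw) perm_to_rem.
move=> [k [u [kS]]]; rewrite mem_permutations => pu ->.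
by rewrite perm_rcons (permPr (perm_to_rem kS)) perm_cons.
Qed.

Section FiniteCodimension.
Variables (F : fieldType) (V : lmodType F).

(** Finite intersections of kernels of functionals, the form in which the conditions arise;
    [fincodim_complement] turns them into finite complements. *)
Inductive fincodim : (V -> Prop) -> Prop :=
| fincodimT : fincodim (fun=> True)
| fincodimK (l : V -> F) of lin l : fincodim (fun x => l x = 0)
| fincodimI (P Q : V -> Prop) of fincodim P & fincodim Q : fincodim (fun x => P x /\ Q x).

Lemma fincodim_subspace P : fincodim P -> subspace P.
Proof.
elim=> {P} [|l ll|P Q _ hP _ hQ]; [by split | exact: ker_subspace |].
by case: hP hQ => P0 hP [Q0 hQ]; split=> // c x y [Px Qx] [Py Qy]; split; auto.
Qed.

Lemma fincodim_complement (A P : V -> Prop) : subspace A -> fincodim P ->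
  exists es : seq V, (forall e, e \in es -> A e) /\
    forall x, A x -> exists y, [/\ A y, P y & span (fun z => z \in es) (x - y)].
Proof.
move=> sA fP; elim: fP A sA => {P} [|l ll|P Q fP ihP _ ihQ] A sA.
- by exists [::]; split=> // x Ax; exists x; split=> //; rewrite subrr; exact: span0.
- have [[e [Ae le]]|hl] := pselect (exists e, A e /\ l e <> 0); last first.
    exists [::]; split=> // x Ax; exists x; split=> //; last by rewrite subrr; exact: span0.
    by apply: contrapT => lx; apply: hl; exists x.
  exists [:: e]; split=> [z|x Ax]; first by rewrite inE => /eqP->.
  exists (x - (l x / l e) *: e); split.
  + by apply: subspaceB => //; apply: subspaceZ.
  + by rewrite linB // linZ // divfK ?subrr //; apply/eqP.
  + by rewrite subKr; apply: (subspaceZ _ (span_subspace _)); apply: span_id; rewrite mem_head.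
have [es [hes hx]] := ihP A sA.
have sAP : subspace (fun x => A x /\ P x).
  have [A0 hA] := sA; have [P0 hP] := fincodim_subspace fP.
  by split=> // c x y [Ax Px] [Ay Py]; split; auto.
have [fs [hfs hy]] := ihQ _ sAP.
exists (es ++ fs); split=> [e|x Ax].
  by rewrite mem_cat => /orP[/hes|/hfs[]].
have [y [Ay Py sy]] := hx x Ax; have [z [[Az Pz] Qz sz]] := hy y (conj Ay Py).
exists z; split=> //; rewrite -(subrK y x) -addrA.
apply: (subspaceD (span_subspace _)).
  by apply: span_mono sy => t; rewrite mem_cat => ->.
by apply: span_mono sz => t; rewrite mem_cat => ->; rewrite orbT.
Qed.
End FiniteCodimension.

(** * Words in finitely many commuting nilpotent adjoint maps *)

Section Structure.
Variables (F : fieldType) (L : lieSuperalgType F).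
Hypothesis even_abel : forall x y : L, hom false x -> hom false y -> sbracket x y = 0.
Hypothesis adnil : forall x : L, hom false x -> ad_nilpotent x.
Implicit Types (d : seq L -> F) (m : seq L) (x y z a b v : L) (l : L -> F).

Let even_comm := even_comm even_abel.

Section Monomials.
Variable (I : finType) (aa : I -> L).
Hypothesis aa_even : forall i, hom false (aa i).

Definition dsc (c : seq I) x := foldr (fun i => sbracket (aa i)) x c.

Lemma dsc_cat c c' x : dsc (c ++ c') x = dsc c (dsc c' x).
Proof. exact: foldr_cat. Qed.

Lemma dsc_linear c (k : F) x y : dsc c (k *: x + y) = k *: dsc c x + dsc c y.
Proof. by elim: c => //= i c ->; rewrite sbracketPr. Qed.

Lemma dsc0 c : dsc c 0 = 0.
Proof. by elim: c => //= i c ->; rewrite sb0r. Qed.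

Lemma dsc_even c a x : hom false a -> sbracket a (dsc c x) = dsc c (sbracket a x).
Proof. by move=> ha; elim: c => //= i c ih; rewrite even_comm // ih. Qed.

Lemma dsc_perm c c' x : perm_eq c c' -> dsc c x = dsc c' x.
Proof.
have dC s t y : dsc s (dsc t y) = dsc t (dsc s y).
  by elim: s => //= i s ->; rewrite dsc_even.
elim: c c' => [|i c ih] c'; first by rewrite perm_sym => /perm_nilP->.
move=> p; have ic' : i \in c' by rewrite -(perm_mem p) mem_head.
case/splitPr: c' / ic' p => s t p; rewrite dsc_cat /=.
rewrite -dsc_even // -dsc_cat; congr sbracket; apply: ih.
by rewrite -(perm_cons i) (permPl p) -cat1s perm_catCA.
Qed.

(** In a long word some letter [i] occurs at least [n i] times; the maps commute, so these
    occurrences can be collected. *)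
Lemma dsc_nilpotent : exists M, forall c x, (M <= size c)%N -> dsc c x = 0.
Proof.
have [n hn] := choice (fun i => adnil (aa_even i)).
exists (\sum_i n i).+1 => c x hc.
have [i hi] : exists i, (n i <= count_mem i c)%N.
  apply: contrapT => hno; move: hc; rewrite leqNgt ltnS => /negP; apply.
  rewrite -(sum1_size c) (partition_big id xpredT) //=.
  apply: leq_sum => i _; rewrite sum1_count leqNgt; apply/negP => hi; apply: hno.
  by exists i; exact: ltnW.
have p : perm_eq c (nseq (count_mem i c) i ++ filter (predC (pred1 i)) c).
  rewrite -(perm_filterC (pred1 i) c) perm_sym perm_cat2r.
  suff -> : filter (pred1 i) c = nseq (count_mem i c) i by [].
  by rewrite -size_filter; apply/all_pred1P/filter_all.
rewrite (dsc_perm _ p) dsc_cat -(subnKC hi) nseqD dsc_cat.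
have e k y : dsc (nseq k i) y = iter k (ad (aa i)) y by elim: k => //= k ->.
by rewrite e hn.
Qed.

Variable fe : seq L.

Definition mspan := span (fun y => exists c e, e \in fe /\ y = dsc c e).

Lemma mspan_subspace : subspace mspan. Proof. exact: span_subspace. Qed.

Lemma mspan_dsc c x : mspan x -> mspan (dsc c x).
Proof.
elim=> [|k {}x y [c' [e [he ->]]] _ ih]; first by rewrite dsc0; exact: span0.
rewrite dsc_linear; apply: spanP => //; exists (c ++ c'), e; split=> //.
by rewrite dsc_cat.
Qed.

Lemma mspan_finite : exists es : seq L, forall x, mspan x -> span (fun z => z \in es) x.
Proof.
have [M hM] := dsc_nilpotent.
exists (flatten [seq [seq dsc c e | c <- words I k, e <- fe] | k <- iota 0 M]).
apply: span_sub => x [c [e [he ->]]].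
have [hc|hc] := leqP M (size c); first by rewrite hM //; exact: span0.
apply/span_id/flattenP; exists [seq dsc c e | c <- words I (size c), e <- fe].
  by apply/mapP; exists (size c); rewrite ?mem_iota.
by apply/allpairsP; exists (c, e); split; rewrite ?mem_words.
Qed.

(* Operators in the augmentation ideal of the commutative algebra generated by the [ad (aa i)]. *)
Inductive nop : (L -> L) -> Prop :=
| nop0 : nop (fun=> 0)
| nopS c (k : F) N of c != [::] & nop N : nop (fun x => k *: dsc c x + N x).

Lemma nop_add N N' : nop N -> nop N' -> nop (fun x => N x + N' x).
Proof.
move=> hN hN'; elim: hN => [|c k {}N hc _ ih].
  by rewrite (_ : (fun x => _) = N') //; apply/funext => x; rewrite add0r.
rewrite (_ : (fun x => _) = fun x => k *: dsc c x + (N x + N' x)); first exact: nopS.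
by apply/funext => x; rewrite addrA.
Qed.

Lemma nop_scale k N : nop N -> nop (fun x => k *: N x).
Proof.
elim=> [|c k' {}N hc _ ih].
  by rewrite (_ : (fun x => _) = fun=> 0); [exact: nop0 | apply/funext => x; rewrite scaler0].
rewrite (_ : (fun x => _) = fun x => (k * k') *: dsc c x + k *: N x); first exact: nopS.
by apply/funext => x; rewrite scalerDr scalerA.
Qed.
(** A geometric series: modulo [mspan] one may replace [x] by - k^-1 N x as often as desired, each
    time lengthening the words applied to [x], until they vanish by [dsc_nilpotent]. *)
Lemma nop_inverse k N x : k != 0 -> nop N -> mspan (k *: x + N x) -> mspan x.
Proof.
move=> k0 hN hx.
have [M hM] := dsc_nilpotent.
pose tail r y := span (fun z => exists c, (r <= size c)%N /\ z = dsc c x) y.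
have sub r : subspace (fun y => exists e t, [/\ mspan e, tail r t & y = e + t]).
  split=> [|c _ _ [e [t [he ht ->]]] [e' [t' [he' ht' ->]]]].
    by exists 0, 0; split; [exact: span0 | exact: span0 | rewrite addr0].
  exists (c *: e + e'), (c *: t + t'); split.
  - by apply: (span_subspace _).2.
  - by apply: (span_subspace _).2.
  - by rewrite scalerDr addrACA.
have h r : exists e t, [/\ mspan e, tail r t & x = e + t].
  elim: r => [|r [e [t [he ht ->]]]].
    exists 0, x; split; [exact: span0 | | by rewrite add0r].
    by apply: span_id; exists [::].
  suff [e' [t' [he' ht' ->]]] : exists e' t', [/\ mspan e', tail r.+1 t' & t = e' + t'].
    by exists (e + e'), t'; split=> //; [exact: (subspaceD (span_subspace _)) | rewrite addrA].
  move: t ht; apply: span_min; first exact: sub.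
  move=> _ [c [hc ->]].
  exists (k^-1 *: dsc c (k *: x + N x)), (- k^-1 *: dsc c (N x)); split.
  - by apply: (subspaceZ _ (span_subspace _)); exact: mspan_dsc.
  - apply: (subspaceZ _ (span_subspace _)); elim: hN {hx} => [|c' k' N' hc' _ ih].
      by rewrite dsc0; exact: span0.
    rewrite dsc_linear -dsc_cat; apply: spanP => //; exists (c ++ c'); split=> //.
    by rewrite size_cat -addn1 leq_add // lt0n size_eq0.
  - by rewrite dsc_linear scalerDr scalerA mulVf // scale1r scaleNr addrK.
have [e [t [he ht ->]]] := h M.
suff -> : t = 0 by rewrite addr0.
move: t ht; apply: span_min => [|_ [c [hc ->]]]; last exact: hM.
by split=> // c y z -> ->; rewrite scaler0 addr0.
Qed.
End Monomials.
End Structure.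

(** * Evaluation of words on wedge products *)

Section WedgeEvaluation.
Variables (F : fieldType) (L : lieSuperalgType F).
Hypothesis even_abel : forall x y : L, hom false x -> hom false y -> sbracket x y = 0.
Hypothesis adnil : forall x : L, hom false x -> ad_nilpotent x.
Implicit Types (d : seq L -> F) (m : seq L) (x y z a b v : L) (l : L -> F).

Local Notation form := (seq L -> F).
Local Notation zform := (fun _ : seq L => 0 : F).

Definition scf (c : F) d : form := fcomb c d zform.

Lemma alternating_scf c d : alternating d -> alternating (scf c d).
Proof. by move=> hd; apply: alternating_comb => //; exact: alternating0. Qed.

Section Letters.
Variable I : finType.

Definition yact (vv aa : I -> L) d i : form := lieD (aa i) (con (vv i) d).

Lemma yact_comb vv aa c d d' i : yact vv aa (fcomb c d d') i =
  fcomb c (yact vv aa d i) (yact vv aa d' i).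
Proof. by rewrite /yact -lieD_comb. Qed.

Lemma yact_zero vv aa i : yact vv aa zform i = zform.
Proof. exact: lieD0. Qed.

Lemma yact_alternating vv aa d i : alternating d -> alternating (yact vv aa d i).
Proof. by move=> hd; apply/alternating_lieD/alternating_con. Qed.

Lemma yacts_alternating vv aa d w : alternating d -> alternating (foldl (yact vv aa) d w).
Proof. by elim: w d => //= i w ih d hd; apply/ih/yact_alternating. Qed.

Lemma yacts_eq vv aa vv' aa' d (w : seq I) : {in w, vv =1 vv'} -> {in w, aa =1 aa'} ->
  foldl (yact vv aa) d w = foldl (yact vv' aa') d w.
Proof.
elim: w d => //= i w ih d hv ha; rewrite /yact hv ?ha ?mem_head //.
by apply: ih => j jw; [apply: hv | apply: ha]; rewrite inE jw orbT.
Qed.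

Variables (vv aa : I -> L) (vk : L).
Hypothesis aa_even : forall i, hom false (aa i).

Let fe := vk :: [seq vv i | i <- enum I].
Let ya := yact vv aa.

Definition killed l := lin l /\ forall c e, e \in fe -> l (dsc aa c e) = 0.

Lemma killed_vv l c i : killed l -> l (dsc aa c (vv i)) = 0.
Proof. by case=> _; apply; rewrite inE map_f ?orbT // mem_enum. Qed.

Lemma killed_vk l c : killed l -> l (dsc aa c vk) = 0.
Proof. by case=> _; apply; rewrite mem_head. Qed.

Lemma dsc_rcons l c j :
  (fun x => l (dsc aa (rcons c j) x)) = (fun x => l (dsc aa c (sbracket (aa j) x))).
Proof. by apply/funext => x; rewrite -cats1 dsc_cat. Qed.

Lemma dsc_rcons_even l c j a : hom false a ->
  (fun x => l (dsc aa (rcons c j) (sbracket a x))) =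
  (fun x => l (dsc aa c (sbracket a (sbracket (aa j) x)))).
Proof. by move=> ha; apply/funext => x; rewrite -cats1 dsc_cat /= (even_comm even_abel). Qed.

Lemma lieD_con_wedge a x l th : l x = 0 -> lieD a (con x (wedge l th)) =
  fcomb 1 (wedge (fun y => l (sbracket a y)) (scf (-1) (con x th)))
    (wedge l (scf (-1) (lieD a (con x th)))).
Proof.
move=> lx; rewrite con_wedge lx !lieD_comb lieD0 lieD_wedge /scf !wedge_comb !wedge0.
by apply/funext => m; rewrite /fcomb; ring.
Qed.

Lemma wedge_pair l th x y : wedge l th [:: x; y] = l x * th [:: y] - l y * th [:: x].
Proof. by rewrite /= /con; ring. Qed.

(* Error terms in the action of a word on [wedge l d]: the functional [l] only enters through the
   functionals [l (dsc aa c _)], with nonempty [c] if [ne] holds. *)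
Inductive fam (ne : bool) : ((L -> F) -> form) -> Prop :=
| fam0 : fam ne (fun _ => zform)
| famS c th Th of ne ==> (c != [::]) & alternating th & fam ne Th :
    fam ne (fun l => fcomb 1 (wedge (fun x => l (dsc aa c x)) th) (Th l)).

Lemma fam_step ne Th j : fam ne Th ->
  exists Th', fam ne Th' /\ forall l, killed l -> ya (Th l) j = Th' l.
Proof.
elim=> [|c th {}Th hc hth _ [Th' [fT eT]]].
  by exists (fun _ => zform); split; [exact: fam0 | move=> l _; exact: yact_zero].
exists (fun l => fcomb 1 (wedge (fun x => l (dsc aa (rcons c j) x)) (scf (-1) (con (vv j) th)))
  (fcomb 1 (wedge (fun x => l (dsc aa c x)) (scf (-1) (lieD (aa j) (con (vv j) th)))) (Th' l))).
split=> [|l kl].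
  have ath := alternating_con (vv j) hth.
  apply: famS; [by rewrite -size_eq0 size_rcons implybT | exact: alternating_scf |].
  by apply: famS => //; apply/alternating_scf/alternating_lieD.
rewrite {1}/ya yact_comb -/ya eT // /ya /yact lieD_con_wedge ?killed_vv // dsc_rcons.
by apply/funext => m; rewrite /fcomb; ring.
Qed.

(** Contraction of [l] with [vv i] gives 0 by [killed], and contraction past [l] gives a sign. By
    the Leibniz rule the Lie derivative falls either on the form, which is the main term, or on [l],
    which gives the terms of [Th]. *)
Lemma fam_main d w : alternating d -> exists Th, fam true Th /\ forall l, killed l ->
  foldl ya (wedge l d) w = fcomb ((-1) ^+ size w) (wedge l (foldl ya d w)) (Th l).
Proof.
move=> hd; elim/last_ind: w => [|w j [Th [/fam_step fT eT]]].
  exists (fun _ => zform); split=> [|l _]; first exact: fam0.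
  by apply/funext => m; rewrite /fcomb /= expr0 mul1r addr0.
have [Th' [fT' eT']] := fT j; pose d' := foldl ya d w.
exists (fun l => fcomb 1 (wedge (fun x => l (dsc aa [:: j] x))
  (scf ((-1) ^+ (size w).+1) (con (vv j) d'))) (Th' l)).
have hd' : alternating (con (vv j) d') by apply/alternating_con/yacts_alternating.
split=> [|l kl]; first by apply: famS => //; exact: alternating_scf.
rewrite !foldl_rcons eT // size_rcons [LHS]yact_comb -/ya eT' // /ya /yact -/ya.
have lv : l (vv j) = 0 := killed_vv [::] j kl.
rewrite [X in fcomb _ X _]lieD_con_wedge // -/d' /scf !wedge_comb !wedge0 -/ya.
apply/funext => m; rewrite /fcomb /ya /yact /= exprS; ring.
Qed.

Lemma fam_eval Th : fam true Th -> exists N, nop aa N /\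
  forall l x, killed l -> Th l [:: vk; x] = l (N x).
Proof.
elim=> [|c th {}Th hc hth _ [N [hN eN]]].
  by exists (fun=> 0); split=> [|l x [ll _]]; [exact: nop0 | rewrite lin0].
exists (fun x => (- th [:: vk]) *: dsc aa c x + N x); split; first exact: nopS.
move=> l x kl; have [ll _] := kl.
by rewrite /fcomb wedge_pair (eN l) // killed_vk // ll; ring.
Qed.

(* The same after one letter has been replaced by [vk] and the varying element [a]. *)
Inductive fam2 : ((L -> F) -> L -> form) -> Prop :=
| fam20 : fam2 (fun _ _ => zform)
| fam2a c th Th of alternating th & fam2 Th : fam2 (fun l a =>
    fcomb 1 (wedge (fun x => l (dsc aa c (sbracket a x))) th) (Th l a))
| fam2b c (th : L -> form) Th of (forall a, alternating (th a)) &
    (forall k a b, th (k *: a + b) = fcomb k (th a) (th b)) & fam2 Th : fam2 (fun l a =>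
    fcomb 1 (wedge (fun x => l (dsc aa c x)) (th a)) (Th l a))
| fam2c c e th Th of alternating th & fam2 Th : fam2 (fun l a =>
    fcomb (l (dsc aa c (sbracket a e))) th (Th l a)).

Lemma fam2_step Th j : fam2 Th -> exists Th', fam2 Th' /\
  forall l a, killed l -> hom false a -> ya (Th l a) j = Th' l a.
Proof.
elim=> [|c th {}Th hth _ [Th' [fT eT]]|c th {}Th hth lth _ [Th' [fT eT]]|c e th {}Th hth _ [Th' [fT eT]]].
- by exists (fun _ _ => zform); split; [exact: fam20 | move=> l a _ _; exact: yact_zero].
- exists (fun l a => fcomb (l (dsc aa c (sbracket a (vv j)))) (lieD (aa j) th)
    (fcomb 1 (wedge (fun x => l (dsc aa (rcons c j) (sbracket a x))) (scf (-1) (con (vv j) th)))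
    (fcomb 1 (wedge (fun x => l (dsc aa c (sbracket a x)))
      (scf (-1) (lieD (aa j) (con (vv j) th)))) (Th' l a)))).
  split=> [|l a kl ha].
    have ath := alternating_con (vv j) hth.
    apply: fam2c; first exact: alternating_lieD.
    apply: fam2a; first exact: alternating_scf.
    by apply: fam2a => //; apply/alternating_scf/alternating_lieD.
  rewrite {1}/ya yact_comb -/ya eT // /ya /yact con_wedge !lieD_comb lieD0 lieD_wedge dsc_rcons_even //.
  by rewrite /scf !wedge_comb !wedge0; apply/funext => m; rewrite /fcomb; ring.
- exists (fun l a => fcomb 1 (wedge (fun x => l (dsc aa (rcons c j) x)) (scf (-1) (con (vv j) (th a))))
    (fcomb 1 (wedge (fun x => l (dsc aa c x)) (scf (-1) (lieD (aa j) (con (vv j) (th a))))) (Th' l a))).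
  split=> [|l a kl ha].
    have ath a := alternating_con (vv j) (hth a).
    have lth' k a b : con (vv j) (th (k *: a + b)) = fcomb k (con (vv j) (th a)) (con (vv j) (th b)).
      by rewrite lth.
    apply: fam2b => [a|k a b|]; first exact: alternating_scf.
      by rewrite lth'; apply/funext => m; rewrite /scf /fcomb; ring.
    apply: fam2b => [a|k a b|//]; first by apply/alternating_scf/alternating_lieD.
    by rewrite lth' lieD_comb; apply/funext => m; rewrite /scf /fcomb; ring.
  rewrite {1}/ya yact_comb -/ya eT // /ya /yact lieD_con_wedge ?killed_vv // dsc_rcons.
  by apply/funext => m; rewrite /fcomb; ring.
- exists (fun l a => fcomb (l (dsc aa c (sbracket a e))) (ya th j) (Th' l a)); split.
    by apply: fam2c => //; exact: yact_alternating.
  by move=> l a kl ha; rewrite /ya yact_comb -/ya eT.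
Qed.

Lemma fam2_of_fam ne Th : fam ne Th -> exists Th2, fam2 Th2 /\
  forall l a, killed l -> hom false a -> lieD a (con vk (Th l)) = Th2 l a.
Proof.
elim=> [|c th {}Th hc hth _ [Th' [fT eT]]].
  by exists (fun _ _ => zform); split; [exact: fam20 | move=> l a _ _; exact: lieD0].
exists (fun l a => fcomb 1 (wedge (fun x => l (dsc aa c (sbracket a x))) (scf (-1) (con vk th)))
  (fcomb 1 (wedge (fun x => l (dsc aa c x)) (scf (-1) (lieD a (con vk th)))) (Th' l a))).
split=> [|l a kl ha].
  have ath := alternating_con vk hth.
  apply: fam2a; first exact: alternating_scf.
  apply: fam2b => [a|k a b|//]; first by apply/alternating_scf/alternating_lieD.
  by rewrite lieD_linear //; apply/funext => m; rewrite /scf /fcomb; ring.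
have -> : con vk (fcomb 1 (wedge (fun x => l (dsc aa c x)) th) (Th l)) =
  fcomb 1 (con vk (wedge (fun x => l (dsc aa c x)) th)) (con vk (Th l)) by [].
rewrite lieD_comb eT // lieD_con_wedge ?killed_vk //.
by apply/funext => m; rewrite /fcomb; ring.
Qed.

Lemma fam2_word d w1 w2 : alternating d -> exists Th, fam2 Th /\
  forall l a, killed l -> hom false a ->
    foldl ya (lieD a (con vk (foldl ya (wedge l d) w1))) w2 = Th l a.
Proof.
move=> hd.
have [Th1 [fT1 eT1]] : exists Th, fam false Th /\
    forall l, killed l -> foldl ya (wedge l d) w1 = Th l.
  elim/last_ind: w1 => [|w j [Th [/fam_step fT eT]]].
    exists (fun l => fcomb 1 (wedge (fun x => l (dsc aa [::] x)) d) zform); split.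
      by apply: famS => //; exact: fam0.
    by move=> l _; apply/funext => m; rewrite /fcomb /=; ring.
  have [Th' [fT' eT']] := fT j; exists Th'; split=> // l kl.
  by rewrite foldl_rcons eT // eT'.
have [Th2 [fT2 eT2]] := fam2_of_fam fT1.
elim/last_ind: w2 => [|w j [Th [/fam2_step fT eT]]].
  by exists Th2; split=> // l a kl ha; rewrite /= eT1 // eT2.
have [Th' [fT' eT']] := fT j; exists Th'; split=> // l a kl ha.
by rewrite foldl_rcons eT // eT'.
Qed.

(* Up to finite codimension, [E l a v] is [l] of a nilpotent operator applied to [sbracket a v]; such
   terms cannot cancel a nonzero multiple of [l (sbracket a v)]. *)
Definition negl (E : (L -> F) -> L -> L -> F) := exists P Q N,
  [/\ fincodim P, fincodim Q, nop aa N &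
  forall l a v, killed l -> hom false a -> P a -> hom true v -> Q v ->
    E l a v = l (N (sbracket a v))].

Lemma negl0 : negl (fun _ _ _ => 0).
Proof.
exists (fun=> True), (fun=> True), (fun=> 0); split; try exact: fincodimT; first exact: nop0.
by move=> l a v [ll _] _ _ _ _; rewrite lin0.
Qed.

Lemma negl_comb k E E' : negl E -> negl E' -> negl (fun l a v => k * E l a v + E' l a v).
Proof.
move=> [P [Q [N [hP hQ hN e]]]] [P' [Q' [N' [hP' hQ' hN' e']]]].
exists (fun x => P x /\ P' x), (fun x => Q x /\ Q' x), (fun x => k *: N x + N' x).
split; try exact: fincodimI; first exact: nop_add (nop_scale k hN) hN'.
move=> l a v kl ha [Pa Pa'] hv [Qv Qv'].
by rewrite e // e' //; have [ll _] := kl; rewrite ll.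
Qed.

Lemma negl_sum (J : eqType) (s : seq J) (E : J -> (L -> F) -> L -> L -> F) :
  (forall j, j \in s -> negl (E j)) -> negl (fun l a v => \sum_(j <- s) E j l a v).
Proof.
elim: s => [|j s ih] hE.
  rewrite (_ : (fun _ => _) = fun _ _ _ => 0); first exact: negl0.
  by apply/funext => l; apply/funext => a; apply/funext => v; rewrite big_nil.
rewrite (_ : (fun _ => _) = fun l a v => 1 * E j l a v + \sum_(j <- s) E j l a v).
  apply: negl_comb; first by apply: hE; rewrite mem_head.
  by apply: ih => i si; apply: hE; rewrite inE si orbT.
by apply/funext => l; apply/funext => a; apply/funext => v; rewrite big_cons mul1r.
Qed.

(** In every term either a functional of [a] alone or of [v] alone occurs as a factor, and its
    vanishing is a condition put into [P] or [Q]; or [l] is killed; or [l] is applied to a word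
    ending in [i] acting on [a,v], which goes into [N]. *)
Lemma fam2_negl Th i : fam2 Th -> negl (fun l a v => Th l a [:: vv i; sbracket (aa i) v]).
Proof.
elim=> [|c th {}Th [ml alt] _ [P [Q [N [hP hQ hN e]]]]
  |c th {}Th hth lth _ [P [Q [N [hP hQ hN e]]]]|c x th {}Th [ml alt] _ [P [Q [N [hP hQ hN e]]]]].
- exact: negl0.
- exists P, (fun v => th [:: sbracket (aa i) v] = 0 /\ Q v),
    (fun x => (- th [:: vv i]) *: dsc aa (rcons c i) x + N x); split=> //.
  + apply: fincodimI => //; apply: fincodimK => k x y.
    by rewrite sbracketPr (ml [::]).
  + by apply: nopS => //; rewrite -size_eq0 size_rcons.
  move=> l a v kl ha Pa hv [Qv Qv']; have [ll _] := kl.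
  rewrite /fcomb wedge_pair Qv mulr0 sub0r e // ll -cats1 dsc_cat /=.
  by rewrite (even_comm even_abel v ha (aa_even i)); ring.
- exists (fun a => th a [:: vv i] = 0 /\ P a), Q, N; split=> //.
    by apply: fincodimI => //; apply: fincodimK => k x y; rewrite lth.
  move=> l a v kl ha [Pa Pa'] hv Qv; rewrite /fcomb wedge_pair Pa killed_vv // e //; ring.
- exists P, (fun v => th [:: vv i; sbracket (aa i) v] = 0 /\ Q v), N; split=> //.
    apply: fincodimI => //; apply: fincodimK => k y z.
    by rewrite sbracketPr (ml [:: vv i]).
  move=> l a v kl ha Pa hv [Qv Qv']; rewrite /fcomb Qv e //; ring.
Qed.

(** For a and v in the finite-codimensional sets every killed [l] vanishes on (N - kappa) [a,v], so
    this vector lies in [mspan] by separation, and then so does [a,v] by [nop_inverse]. The space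
    [mspan] is finite-dimensional. *)
Lemma negl_span (kappa : F) : kappa != 0 -> negl (fun l a v => kappa * l (sbracket a v)) ->
  exists P Q (es : seq L), [/\ fincodim P, fincodim Q &
    forall a v, hom false a -> P a -> hom true v -> Q v -> span (fun z => z \in es) (sbracket a v)].
Proof.
move=> k0 [P [Q [N [hP hQ hN e]]]].
have [es hes] := mspan_finite even_abel adnil aa_even fe.
exists P, Q, es; split=> // a v ha Pa hv Qv; apply: hes.
apply: (@nop_inverse _ _ even_abel adnil _ aa aa_even fe (- kappa) N) => //.
  by rewrite oppr_eq0.
apply: contrapT => nx.
have [l [ll lE lx]] := separation (@mspan_subspace _ _ _ aa fe) nx.
have kl : killed l by split=> // c z hz; apply: lE; apply: span_id; exists c, z.
have /eqP := lx; rewrite ll -(e l a v) //.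
by rewrite mulNr addNr eq_sym oner_eq0.
Qed.
End Letters.
End WedgeEvaluation.

(** * Polynomial identities and the action of the even part *)

Section SmallAction.
Variables (F : fieldType) (L : lieSuperalgType F).
Hypothesis even_abel : forall x y : L, hom false x -> hom false y -> sbracket x y = 0.
Hypothesis odd_abel : forall x y : L, hom true x -> hom true y -> sbracket x y = 0.
Hypothesis adnil : forall x : L, hom false x -> ad_nilpotent x.
Implicit Types (d : seq L -> F) (m : seq L) (x y z a b v : L) (l : L -> F).

Definition small_action := exists (P Q : L -> Prop) (es : seq L), [/\ fincodim P, fincodim Q &
    forall a v, hom false a -> P a -> hom true v -> Q v -> span (fun z => z \in es) (sbracket a v)].

Section Letters.
Variable I : finType.

Lemma yact_pair (vv aa : I -> L) d i v :
  yact vv aa d i [:: v] = d [:: vv i; sbracket (aa i) v].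
Proof. by rewrite /yact /= addr0. Qed.

Lemma negl_ext (aa : I -> L) vv vk E E' :
  (forall l a v, killed vv aa vk l -> hom false a -> hom true v -> E l a v = E' l a v) ->
  negl vv aa vk E -> negl vv aa vk E'.
Proof.
move=> h [P [Q [N [hP hQ hN e]]]]; exists P, Q, N; split=> // l a v kl ha Pa hv Qv.
by rewrite -h // e.
Qed.

Lemma negl_scale (aa : I -> L) vv vk k E : negl vv aa vk E ->
  negl vv aa vk (fun l a v => k * E l a v).
Proof.
move=> h; apply: negl_ext (negl_comb k h (negl0 _ _ _)) => l a v _ _ _.
by rewrite addr0.
Qed.

Definition word_vanish (S : seq I) (alpha : seq I -> F) :=
  forall d (vv aa : I -> L) v, alternating d -> (forall i, hom true (vv i)) ->
    (forall i, hom false (aa i)) -> hom true v ->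
    \sum_(w <- permutations S) alpha w * foldl (yact vv aa) d w [:: v] = 0.

(** The vanishing sum is evaluated with [d] replaced by l wedge d and with the letter [k] given the
    odd part [vk] and a varying even part a. Words ending in [k] contribute - (-1)^n g l([a,v]) up
    to the errors of [fam_main], and the other words only errors of type [fam2]. [X] is a summand
    with the main term cancelled, so (-1)^n g l([a,v]) is negligible and [negl_span] applies. *)
Lemma small_action_step (S : seq I) k alpha d (vv aa : I -> L) vk :
  uniq S -> k \in S -> alternating d -> (forall i, hom true (vv i)) ->
  (forall i, hom false (aa i)) -> hom true vk ->
  \sum_(w <- permutations (rem k S)) alpha (rcons w k) * foldl (yact vv aa) d w [:: vk] != 0 ->
  word_vanish S alpha -> small_action.
Proof.
move=> uS kS hd hvv haa hvk g0 hS; set g := \sum_(_ <- _) _ in g0.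
pose n := size (rem k S).
pose vv2 i := if i == k then vk else vv i; pose aa2 a i := if i == k then a else aa i.
pose X j w l a v := alpha (rcons w j) *
  (foldl (yact vv2 (aa2 a)) (wedge l d) w [:: vv2 j; sbracket (aa2 a j) v] +
   (if j == k then (-1) ^+ n * foldl (yact vv aa) d w [:: vk] * l (sbracket a v) else 0)).
apply: (negl_span even_abel adnil haa (vv := vv) (vk := vk) (kappa := (-1) ^+ n * g)).
  by rewrite mulf_neq0 // signr_eq0.
have nX : negl vv aa vk
    (fun l a v => \sum_(j <- S) \sum_(w <- permutations (rem j S)) X j w l a v).
  apply: negl_sum => j jS; apply: negl_sum => w; rewrite mem_permutations => pw.
  apply: negl_scale.
  have [ejk|jk] := eqVneq j k.
    have kw : forall i, i \in w -> (i == k) = false.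
      move=> i; rewrite (perm_mem pw) ejk mem_rem_uniq // inE => /andP[ik _].
      exact: negPf.
    have [Th [fT eT]] := fam_main vv aa vk w hd.
    have [N [hN eN]] := fam_eval vv vk fT.
    exists (fun=> True), (fun=> True), N; split; try exact: fincodimT; first exact: hN.
    move=> l a v kl ha _ hv _; rewrite ejk /vv2 /aa2 eqxx -(eN l) //.
    rewrite -(@yacts_eq _ _ _ vv aa); [|by move=> i /kw ->..].
    rewrite eT // /fcomb wedge_pair (killed_vk [::] kl) (perm_size pw) ejk -/n; ring.
  rewrite {2}/vv2 (negPf jk).
  have kw : k \in w by rewrite (perm_mem pw) mem_rem_uniq // inE eq_sym jk.
  have uw : uniq w by rewrite (perm_uniq pw) rem_uniq.
  case/splitPr: w / kw uw {pw} => w1 w2; rewrite cat_uniq /= negb_or.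
  move=> /and3P[_ /andP[k1 _] /andP[k2 _]].
  have [Th [fT eT]] := fam2_word even_abel vv vk haa w1 w2 hd.
  apply: negl_ext (fam2_negl even_abel vv vk haa j fT) => l a v kl ha hv.
  have kw (w : seq I) i : k \notin w -> i \in w -> (i == k) = false.
    by move=> kw iw; apply: contraNF kw => /eqP <-.
  rewrite -eT // addr0 foldl_cat /= /aa2 (negPf jk) -(@yacts_eq _ _ _ vv aa _ _ _ w1).
  - rewrite -(@yacts_eq _ _ _ vv aa _ _ _ w2).
    + by rewrite {4}/yact /vv2 eqxx.
    + by move=> i /(kw _ _ k2); rewrite /vv2 => ->.
    + by move=> i /(kw _ _ k2) ->.
  - by move=> i /(kw _ _ k1); rewrite /vv2 => ->.
  - by move=> i /(kw _ _ k1) ->.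
apply: negl_ext nX => l a v [ll lf] ha hv.
have hw := alternating_wedge ll hd.
have S0 : S != [::] by case: (S) kS.
have := hS (wedge l d) vv2 (aa2 a) v hw; rewrite big_permutations // => e0.
transitivity (\sum_(j <- S) \sum_(w <- permutations (rem j S))
   (alpha (rcons w j) * foldl (yact vv2 (aa2 a)) (wedge l d) (rcons w j) [:: v] +
    if j == k then
      alpha (rcons w j) * ((-1) ^+ n * foldl (yact vv aa) d w [:: vk] * l (sbracket a v))
    else 0)).
  rewrite /=; apply: eq_bigr => j _; apply: eq_bigr => w _; rewrite /X mulrDr foldl_rcons yact_pair.
  by case: ifP => _; rewrite ?mulr0.
under eq_bigr => j _ do rewrite big_split /=.
rewrite big_split /= e0 ?add0r; first last.
- by [].
- by move=> i; rewrite /aa2; case: ifP.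
- by move=> i; rewrite /vv2; case: ifP.
rewrite (bigD1_seq k) //= eqxx [X in _ + X]big1 ?addr0.
  rewrite /g mulr_sumr mulr_suml; apply: eq_bigr => w _; ring.
by move=> j /negPf jk; rewrite big1 // => w _; rewrite jk.
Qed.

Lemma small_action0 : (forall v, hom true v -> v = 0) -> small_action.
Proof.
move=> h; exists (fun=> True), (fun=> True), [::]; split; try exact: fincodimT.
by move=> a v ha _ /h -> _; rewrite sb0r; exact: span0.
Qed.

(** Let [k] be the last letter of a word with nonzero coefficient. Either the shorter sum over words
    preceding [k] also vanishes identically, and induction applies, or some evaluation of it is
    nonzero and [small_action_step] does. With no letter left, the sum says that every functional
    vanishes on L_1. *)
Lemma small_action_of_words (S : seq I) alpha : uniq S -> (exists2 w, perm_eq w S & alpha w != 0) ->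
  word_vanish S alpha -> small_action.
Proof.
move: {2}(size S) (erefl (size S)) => n; elim: n S alpha => [|n ih] S alpha sS uS [w pw aw] hS.
  move/eqP/nilP: sS pw hS => -> /perm_nilP ew hS; rewrite ew in aw.
  apply: small_action0 => v hv; apply: separation0 => l ll.
  pose d0 m : F := if m is [::] then 1 else 0.
  have hd0 : alternating d0.
    by split=> [[|y u] c x z m|[|z u] x y m] /=; rewrite ?mulr0 ?addr0 ?oppr0.
  have := hS (wedge l d0) (fun=> 0) (fun=> 0) v (alternating_wedge ll hd0).
  rewrite big_seq1 /= mulr1 subr0 => e; apply/eqP.
  have : alpha [::] * l v = 0.
    by apply: e => // i; case: (hom_subspace (s := L) (true)); case: (hom_subspace (s := L) (false)).
  by move/eqP; rewrite mulf_eq0 (negPf aw).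
case/lastP: w pw aw => [|w k] pw aw; first by move: (perm_size pw); rewrite sS.
have kS : k \in S by rewrite -(perm_mem pw) mem_rcons mem_head.
have [hall|/existsNP[d /existsNP[vv /existsNP[aa /existsNP[v hno]]]]] :=
    pselect (word_vanish (rem k S) (fun w => alpha (rcons w k))).
  apply: ih hall; first by rewrite size_rem // sS.
    exact: rem_uniq.
  exists w => //; rewrite -(perm_cons k) -perm_rcons (permPl pw); exact: perm_to_rem.
move/not_implyP: hno => [hd /not_implyP[hv /not_implyP[ha /not_implyP[hvk /eqP g0]]]].
exact: (small_action_step uS kS hd hv ha hvk g0 hS).
Qed.
End Letters.

Lemma PI_small_action (U : algType F) (iota : L -> U) :
  enveloping iota -> is_PI U -> small_action.
Proof.
move=> env /PI_multilinear[n [alpha [alpha0 hal]]].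
have [pr [prl pr_even pr_odd prid pr0]] := even_proj L.
case/lastP eS : (enum 'I_n) => [|w k].
  have := hal (fun=> 0); rewrite eS big_seq1 big_nil => /eqP.
  by rewrite scaler_eq0 oner_eq0 orbF -eS (negPf alpha0).
have uS : uniq (rcons w k) by rewrite -eS enum_uniq.
have kS : k \in rcons w k by rewrite mem_rcons mem_head.
have pw : perm_eq w (rem k (rcons w k)).
  by rewrite -(perm_cons k) -perm_rcons; exact: perm_to_rem.
apply: (@small_action_of_words _ (rem k (rcons w k)) (fun w => alpha (rcons w k))).
- exact: rem_uniq.
- by exists w; rewrite // -eS.
move=> d vv aa v hd hvv haa hv.
have [Phi [Pl hPhi]] := act_functional even_abel odd_abel prl prid pr0 env hd.
(* The variable [k] becomes a single odd element. A word not ending in [k] ends with a Lie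
   derivative, which is 0 at the empty word, so only the words ending in [k] survive. *)
pose u i := if i == k then [:: v] else [:: vv i; aa i].
have := congr1 Phi (hal (fun i => \prod_(x <- u i) iota x)).
rewrite (lin0 Pl) lin_sum // eS big_permutations //; last by case: (w).
have act_word s : (forall i, i \in s -> (i == k) = false) ->
    foldl (act pr) d (flatten [seq u i | i <- s]) = foldl (yact vv aa) d s.
  elim/last_ind: s => // s i ih hs; rewrite map_rcons -cats1 flatten_cat foldl_cat ih; last first.
    by move=> j js; apply: hs; rewrite mem_rcons inE js orbT.
  have hdi := yacts_alternating vv aa s hd.
  rewrite foldl_cat /= /u hs ?mem_rcons ?mem_head //= (act_odd pr0 hdi (hvv i)).
  by rewrite (act_even prid (alternating_con _ hdi) (haa i)) foldl_rcons.
have val s : Phi (alpha s *: \prod_(i <- s) \prod_(x <- u i) iota x) =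
    alpha s * foldl (act pr) d (flatten [seq u i | i <- s]) [::].
  by rewrite linZ // -hPhi big_flatten big_map.
have fl j s : flatten [seq u i | i <- rcons s j] = flatten [seq u i | i <- s] ++ u j.
  by rewrite map_rcons -cats1 flatten_cat /= cats0.
rewrite (bigD1_seq k) //= [X in _ + X]big1_seq ?addr0 => [|j /andP[jk _]].
  move=> e; apply: etrans e; rewrite big_seq [RHS]big_seq.
  apply: eq_bigr => s; rewrite mem_permutations => ps.
  rewrite val fl foldl_cat act_word; last first.
    by move=> i; rewrite (perm_mem ps) mem_rem_uniq // inE => /andP[/negPf->].
  rewrite /= /u eqxx /= act_odd //; exact: yacts_alternating.
apply: big1 => s _; rewrite val fl foldl_cat /= /u (negPf jk) /=.
by rewrite act_even ?mulr0 //; apply/act_alternating/acts_alternating.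
Qed.
End SmallAction.

(** * Nilpotency *)

Lemma span_nil (F : fieldType) (V : lmodType F) (x : V) :
  span (fun z => z \in [::]) x -> x = 0.
Proof. by elim. Qed.

Lemma span_replace (F : fieldType) (V : lmodType F) (x : V) (es : seq V) :
    x != 0 -> span (fun z => z \in es) x ->
  exists es', (size es' < size es)%N /\
    forall y, span (fun z => z \in es) y -> span (fun z => z \in x :: es') y.
Proof.
move=> x0; elim: es => [/span_nil x0'|e es ih /span_cons[c hc]].
  by rewrite x0' eqxx in x0.
have [c0|c0] := eqVneq c 0.
  move: hc; rewrite c0 scale0r subr0 => /ih[es' [les h]].
  exists (e :: es'); split=> // y; apply: span_sub => z; rewrite inE => /orP[/eqP->|zes].
    by apply: span_id; rewrite !inE eqxx orbT.
  have := h z (span_id zes); apply: span_mono => t; rewrite !inE => /orP[->//|->].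
  by rewrite !orbT.
exists es; split=> // y; apply: span_sub => z; rewrite inE => /orP[/eqP->|zes]; last first.
  by apply: span_id; rewrite inE zes orbT.
apply/span_cons; exists c^-1.
have -> : e - c^-1 *: x = (- c^-1) *: (x - c *: e).
  by rewrite scalerBr !scaleNr scalerA mulVf // scale1r opprK addrC.
exact/(subspaceZ _ (span_subspace _)).
Qed.

Section NilpotentAction.
Variables (F : fieldType) (L : lieSuperalgType F).
Hypothesis even_abel : forall x y : L, hom false x -> hom false y -> sbracket x y = 0.
Hypothesis odd_abel : forall x y : L, hom true x -> hom true y -> sbracket x y = 0.
Hypothesis adnil : forall x : L, hom false x -> ad_nilpotent x.
Implicit Types (x y z a b v : L) (s w : seq L).

Definition mact s x := foldr (fun a => sbracket a) x s.

Lemma mact_cat s t x : mact (s ++ t) x = mact s (mact t x).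
Proof. exact: foldr_cat. Qed.

Lemma mact0 s : mact s 0 = 0.
Proof. by elim: s => //= a s ->; rewrite sb0r. Qed.

Lemma mact_odd s v : (forall a, a \in s -> hom false a) -> hom true v -> hom true (mact s v).
Proof.
move=> hs hv; elim: s hs => //= a s ih hs.
apply: (hom_sbracket false true); first by apply: hs; rewrite mem_head.
by apply: ih => b bs; apply: hs; rewrite inE bs orbT.
Qed.

(** The rightmost operator [b] maps [X] to a stable subspace [Y]. If [Y] is all of [X], nilpotency
    of ad b gives X = 0; otherwise an element of [X] outside [Y] lets the exchange lemma span [Y] by
    fewer vectors, and the remaining operators act on [Y]. *)
Lemma mact_finite (A X : L -> Prop) (es : seq L) :
    (forall a, A a -> hom false a) -> subspace X ->
    (forall a x, A a -> X x -> X (sbracket a x)) ->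
    (forall x, X x -> span (fun z => z \in es) x) ->
  forall s x, (forall a, a \in s -> A a) -> (size es <= size s)%N -> X x -> mact s x = 0.
Proof.
move=> evA sX stX spX s; elim/last_ind: s X es sX stX spX => [|s b ih] X es sX stX spX x hs.
  by rewrite leqn0 => /nilP es0 /spX; rewrite es0 => /span_nil->; rewrite mact0.
rewrite size_rcons => les Xx; rewrite -cats1 mact_cat /=.
have Ab : A b by apply: hs; rewrite mem_rcons mem_head.
pose Y z := exists2 y, X y & z = sbracket b y.
have sY : subspace Y.
  split=> [|c _ _ [y Xy ->] [z Xz ->]].
    by exists 0; [case: sX | rewrite sb0r].
  by exists (c *: y + z); [apply: sX.2 | rewrite sbracketPr].
have YX z : Y z -> X z by move=> [y Xy ->]; apply: stX.
have stY a z : A a -> Y z -> Y (sbracket a z).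
  move=> Aa [y Xy ->]; exists (sbracket a y); first exact: stX.
  by rewrite (even_comm even_abel) //; apply: evA.
have Yx : Y (sbracket b x) by exists x.
have hs' a : a \in s -> A a by move=> ha; apply: hs; rewrite mem_rcons inE ha orbT.
have [XY|/existsNP[z /not_implyP[Xz nYz]]] := pselect (forall z, X z -> Y z).
  have [n hn] := adnil (evA _ Ab).
  have Xn z k : X z -> exists y, z = iter k (ad b) y.
    elim: k z => [|k ihk] z Xz; first by exists z.
    have [y /ihk[t ->] ->] := XY z Xz; by exists t.
  by have [y ->] := Xn _ n Xx; rewrite hn sb0r mact0.
have z0 : z != 0 by apply: contra_notN nYz => /eqP->; case: sY.
have [es' [les' hes']] := span_replace z0 (spX z Xz).
have [|t [tY lt ht]] := span_exchange (S := Y) (t0 := [:: z]) (es := es').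
  by move=> y /YX/spX/hes'.
apply: (ih Y t sY stY) => //; last first.
  by apply: leq_trans lt _; rewrite -ltnS (leq_trans les').
move=> y Yy; have /span_cons[c hc] := ht y Yy.
suff c0 : c = 0 by move: hc; rewrite c0 scale0r subr0.
apply: contrapT => /eqP c0; apply: nYz.
have Yc : Y (y - c *: z) by move: hc; apply: span_min.
have -> : z = c^-1 *: (y - (y - c *: z)) by rewrite subKr scalerA mulVf // scale1r.
by apply: subspaceZ => //; apply: subspaceB.
Qed.

Lemma ad_image (P Q : L -> Prop) (es fv : seq L) a : hom false a -> P a ->
  (forall a v, hom false a -> P a -> hom true v -> Q v ->
    span (fun z => z \in es) (sbracket a v)) ->
  (forall v, hom true v -> exists v', [/\ hom true v', Q v' & span (fun z => z \in fv) (v - v')]) ->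
  forall v, hom true v -> span (fun z => z \in es ++ [seq sbracket a f | f <- fv]) (sbracket a v).
Proof.
move=> ha Pa hes cfv y hy; have [y' [hy' Qy' sy]] := cfv y hy.
rewrite -(subrK y' y) sbDr; apply: (subspaceD (span_subspace _)); last first.
  by have := hes _ _ ha Pa hy' Qy'; apply: span_mono => z; rewrite mem_cat => ->.
move: (y - y') sy; apply: span_min.
  split=> [|c x z hx hz]; first by rewrite sb0r; exact: span0.
  by rewrite sbracketPr; apply: (span_subspace _).2.
by move=> z hz; apply: span_id; rewrite mem_cat map_f ?orbT.
Qed.

(** For a in A the space [a, L_1] is spanned by K vectors, K independent of a, so K + 1 letters from
    A kill L_1. A general even element is one of A plus a combination of [fa]; a word of length M +
    K + 1 expands into words with at least M letters from [fa] or at least K + 1 from A. *)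
Lemma even_action_nilpotent : small_action L -> exists N, forall s v,
  (forall a, a \in s -> hom false a) -> hom true v -> (N <= size s)%N -> mact s v = 0.
Proof.
move=> [P [Q [es [fP fQ hes]]]].
have [fa [hfa cfa]] := fincodim_complement (hom_subspace false) fP.
have [fv [hfv cfv]] := fincodim_complement (hom_subspace true) fQ.
pose A a := hom false a /\ P a.
pose K := (size es + size fv)%N.
have nilA s v : (forall a, a \in s -> A a) -> hom true v -> (K.+1 <= size s)%N -> mact s v = 0.
  case/lastP: s => // s a hs hv; rewrite size_rcons ltnS => les.
  have [ha Pa] : A a by apply: hs; rewrite mem_rcons mem_head.
  pose X z := exists2 y, hom true y & z = sbracket a y.
  rewrite -cats1 mact_cat /=.
  apply: (@mact_finite A X (es ++ [seq sbracket a v | v <- fv])).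
  - by move=> b [].
  - split=> [|c _ _ [y Xy ->] [z Xz ->]].
      by exists 0; [case: (hom_subspace (s := L) true) | rewrite sb0r].
    by exists (c *: y + z); [apply: (hom_subspace true).2 | rewrite sbracketPr].
  - move=> b _ [hb _] [y hy ->]; exists (sbracket b y).
      exact: (hom_sbracket false true).
    by rewrite (even_comm even_abel).
  - by move=> _ [y hy ->]; exact: (ad_image (P := P) (Q := Q) ha Pa hes cfv hy).
  - by move=> b hb; apply: hs; rewrite mem_rcons inE hb orbT.
  - by rewrite size_cat size_map.
  - by exists v.
pose aa (i : 'I_(size fa)) := fa`_i.
have haa i : hom false (aa i) by apply: hfa; rewrite mem_nth.
have [M hM] := dsc_nilpotent even_abel adnil haa.
pose T n v := span (fun z => exists c w, [/\ (size c + size w = n)%N,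
  forall a, a \in w -> A a & z = dsc aa c (mact w v)]).
have stT n v a t : hom false a -> T n v t -> T n.+1 v (sbracket a t).
  move=> ha; move: t; apply: span_min.
    split=> [|c x z hx hz]; first by rewrite sb0r; exact: span0.
    by rewrite sbracketPr; apply: (span_subspace _).2.
  move=> _ [c [w [scw hw ->]]]; have [a' [ha' Pa' sa]] := cfa a ha.
  rewrite -(subrK a' a) sbDl; apply: (subspaceD (span_subspace _)); last first.
    apply: span_id; exists c, (a' :: w); split.
    - by rewrite /= addnS scw.
    - by move=> b; rewrite inE => /orP[/eqP->//|/hw].
    - exact: dsc_even.
  move: (a - a') sa; apply: span_min.
    split=> [|k x z hx hz]; first by rewrite sb0l; exact: span0.
    by rewrite sbracketPl; apply: (span_subspace _).2.
  move=> z hz; have iz : (index z fa < size fa)%N by rewrite index_mem.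
  apply: span_id; exists (Ordinal iz :: c), w; split=> //; first by rewrite /= addSn scw.
  by rewrite /= /aa /= nth_index.
exists (M + K.+1)%N => s v hs hv ls.
have Ts : T (size s) v (mact s v).
  elim: s hs {ls} => [|a s ih] hs; first by apply: span_id; exists [::], [::].
  apply: stT; first by apply: hs; rewrite mem_head.
  by apply: ih => b bs; apply: hs; rewrite inE bs orbT.
move: (mact s v) Ts; apply: span_min.
  by split=> // c x y -> ->; rewrite scaler0 addr0.
move=> _ [c [w [scw hw ->]]]; have [Mc|cM] := leqP M (size c); first exact: hM.
rewrite nilA ?dsc0 //; rewrite -(leq_add2l M) (leq_trans ls) // -scw leq_add2r.
exact: ltnW.
Qed.

Lemma nilpotent_of_even_action N : (forall s v, (forall a, a \in s -> hom false a) ->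
  hom true v -> (N <= size s)%N -> mact s v = 0) -> nilpotent_alg L.
Proof.
move=> hN.
pose E n := span (fun z => exists s v, [/\ size s = n, forall a, a \in s -> hom false a,
  hom true v & z = mact s v]).
have oddE n z : E n z -> hom true z.
  move: z; apply: span_min; first exact: hom_subspace.
  by move=> _ [s [v [_ hs hv ->]]]; apply: mact_odd.
have stE n a z : hom false a -> E n z -> E n.+1 (sbracket a z).
  move=> ha; move: z; apply: span_min.
    split=> [|c x z hx hz]; first by rewrite sb0r; exact: span0.
    by rewrite sbracketPr; apply: (span_subspace _).2.
  move=> _ [s [v [<- hs hv ->]]]; apply: span_id; exists (a :: s), v; split=> // b.
  by rewrite inE => /orP[/eqP->//|/hs].
have skew a z : hom false a -> hom true z -> sbracket z a = - sbracket a z.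
  by move=> ha hz; rewrite (sbracketC _ _ _ _ hz ha) expr0 scale1r.
have lcsE n : forall z, lcs n.+1 z -> E n.+1 z.
  elim: n => [|n ih] z /lspanE; move: z; apply: span_min; try exact: span_subspace.
    move=> _ [x [y [_ _ ->]]].
    have [x0 [x1 [hx0 hx1 ->]]] := hom_sum x; have [y0 [y1 [hy0 hy1 ->]]] := hom_sum y.
    rewrite sbDl !sbDr (even_abel hx0 hy0) (odd_abel hx1 hy1) add0r addr0 (skew y0 x1) //.
    apply: (subspaceB (span_subspace _)); apply: stE => //; apply: span_id.
      by exists [::], y1.
    by exists [::], x1.
  move=> _ [x [y [/ih Ex _ ->]]].
  have [y0 [y1 [hy0 hy1 ->]]] := hom_sum y; have hx := oddE _ _ Ex.
  rewrite sbDr (odd_abel hx hy1) addr0 skew //.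
  by apply: (subspaceN (span_subspace _)); apply: stE.
exists N.+1 => z /lcsE; move: z; apply: span_min.
  by split=> // c x y -> ->; rewrite scaler0 addr0.
by move=> _ [s [v [ss hs hv ->]]]; rewrite hN // ss.
Qed.

End NilpotentAction.

(** * The case of a central even part *)

Section Central.
Variables (F : fieldType) (L : lieSuperalgType F).
Hypothesis even_abel : forall x y : L, hom false x -> hom false y -> sbracket x y = 0.
Hypothesis even_odd : forall x y : L, hom false x -> hom true y -> sbracket x y = 0.

Lemma even_central (x y : L) : hom false x -> sbracket x y = 0.
Proof.
move=> hx; have [y0 [y1 [hy0 hy1 ->]]] := hom_sum y.
by rewrite sbDr even_abel // even_odd // addr0.
Qed.

Lemma even_centralr (x y : L) : hom false x -> sbracket y x = 0.
Proof.
move=> hx; have [y0 [y1 [hy0 hy1 ->]]] := hom_sum y.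
by rewrite sbDl even_abel // (sbracketC _ _ _ _ hy1 hx) even_odd // scaler0 oppr0 addr0.
Qed.

Lemma nilpotent_of_even_central : nilpotent_alg L.
Proof.
exists 2%N => z /lspanE; move: z; apply: span_min.
  by split=> // c x y -> ->; rewrite scaler0 addr0.
move=> _ [x [y [/lspanE hx _ ->]]]; apply: even_central.
move: x hx; apply: span_min; first exact: hom_subspace.
move=> _ [u [v [_ _ ->]]].
have [u0 [u1 [hu0 hu1 ->]]] := hom_sum u; have [v0 [v1 [hv0 hv1 ->]]] := hom_sum v.
rewrite sbDl (even_central _ hu0) add0r sbDr (even_centralr _ hv0) add0r.
exact: (hom_sbracket true true).
Qed.
End Central.

(** * Words in nilpotent letters *)

Section NilpotentWords.
Variables (F : fieldType) (R : algType F).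

Lemma word_pigeonhole (I : finType) (w : seq I) n : (#|I| * n < size w)%N ->
  exists i, (n < count_mem i w)%N.
Proof.
move=> hw; apply: contrapT => hno; move: hw; rewrite ltnNge => /negP; apply.
rewrite -(sum1_size w) (partition_big id xpredT) //= -sum_nat_const.
apply: leq_sum => i _; rewrite sum1_count leqNgt; apply/negP => hi; apply: hno.
by exists i.
Qed.

Lemma word_extract (I : finType) (z : I -> R) (c : I -> I -> F) :
  (forall i k, z i * z k = c i k *: (z k * z i)) -> forall (w : seq I) i, exists e : F,
  \prod_(k <- w) z k =
  e *: (z i ^+ count_mem i w * \prod_(k <- filter (predC1 i) w) z k).
Proof.
move=> hz w i.
have comm k n : exists e : F, z k * z i ^+ n = e *: (z i ^+ n * z k).
  elim: n => [|n [e ih]]; first by exists 1; rewrite expr0 mulr1 mul1r scale1r.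
  exists (e * c k i); rewrite exprSr mulrA ih -scalerAl -[in LHS]mulrA [in LHS]hz.
  by rewrite -[in LHS]scalerAr scalerA !mulrA.
elim: w => [|k w [e ih]]; first by exists 1; rewrite !big_nil expr0 mul1r scale1r.
rewrite /= big_cons ih; have [->|ki] /= := eqVneq k i.
  by exists e; rewrite add1n exprS -scalerAr mulrA.
have [e' he'] := comm k (count_mem i w).
exists (e * e'); rewrite add0n big_cons -[in LHS]scalerAr [in LHS]mulrA he'.
by rewrite -[in LHS]scalerAl scalerA -[in LHS]mulrA.
Qed.

(** Some letter occurs more than n times, and since letters commute up to scalars its occurrences
    can be moved to the front. *)
Lemma word_nil (I : finType) (z : I -> R) (c : I -> I -> F) n :
  (forall i k, z i * z k = c i k *: (z k * z i)) -> (forall i, z i ^+ n.+1 = 0) ->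
  forall w : seq I, (#|I| * n < size w)%N -> \prod_(k <- w) z k = 0.
Proof.
move=> hz zn w /word_pigeonhole[i hi]; have [e ->] := word_extract hz w i.
by rewrite -(subnKC hi) exprD zn !mul0r scaler0.
Qed.
(* Left multiplication by [x] is a matrix with entries in a supercommutative nil algebra, so the
   entries of its powers are sums of long words in finitely many nilpotent letters. *)
Lemma matrix_nil (P : bool -> R -> Prop) (n : nat) (I : finType) (E : I -> R) (k0 : I) x :
  (forall i, subspace (P i)) ->
  (forall i j a b, P i a -> P j b -> a * b = (-1) ^+ (i && j) *: (b * a)) ->
  (forall i a, P i a -> a ^+ n.+1 = 0) -> E k0 = 1 ->
  (forall k, span (fun z => exists l i b, P i b /\ z = E l * b) (x * E k)) ->
  x ^+ (#|{: bool * (I * I)}| * n).+1 = 0.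
Proof.
move=> sP comP nilP E0 hx.
have coef k : exists M : I * bool -> R, (forall t, P t.2 (M t)) /\
    x * E k = \sum_t E t.1 * M t.
  elim: (hx k) => [|c z y [l [i [b [Pb ->]]]] _ [M [hM ->]]].
    exists (fun=> 0); split=> [t|]; first by case: (sP t.2).
    by rewrite big1 // => t _; rewrite mulr0.
  exists (fun t => (if t == (l, i) then c else 0) *: b + M t); split=> [t|].
    have [->|_] := eqVneq t (l, i); first by apply: (sP i).2 => //; exact: (hM (l, i)).
    by rewrite scale0r add0r.
  rewrite [in LHS](bigD1 (l, i)) //= [in RHS](bigD1 (l, i)) //= eqxx.
  rewrite addrA mulrDr -scalerAr; congr (_ + _).
  by apply: eq_bigr => t /negPf->; rewrite scale0r add0r.
have [M hM] := choice coef.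
pose z (t : bool * (I * I)) := M t.2.2 (t.2.1, t.1).
have Pz t : P t.1 (z t) by case: t => i [l k]; have [] := hM k => /(_ (l, i)).
pose T N := span (fun y => exists k (w : seq (bool * (I * I))),
  size w = N /\ y = E k * \prod_(t <- w) z t).
have stT N y : T N y -> T N.+1 (x * y).
  elim=> [|c {}y y' [k [w [sw ->]]] _ ih]; first by rewrite mulr0; exact: span0.
  rewrite mulrDr -scalerAr; apply: (span_subspace _).2 => //.
  rewrite mulrA (hM k).2 mulr_suml; apply: subspace_sum; first exact: span_subspace.
  move=> [l i] _; apply: span_id; exists l, ((i, (l, k)) :: w); split; first by rewrite /= sw.
  by rewrite big_cons -mulrA.
have Tx N : T N (x ^+ N).
  elim: N => [|N ih]; first by apply: span_id; exists k0, [::]; rewrite big_nil E0 mulr1.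
  by rewrite exprS; apply: stT.
set N := (_.+1); elim: (Tx N) => // c y y' [k [w [sw ->]]] _ ->.
rewrite (word_nil (c := fun t u => (-1) ^+ (t.1 && u.1)) (n := n)) ?mulr0 ?scaler0 ?addr0 //.
- by move=> t u; apply: comP.
- by move=> t; apply: (nilP t.1).
- by rewrite sw.
Qed.

Lemma frobenius_comm (p m : nat) (a b : R) : p \in [pchar R] -> GRing.comm a b ->
  (a + b) ^+ (p ^ m) = a ^+ (p ^ m) + b ^+ (p ^ m).
Proof.
move=> chR; elim: m a b => [|m ih] a b cab; first by rewrite expn0 !expr1.
rewrite expnSr !exprM ih //.
apply: (pFrobenius_autD_comm chR (x := a ^+ (p ^ m)) (y := b ^+ (p ^ m))).
by apply: commrX; apply/commr_sym/commrX/commr_sym.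
Qed.

Lemma span_frobenius (p m : nat) (S T : R -> Prop) : p \in [pchar R] -> subspace T ->
  (forall x y, S x -> S y -> x * y = y * x) -> (forall x, S x -> T (x ^+ (p ^ m))) ->
  forall x, span S x -> T (x ^+ (p ^ m)).
Proof.
move=> chR sT cS hS.
have p0 : (0 < p ^ m)%N by rewrite expn_gt0 prime_gt0 // (pcharf_prime chR).
move=> x; elim=> [|c {}x y Sx sy ih].
  by rewrite expr0n; case: (p ^ m)%N p0; case: sT.
have cxy : GRing.comm (c *: x) y.
  rewrite /GRing.comm -scalerAl -scalerAr; congr (_ *: _).
  elim: sy => [|d z t Sz _ e]; first by rewrite mulr0 mul0r.
  by rewrite mulrDr mulrDl e -scalerAl -scalerAr cS.
by rewrite frobenius_comm // exprZn; apply: sT.2 => //; apply: hS.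
Qed.
End NilpotentWords.

Section Quotient.
Variables (F : fieldType) (U : algType F) (K : U -> Prop).
Hypothesis properK : ~ ideal_gen K 1.

Let KI : {pred U} := ideal_pred K.
HB.instance Definition _ := GRing.isZmodClosed.Build U KI (ideal_pred_zmod _).
HB.instance Definition _ := isProperIdeal.Build U KI (ideal_pred_proper properK).
HB.instance Definition _ := isRightStable.Build U KI (@ideal_pred_right _ _).

Lemma ideal_quotient : exists (R : algType F) (pi : U -> R),
  [/\ forall (c : F) x y, pi (c *: x + y) = c *: pi x + pi y,
      forall x y, pi (x * y) = pi x * pi y, pi 1 = 1,
      forall x, pi x = 0 <-> ideal_gen K x & forall y, exists x, y = pi x].
Proof.
exists (quot_alg KI : algType F), (qpi KI); split.
- by move=> c x y; rewrite linearP.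
- by move=> x y; rewrite rmorphM.
- exact: rmorph1.
- by move=> x; split=> [/(qpi_eq0 KI)/ideal_predP//|/ideal_predP Kx]; exact/(qpi_eq0 KI).
- exact: qpi_surj.
Qed.
End Quotient.

(** * Ideals generated by odd elements *)

Section OddIdeals.
Variables (F : fieldType) (L : lieSuperalgType F) (R : algType F) (j : L -> R).
Hypothesis env : env_quotient j.
Hypothesis two_neq0 : 2%:R != 0 :> F.
Hypothesis odd_abel : forall x y : L, hom true x -> hom true y -> sbracket x y = 0.
Implicit Types (x y z a b v w : L) (s : seq L) (t u : R) (X Y : L -> Prop).

Lemma odd_anticomm v w : hom true v -> hom true w -> j v * j w = - (j w * j v).
Proof.
by move=> hv hw; apply/eqP; rewrite -addr_eq0 (env_odd env) // odd_abel // (env0 env).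
Qed.

Lemma eq_opp0 (t : R) : t = - t -> t = 0.
Proof.
move/eqP; rewrite -addr_eq0 -mulr2n -scaler_nat scaler_eq0 (negPf two_neq0).
by move/eqP.
Qed.

Lemma odd_square v : hom true v -> j v * j v = 0.
Proof. by move=> hv; apply: eq_opp0; exact: odd_anticomm. Qed.

Definition idl X := span (fun z : R => exists x t, X x /\ z = j x * t).

Lemma idl_subspace X : subspace (idl X). Proof. exact: span_subspace. Qed.

Lemma idl_cons X x t : X x -> idl X (j x * t).
Proof. by move=> Xx; apply: span_id; exists x, t. Qed.

Lemma idl_mulr X t u : idl X t -> idl X (t * u).
Proof.
elim=> [|c {}t t' [x [r [Xx ->]]] _ ih]; first by rewrite mul0r; exact: span0.
by rewrite mulrDl -scalerAl -mulrA; apply: (idl_subspace X).2 => //; exact: idl_cons.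
Qed.

Lemma env_split x t (T : R -> Prop) : subspace T ->
  (forall a, hom false a -> T (j a * t)) -> (forall v, hom true v -> T (j v * t)) ->
  T (j x * t).
Proof.
move=> sT h0 h1; have [a [v [ha hv ->]]] := hom_sum x.
by rewrite (envD env) mulrDl; apply: subspaceD => //; [exact: h0 | exact: h1].
Qed.

Lemma left_stable (T : R -> Prop) : subspace T ->
  (forall a t, hom false a -> T t -> T (j a * t)) ->
  (forall v t, hom true v -> T t -> T (j v * t)) -> forall u t, T t -> T (u * t).
Proof.
move=> sT h0 h1; apply: (env_ind env) => [||x v ih].
- split=> [t _|c u v hu hv t Tt]; first by rewrite mul0r; case: sT.
  by rewrite mulrDl -scalerAl; apply: sT.2; auto.
- by move=> t; rewrite mul1r.
move=> t /ih Tt; rewrite -mulrA; apply: env_split => // [a ha|w hw]; auto.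
Qed.

Section Stable.
Variable X : L -> Prop.
Hypotheses (X_odd : forall x, X x -> hom true x)
  (X_stable : forall a x, hom false a -> X x -> X (sbracket a x)).

Lemma idl_mull t u : idl X t -> idl X (u * t).
Proof.
apply: left_stable => [|a {}t ha|v {}t hv]; first exact: idl_subspace.
  elim=> [|c {}t t' [x [r [Xx ->]]] _ ih]; first by rewrite mulr0; exact: span0.
  rewrite mulrDr -scalerAr mulrA (env_even_any env) // mulrDl -mulrA.
  apply: (idl_subspace X).2 => //; apply: (subspaceD (idl_subspace _)); apply: idl_cons => //.
  exact: X_stable.
elim=> [|c {}t t' [x [r [Xx ->]]] _ ih]; first by rewrite mulr0; exact: span0.
rewrite mulrDr -scalerAr mulrA (odd_anticomm hv (X_odd Xx)) mulNr -mulrA -mulrN.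
by apply: (idl_subspace X).2 => //; apply: idl_cons.
Qed.

Lemma idl_right t : idl X t -> span (fun z : R => exists u x, X x /\ z = u * j x) t.
Proof.
have sT := span_subspace (fun z : R => exists u x, X x /\ z = u * j x).
set T := (span _) in sT *.
have stT (u r : R) : T r -> T (u * r).
  elim=> [|c z y [r' [x [Xx ->]]] _ ih]; first by rewrite mulr0; case: sT.
  rewrite mulrDr -scalerAr mulrA; apply: sT.2 => //.
  by apply: span_id; exists (u * r'), x.
suff h u : forall x, X x -> T (j x * u).
  by apply: span_min => // z [x [u [Xx ->]]]; apply: h.
move: u {t}; apply: (env_ind env) => [||y u ih].
- split=> [x _|c u v hu hv x Xx]; first by rewrite mulr0; case: sT.
  by rewrite mulrDr -scalerAr; apply: sT.2; auto.
- by move=> x Xx; apply: span_id; exists 1, x; rewrite mulr1 mul1r.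
move=> x Xx; have [a [v [ha hv ->]]] := hom_sum y.
rewrite (envD env) mulrDl mulrDr; apply: subspaceD => //.
  have -> : j x * (j a * u) = j a * (j x * u) - j (sbracket a x) * u.
    by rewrite !mulrA (env_even_any env x ha) mulrDl addrK.
  by apply: subspaceB => //; [apply/stT/ih | apply/ih/X_stable].
rewrite mulrA (odd_anticomm (X_odd Xx) hv) mulNr -mulrA.
by apply: subspaceN => //; apply/stT/ih.
Qed.

Definition idw n := span (fun z : R => exists s r,
  [/\ forall x, x \in s -> X x, size s = n & z = \prod_(x <- s) j x * r]).

Lemma idw_cons n x t : X x -> idw n t -> idw n.+1 (j x * t).
Proof.
move=> Xx; elim=> [|c {}t t' [s [r [hs ss ->]]] _ ih]; first by rewrite mulr0; exact: span0.
rewrite mulrDr -scalerAr mulrA; apply: spanP => //; exists (x :: s), r; split.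
- by move=> y; rewrite inE => /orP[/eqP->//|/hs].
- by rewrite /= ss.
- by rewrite big_cons.
Qed.

Lemma idw_mull n u t : idw n t -> idw n (u * t).
Proof.
apply: left_stable => [|a {}t ha|v {}t hv]; first exact: span_subspace.
  elim=> [|c {}t t' [s [r [hs ss ->]]] _ ih]; first by rewrite mulr0; exact: span0.
  rewrite mulrDr -scalerAr; apply: (span_subspace _).2 => //; rewrite -{n}ss in ih *.
  elim: s hs {ih} => [|x s ihs] hs.
    by apply: span_id; exists [::], (j a * r); split=> //; rewrite !big_nil !mul1r.
  have Xx : X x by apply: hs; rewrite mem_head.
  have hs' y : y \in s -> X y by move=> ys; apply: hs; rewrite inE ys orbT.
  rewrite big_cons -[_ * r]mulrA [j a * _]mulrA (env_even_any env) // mulrDl -[_ * j a * _]mulrA.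
  apply: (subspaceD (span_subspace _)); apply: idw_cons => //; first exact: ihs.
    exact: X_stable.
  by apply: span_id; exists s, r.
elim=> [|c {}t t' [s [r [hs ss ->]]] _ ih]; first by rewrite mulr0; exact: span0.
rewrite mulrDr -scalerAr; apply: (span_subspace _).2 => //; rewrite -{n}ss in ih *.
elim: s hs {ih} => [|x s ihs] hs.
  by apply: span_id; exists [::], (j v * r); split=> //; rewrite !big_nil !mul1r.
have Xx : X x by apply: hs; rewrite mem_head.
rewrite big_cons -[_ * r]mulrA [j v * _]mulrA (odd_anticomm hv (X_odd Xx)) mulNr -[_ * j v * _]mulrA.
apply: (subspaceN (span_subspace _)); apply: idw_cons => //; apply: ihs => y ys.
by apply: hs; rewrite inE ys orbT.
Qed.

Lemma idl_pow_word n t : idl X t -> idw n (t ^+ n).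
Proof.
move=> Xt; elim: n => [|n ih].
  by apply: span_id; exists [::], 1; split=> //; rewrite big_nil mulr1.
rewrite exprS; move: (t ^+ n) ih => u ih.
elim: Xt => [|c x y [v [r [Xv ->]]] _ ih']; first by rewrite mul0r; exact: span0.
rewrite mulrDl -scalerAl -mulrA; apply: (span_subspace _).2 => //.
by apply: idw_cons => //; apply: idw_mull.
Qed.
End Stable.

(** Modulo the ideal of [X] a product of [size fs + 1] elements of [Y] is a combination of words in
    [fs] of that length; one letter is repeated, odd letters anticommute, and their squares are
    0. *)
Lemma idl_power X Y (fs : seq L) t :
  (forall x, X x -> hom true x) -> (forall a x, hom false a -> X x -> X (sbracket a x)) ->
  (forall x, Y x -> hom true x) -> (forall a x, hom false a -> Y x -> Y (sbracket a x)) ->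
  (forall f, f \in fs -> hom true f) ->
  (forall y, Y y -> exists x, X x /\ span (fun z => z \in fs) (y - x)) ->
  idl Y t -> idl X (t ^+ (size fs).+1).
Proof.
move=> X1 stX Y1 stY fs1 hY Yt.
pose ff (i : 'I_(size fs)) := fs`_i.
have ff1 i : hom true (ff i) by apply: fs1; rewrite mem_nth.
pose T n := span (fun z : R => idl X z \/
  exists (c : seq 'I_(size fs)) r, size c = n /\ z = \prod_(i <- c) j (ff i) * r).
have stT n u : T n u -> forall y, Y y -> T n.+1 (j y * u).
  move=> Tu y Yy; have [x [Xx sx]] := hY y Yy.
  rewrite -(subrK x y) (envD env) mulrDl; apply: (subspaceD (span_subspace _)); last first.
    by apply: span_id; left; exact: idl_cons.
  elim: Tu => [|c z1 z2 hz _ ih]; first by rewrite mulr0; exact: span0.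
  rewrite mulrDr -scalerAr; apply: (span_subspace _).2 => //.
  case: hz => [Xz|[w [r [sw ->]]]]; first by apply: span_id; left; exact: idl_mull.
  elim: sx => [|d f g hf _ ihf]; first by rewrite (env0 env) mul0r; exact: span0.
  rewrite (envP env) mulrDl -scalerAl; apply: spanP => //; right.
  have iz : (index f fs < size fs)%N by rewrite index_mem.
  exists (Ordinal iz :: w), r; split; first by rewrite /= sw.
  by rewrite big_cons /ff /= nth_index // mulrA.
set n := (size fs).+1.
have : T n (t ^+ n).
  move: (idl_pow_word Y1 stY n Yt); apply: span_min; first exact: span_subspace.
  move=> _ [s [r [hs <- ->]]]; elim: s hs => [|y s ih] hs.
    by apply: span_id; right; exists [::], r; rewrite !big_nil.
  rewrite big_cons -mulrA; apply: stT; last by apply: hs; rewrite mem_head.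
  by apply: ih => z zs; apply: hs; rewrite inE zs orbT.
apply: span_min; first exact: idl_subspace.
move=> _ [//|[c [r [sc ->]]]].
rewrite (word_nil (c := fun _ _ => -1) (n := 1)) ?mul0r; first exact: span0.
- by move=> i k; rewrite scaleN1r; apply: odd_anticomm.
- by move=> i; rewrite expr2 odd_square.
- by rewrite card_ord muln1 sc.
Qed.

End OddIdeals.

(** * Bounded nilpotency modulo a finite-dimensional ideal *)

Section EngelInQuotient.
Variables (F : fieldType) (L : lieSuperalgType F) (R : algType F) (j : L -> R).
Hypothesis env : env_quotient j.
Variable (p m : nat).
Hypotheses (charR : p \in [pchar R]) (odd_p : odd p).

Lemma central_all u : (forall x, u * j x = j x * u) -> forall t, u * t = t * u.
Proof.
move=> hu; apply: (env_ind env) => [||x t ih].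
- split=> [|c x y hx hy]; first by rewrite mulr0 mul0r.
  by rewrite mulrDr mulrDl -scalerAl -scalerAr hx hy.
- by rewrite mulr1 mul1r.
- by rewrite mulrA hu -mulrA ih mulrA.
Qed.

Lemma even_pow_central a : hom false a -> (forall x, iter (p ^ m) (ad a) x = 0) ->
  forall t, j a ^+ (p ^ m) * t = t * j a ^+ (p ^ m).
Proof.
move=> ha na; apply: central_all => x.
have iter_comm k y : lcomm (j y) (nseq k (j a)) = (-1) ^+ k * j (iter k (ad a) y).
  elim: k y => [|k ih] y; first by rewrite mul1r.
  rewrite iterSr exprS [LHS]/= -/(lcomm _ _).
  have -> : comm (j y) (j a) = j (- ad a y).
    by rewrite /comm (env_even_any env y ha) opprD addrA subrr sub0r (envN env).
  rewrite ih; elim: k {ih} => [|k ih]; first by rewrite /= mulr1 mul1r (envN env) mulN1r.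
  have adN i z : iter i (ad a) (- z) = - iter i (ad a) z.
    by elim: i => //= i ->; rewrite /ad -scaleN1r sbZr scaleN1r.
  by rewrite adN (envN env) mulrN mulN1r mulNr.
have := lcomm_pexp charR odd_p m (j x) (j a).
rewrite iter_comm na (env0 env) mulr0 /comm => /eqP.
by rewrite eq_sym subr_eq0 => /eqP.
Qed.
End EngelInQuotient.

Section SuperNil.
Variables (F : fieldType) (L : lieSuperalgType F) (R : algType F) (j : L -> R).
Hypothesis env : env_quotient j.
Hypothesis two_neq0 : 2%:R != 0 :> F.
Hypothesis even_abel : forall x y : L, hom false x -> hom false y -> sbracket x y = 0.
Hypothesis odd_abel : forall x y : L, hom true x -> hom true y -> sbracket x y = 0.
Variables (p q : nat).
Hypotheses (charR : p \in [pchar R]).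
Variables (A V : L -> Prop) (fa fv : seq L).
Hypotheses (A_even : forall a, A a -> hom false a) (V_odd : forall v, V v -> hom true v)
  (V_stable : forall a v, hom false a -> V v -> V (sbracket a v))
  (AV : forall a v, A a -> V v -> j (sbracket a v) = 0)
  (fa_even : forall a, a \in fa -> hom false a) (fv_odd : forall v, v \in fv -> hom true v)
  (fa_split : forall a, hom false a -> exists a', A a' /\ span (fun z => z \in fa) (a - a'))
  (fv_split : forall v, hom true v -> exists v', V v' /\ span (fun z => z \in fv) (v - v'))
  (fa_central : forall a, a \in fa -> forall t, j a ^+ q.+1 * t = t * j a ^+ q.+1).
Implicit Types (a v w : L) (s : seq L) (t u : R).

Let aa (i : 'I_(size fa)) := fa`_i.
Let vv (i : 'I_(size fv)) := fv`_i.

Let aa_in i : aa i \in fa. Proof. exact: mem_nth. Qed.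
Let vv_in i : vv i \in fv. Proof. exact: mem_nth. Qed.

(** Generators of the supercommutative coefficient algebra. [A] commutes with [V] because [AV] makes
    their brackets vanish in [R], and the powers of the complement [fa] are central; [sword] records
    words with their parity. *)
Inductive sgen : bool -> R -> Prop :=
| sgenA a of A a : sgen false (j a)
| sgenC i : sgen false (j (aa i) ^+ q.+1)
| sgenV v of V v : sgen true (j v).

Inductive sword : bool -> R -> Prop :=
| sword1 : sword false 1
| swordM i k g t of sgen i g & sword k t : sword (i (+) k) (g * t).

Let sc (i k : bool) : F := (-1) ^+ (i && k).

Let scD i k l : sc (i (+) k) l = sc k l * sc i l.
Proof. by rewrite /sc; case: i k l => [] [] []; rewrite /= ?expr0 ?expr1 ?mulr1 ?mul1r ?mulrNN ?mulr1. Qed.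

Let scC i k : sc i k = sc k i. Proof. by rewrite /sc andbC. Qed.

Lemma sgen_comm i k (x y : R) : sgen i x -> sgen k y -> x * y = sc i k *: (y * x).
Proof.
have jA a b : hom false a -> hom false b -> j a * j b = j b * j a.
  by move=> ha hb; rewrite (env_even_any env) // even_abel // (env0 env) addr0.
case=> [a Aa|l|v Vv] [b Ab|r|w Vw]; rewrite /sc /= ?expr0 ?expr1 ?scale1r ?scaleN1r.
- by apply: jA; apply: A_even.
- by rewrite fa_central.
- by rewrite (env_even_any env) ?AV ?addr0 //; apply: A_even.
- by rewrite fa_central.
- by rewrite fa_central.
- by rewrite fa_central.
- by rewrite [RHS](env_even_any env) ?AV ?addr0 //; apply: A_even.
- by rewrite fa_central.
- by apply: (odd_anticomm env odd_abel); apply: V_odd.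
Qed.

Lemma comm_scale (c d : F) (x y t : R) : x * t = c *: (t * x) -> y * t = d *: (t * y) ->
  (x * y) * t = (d * c) *: (t * (x * y)) :> R.
Proof. by move=> hx hy; rewrite -mulrA hy -scalerAr [in LHS]mulrA hx -scalerAl scalerA !mulrA. Qed.

Lemma sword_comm_gen i k (g t : R) : sgen i g -> sword k t -> g * t = sc i k *: (t * g).
Proof.
move=> hg; elim=> [|{}k l h {}t hh _ ih]; first by rewrite /sc andbF expr0 scale1r mulr1 mul1r.
rewrite [in LHS]mulrA (sgen_comm hg hh) -[in LHS]scalerAl -[in LHS]mulrA ih -[in LHS]scalerAr scalerA !mulrA.
by rewrite ![sc i _]scC scD mulrC.
Qed.

Lemma sword_comm i k (t u : R) : sword i t -> sword k u -> t * u = sc i k *: (u * t).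
Proof.
move=> ht hu; elim: ht => [|{}i l g {}t hg _ ih]; first by rewrite /sc expr0 scale1r mulr1 mul1r.
by rewrite scD; apply: comm_scale => //; exact: sword_comm_gen.
Qed.

Lemma sword_gen i g : sgen i g -> sword i g.
Proof. by move=> hg; rewrite -[i]addbF -[g]mulr1; apply: swordM => //; exact: sword1. Qed.

Definition sideal_word (i : bool) (z : R) :=
  exists v t, [/\ V v, sword (~~ i) t & z = j v * t].

Definition sideal i := span (sideal_word i).

Lemma sideal_word_sword i (z : R) : sideal_word i z -> sword i z.
Proof.
move=> [v [t [Vv ht ->]]]; have := swordM (sgenV Vv) ht.
by rewrite addTb negbK.
Qed.

Lemma sideal_comm i k (t u : R) : sideal i t -> sideal k u -> t * u = sc i k *: (u * t).
Proof.
move=> ht hu; elim: ht => [|c x y hx _ ih]; first by rewrite mulr0 mul0r scaler0.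
rewrite mulrDl mulrDr ih scalerDr -scalerAl -scalerAr; congr (_ + _).
rewrite scalerA mulrC -scalerA; congr (_ *: _).
elim: hu => [|d z w hz _ ih']; first by rewrite mulr0 mul0r scaler0.
rewrite mulrDr mulrDl ih' scalerDr -scalerAl -scalerAr; congr (_ + _).
rewrite scalerA mulrC -scalerA; congr (_ *: _).
by apply: sword_comm; exact: sideal_word_sword.
Qed.

(** An odd element squares to 0 by supercommutativity. An even one is a sum of commuting words each
    containing some v in [V]; such words square to 0 because v does, and the p-th power is additive
    on them. *)
Lemma sideal_nil i t : sideal i t -> t ^+ p = 0.
Proof.
have p2 : (1 < p)%N := prime_gt1 (pcharf_prime charR).
have sq0 (u : R) : u * u = 0 -> u ^+ p = 0.
  by move=> hu; rewrite -(subnKC p2) exprD expr2 hu mul0r.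
case: i => ht.
  apply: sq0; apply: (eq_opp0 two_neq0).
  by rewrite {1}(sideal_comm ht ht) /sc expr1 scaleN1r.
have := span_frobenius (m := 1) (S := sideal_word false) (T := fun u => u = 0) charR.
rewrite expn1; apply=> //.
- by split=> // c x y -> ->; rewrite scaler0 addr0.
- move=> x y /sideal_word_sword hx /sideal_word_sword hy.
  by rewrite (sword_comm hx hy) /sc expr0 scale1r.
move=> x hx; apply: sq0; have wx := sideal_word_sword hx.
have [v [u [Vv hu ex]]] := hx.
rewrite {2}ex mulrA {1}ex -[j v * u * j v]mulrA.
have -> : u * j v = sc true true *: (j v * u).
  exact: (sword_comm hu (sword_gen (sgenV Vv))).
by rewrite -scalerAr mulrA (odd_square env two_neq0 odd_abel) ?mul0r ?scaler0 ?mul0r //; exact: V_odd.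
Qed.

Definition anysw (b : R) := exists i, sword i b.

Lemma anysw1 : anysw 1. Proof. by exists false; exact: sword1. Qed.

Lemma anyswM i g b : sgen i g -> anysw b -> anysw (g * b).
Proof. by move=> hg [k hb]; exists (i (+) k); apply: swordM. Qed.

Definition oddsp := span (fun z : R => exists s b,
  [/\ forall v, v \in s -> hom true v, anysw b & z = \prod_(v <- s) j v * b]).

Lemma oddsp_odd v t : hom true v -> oddsp t -> oddsp (j v * t).
Proof.
move=> hv; elim=> [|c {}t t' [s [b [hs hb ->]]] _ ih]; first by rewrite mulr0; exact: span0.
rewrite mulrDr -scalerAr mulrA; apply: spanP => //; exists (v :: s), b; split=> //.
  by move=> w; rewrite inE => /orP[/eqP->//|/hs].
by rewrite big_cons.
Qed.

Lemma oddsp_A a t : A a -> oddsp t -> oddsp (j a * t).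
Proof.
move=> Aa; elim=> [|c {}t t' [s [b [hs hb ->]]] _ ih]; first by rewrite mulr0; exact: span0.
rewrite mulrDr -scalerAr; apply: (span_subspace _).2 => // {c t t' ih}.
elim: s hs => [|v s ih] hs.
  apply: span_id; exists [::], (j a * b); split=> //; first exact: anyswM (sgenA Aa) hb.
  by rewrite !big_nil !mul1r.
have hv : hom true v by apply: hs; rewrite mem_head.
have hs' w : w \in s -> hom true w by move=> ws; apply: hs; rewrite inE ws orbT.
rewrite big_cons -[_ * b]mulrA [j a * _]mulrA (env_even_any env _ (A_even Aa)) mulrDl -[_ * j a * _]mulrA.
apply: (subspaceD (span_subspace _)); apply: oddsp_odd => //; first exact: ih.
  exact: (hom_sbracket false true _ _ (A_even Aa)).
by apply: span_id; exists s, b.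
Qed.

Lemma oddsp_C i t : oddsp t -> oddsp (j (aa i) ^+ q.+1 * t).
Proof.
elim=> [|c {}t t' [s [b [hs hb ->]]] _ ih]; first by rewrite mulr0; exact: span0.
rewrite mulrDr -scalerAr; apply: spanP => //; exists s, (j (aa i) ^+ q.+1 * b); split=> //.
  exact: anyswM (sgenC i) hb.
by rewrite [in LHS]mulrA (fa_central (aa_in i) (\prod_(v <- s) j v)) mulrA.
Qed.

Definition shortsp := span (fun z : R => exists (c : seq 'I_(size fv)) b,
  [/\ (size c <= size fv)%N, anysw b & z = \prod_(i <- c) j (vv i) * b]).

Lemma oddsp_short t : oddsp t -> shortsp t.
Proof.
apply: span_min; first exact: span_subspace.
move=> _ [s [b [hs hb ->]]]; elim: s hs => [|v s ih] hs.
  by apply: span_id; exists [::], b; rewrite !big_nil.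
have hv : hom true v by apply: hs; rewrite mem_head.
have /ih : forall w, w \in s -> hom true w by move=> w ws; apply: hs; rewrite inE ws orbT.
rewrite big_cons -mulrA; move: (\prod_(w <- s) j w * b) => u; elim=> [|c x y [d [b' [sd hb' ->]]] _ ih'].
  by rewrite mulr0; exact: span0.
rewrite mulrDr -scalerAr; apply: (span_subspace _).2 => //.
have [v' [Vv' sv]] := fv_split hv.
rewrite -(subrK v' v) (envD env) mulrDl; apply: (subspaceD (span_subspace _)); last first.
  have [e ->] : exists e : F, j v' * (\prod_(i <- d) j (vv i) * b') =
      e *: (\prod_(i <- d) j (vv i) * (j v' * b')).
    elim: d {sd} => [|i d [e he]]; first by exists 1; rewrite !big_nil !mul1r scale1r.
    exists (- e); rewrite !big_cons -!mulrA mulrA.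
    rewrite (odd_anticomm env odd_abel (V_odd Vv') (fv_odd (vv_in i))) mulNr -mulrA he.
    by rewrite -scalerAr scaleNr.
  apply: (subspaceZ _ (span_subspace _)); apply: span_id.
  by exists d, (j v' * b'); split=> //; exact: anyswM (sgenV Vv') hb'.
elim: sv => [|e f g hf _ ihf]; first by rewrite (env0 env) mul0r; exact: span0.
rewrite (envP env) mulrDl -scalerAl; apply: (span_subspace _).2 => //.
have iz : (index f fv < size fv)%N by rewrite index_mem.
pose i0 := Ordinal iz; have -> : f = vv i0 by rewrite /vv nth_index.
have [sd'|sd'] := ltnP (size d) (size fv).
  by apply: span_id; exists (i0 :: d), b'; rewrite big_cons mulrA.
rewrite mulrA -(big_cons _ _ i0 d xpredT (fun i => j (vv i))).
rewrite (word_nil (c := fun _ _ => -1) (n := 1)) ?mul0r; first exact: span0.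
- by move=> i k; rewrite scaleN1r; apply: (odd_anticomm env odd_abel); exact: fv_odd.
- by move=> i; rewrite expr2 (odd_square env two_neq0 odd_abel) //; exact: fv_odd.
- by rewrite card_ord muln1 /= ltnS.
Qed.

Definition evensp n := span (fun z : R => exists (c : seq 'I_(size fa)) t,
  [/\ (size c <= n)%N, oddsp t & z = \prod_(i <- c) j (aa i) * t]).

Lemma evensp_mono n n' t : (n <= n')%N -> evensp n t -> evensp n' t.
Proof.
move=> nn; apply: span_mono => _ [c [u [sc' hu ->]]]; exists c, u; split=> //.
exact: leq_trans nn.
Qed.

Lemma evensp_fa n i t : evensp n t -> evensp n.+1 (j (aa i) * t).
Proof.
elim=> [|k {}t t' [c [u [scc hu ->]]] _ ih]; first by rewrite mulr0; exact: span0.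
rewrite mulrDr -scalerAr mulrA; apply: spanP => //.
by exists (i :: c), u; rewrite big_cons.
Qed.

Lemma aa_comm a i : hom false a -> j a * j (aa i) = j (aa i) * j a.
Proof. by move=> ha; rewrite (env_even_any env) // even_abel ?(env0 env) ?addr0 //; exact: fa_even. Qed.

(** A longer word contains some letter q + 1 times; that power is central and is absorbed into the
    coefficients as a generator [sgenC]. Together with [oddsp_short], where a repeated odd letter
    gives 0, this leaves finitely many module generators. *)
Lemma evensp_bound n t : evensp n t -> evensp (size fa * q) t.
Proof.
apply: span_min; first exact: span_subspace.
move=> _ [c [u [_ hu ->]]]; move: {2}(size c) (leqnn (size c)) => k.
elim: k c u hu => [|k ih] c u hu hc.
  by apply: span_id; exists c, u; split=> //; apply: leq_trans hc _.
have [le|gt] := leqP (size c) (size fa * q).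
  by apply: span_id; exists c, u.
have hw : (#|'I_(size fa)| * q < size c)%N by rewrite card_ord.
have [i hi] := word_pigeonhole hw.
have [e ->] := word_extract (z := fun i => j (aa i)) (c := fun _ _ => 1)
  (fun i k => etrans (aa_comm k (fa_even (aa_in i))) (esym (scale1r _))) c i.
rewrite -(subnKC hi) exprD -!mulrA -scalerAl; apply: (subspaceZ _ (span_subspace _)).
rewrite -!mulrA fa_central // -!mulrA.
have -> : j (aa i) ^+ (count_mem i c - q.+1) * (\prod_(k0 <- [seq x <- c | predC1 i x]) j (aa k0) *
   (u * j (aa i) ^+ q.+1)) = \prod_(k0 <- nseq (count_mem i c - q.+1) i ++ [seq x <- c | predC1 i x])
   j (aa k0) * (j (aa i) ^+ q.+1 * u).
  by rewrite big_cat -fa_central // big_nseq -mulrA; rewrite iter_mulr_1.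
apply: ih; first exact: oddsp_C.
rewrite -ltnS (leq_trans _ hc) // size_cat size_nseq size_filter.
rewrite -(count_predC (pred1 i) c) ltn_add2r.
by rewrite -{2}(subnKC hi) addSn ltnS leq_addl.
Qed.

Lemma evensp_A n a t : A a -> evensp n t -> evensp n (j a * t).
Proof.
move=> Aa; elim=> [|k {}t t' [c [u [scc hu ->]]] _ ih]; first by rewrite mulr0; exact: span0.
rewrite mulrDr -scalerAr; apply: spanP => //.
exists c, (j a * u); split=> //; first exact: oddsp_A.
elim: c {scc} => [|i c ihc]; first by rewrite !big_nil !mul1r.
by rewrite !big_cons -!mulrA -ihc !mulrA (aa_comm i (A_even Aa)).
Qed.

Lemma evensp_odd n v t : hom true v -> evensp n t -> evensp n (j v * t).
Proof.
move=> hv; elim=> [|k {}t t' [c [u [scc hu ->]]] _ ih]; first by rewrite mulr0; exact: span0.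
rewrite mulrDr -scalerAr; apply: (span_subspace _).2 => //; apply: (evensp_mono scc).
elim: c v hv {scc ih} => [|i c ih] v hv.
  by apply: span_id; exists [::], (j v * u); rewrite !big_nil !mul1r; split=> //; exact: oddsp_odd.
rewrite big_cons -[_ * u]mulrA [j v * _]mulrA.
have -> : j v * j (aa i) = j (aa i) * j v - j (sbracket (aa i) v).
  by rewrite (env_even_any env v (fa_even (aa_in i))) addrK.
rewrite mulrBl -[_ * j v * _]mulrA; apply: (subspaceB (span_subspace _)); first exact/evensp_fa/ih.
apply: (evensp_mono (leqnSn _)); apply: ih.
exact: (hom_sbracket false true _ _ (fa_even (aa_in i))).
Qed.

Lemma evensp_all t : evensp (size fa * q) t.
Proof.
have sT := span_subspace (fun z : R => exists (c : seq 'I_(size fa)) t,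
  [/\ (size c <= size fa * q)%N, oddsp t & z = \prod_(i <- c) j (aa i) * t]).
move: t; apply: (env_ind env) => //.
  apply: span_id; exists [::], 1; rewrite big_nil mul1r; split=> //.
  by apply: span_id; exists [::], 1; rewrite big_nil mul1r; split=> //; exact: anysw1.
move=> x t Tt; apply: (env_split env) => // [a ha|v hv]; last exact: evensp_odd.
have [a' [Aa' sa]] := fa_split ha.
rewrite -(subrK a' a) (envD env) mulrDl; apply: (subspaceD sT); last exact: evensp_A.
elim: sa => [|e f g hf _ ihf]; first by rewrite (env0 env) mul0r; exact: span0.
rewrite (envP env) mulrDl -scalerAl; apply: sT.2 => //.
have iz : (index f fa < size fa)%N by rewrite index_mem.
have -> : f = aa (Ordinal iz) by rewrite /aa nth_index.
by apply: evensp_bound; apply: evensp_fa; exact: Tt.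
Qed.

(** The finitely many [E k] generate [R] as a right module over the span of the words [sword]. By
    [idl_right], t E_k is a sum of products u j(v) with v in [V]; expanding u leaves coefficients b
    j(v) in [sideal], which are nil of index p, and [matrix_nil] applies. *)
Lemma super_nil : exists N, forall t, idl j V t -> t ^+ N = 0.
Proof.
pose I : finType := ({bseq (size fa * q) of 'I_(size fa)} * {bseq (size fv) of 'I_(size fv)})%type.
pose E (k : I) : R := \prod_(i <- k.1) j (aa i) * \prod_(i <- k.2) j (vv i).
have p0 : p = p.-1.+1 by rewrite prednK // prime_gt0 // (pcharf_prime charR).
have all_E t : span (fun z : R => exists k b, anysw b /\ z = E k * b) t.
  move: (evensp_all t); apply: span_min; first exact: span_subspace.
  move=> _ [c [u [scc /oddsp_short hu ->]]].
  elim: hu => [|e x y [d [b [sd hb ->]]] _ ih]; first by rewrite mulr0; exact: span0.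
  rewrite mulrDr -scalerAr; apply: spanP => //; exists (Bseq scc, Bseq sd), b; split=> //.
  by rewrite /E mulrA.
pose k0 : I := ([bseq], [bseq]).
exists (#|{: bool * (I * I)}| * p.-1).+1 => t Vt.
apply: (@matrix_nil F R sideal p.-1 I E k0).
- by move=> i; exact: span_subspace.
- by move=> i k a b ha hb; exact: sideal_comm.
- by move=> i a; rewrite -p0; exact: sideal_nil.
- by rewrite /E !big_nil mulr1.
move=> k; have := idl_right env odd_abel V_odd V_stable (idl_mulr (E k) Vt).
apply: span_min; first exact: span_subspace.
move=> _ [u [v [Vv ->]]]; elim: (all_E u) => [|e x y [l [b [[i hb] ->]]] _ ih].
  by rewrite mul0r; exact: span0.
rewrite mulrDl -scalerAl; apply: spanP => //.
exists l, (~~ i), (b * j v); split; last by rewrite mulrA.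
have -> : b * j v = sc i true *: (j v * b) by exact: (sword_comm hb (sword_gen (sgenV Vv))).
apply: (subspaceZ _ (span_subspace _)); apply: span_id.
by exists v, b; rewrite negbK.
Qed.
End SuperNil.

(** * Engel condition from a small action *)

Section OddIdealNil.
Variables (F : fieldType) (p : nat).
Hypotheses (charF : p \in [pchar F]) (odd_p : odd p).
Variables (L : lieSuperalgType F) (U : algType F) (iota : L -> U).
Hypothesis env : env_quotient iota.
Hypothesis even_abel : forall x y : L, hom false x -> hom false y -> sbracket x y = 0.
Hypothesis odd_abel : forall x y : L, hom true x -> hom true y -> sbracket x y = 0.
Hypothesis adnil : forall x : L, hom false x -> ad_nilpotent x.
Hypothesis small : small_action L.
Implicit Types (a v w : L).

Let two0 := two_neq0 charF odd_p.

Let chU (R : algType F) : p \in [pchar R]. Proof. by rewrite (pchar_lalg R). Qed.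

Lemma ad_uniform : exists m, forall a x, hom false a -> iter (p ^ m) (ad a) x = 0.
Proof.
have [N hN] := even_action_nilpotent even_abel adnil small.
(* The even component dies after one step and the odd one after N; p^N is at least as large as
   both. *)
exists N => a x ha; have [x0 [x1 [h0 h1 ->]]] := hom_sum x.
have p1 : (1 < p)%N := prime_gt1 (pcharf_prime charF).
have adE k y : iter k (ad a) y = mact (nseq k a) y by elim: k => //= k ->.
have mD k y z : mact (nseq k a) (y + z) = mact (nseq k a) y + mact (nseq k a) z.
  by elim: k => //= k ->; rewrite sbDr.
rewrite adE mD [X in _ + X]hN ?addr0 //.
- rewrite -(prednK (n := p ^ N)) ?expn_gt0 ?(ltnW p1) // -[_.-1.+1]addn1 nseqD mact_cat.
  by rewrite /= even_abel // mact0.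
- by move=> b /nseqP[->].
- by rewrite size_nseq; apply/ltnW/ltn_expl.
Qed.

Lemma ideal_gen_closed (K : U -> Prop) : subspace K -> (forall u x, K x -> K (u * x)) ->
  (forall u x, K x -> K (x * u)) -> forall x, ideal_gen K x -> K x.
Proof.
move=> sK Kl Kr x; elim=> // {x} [|x y _ Kx _ Ky|u x _ Kx|u x _ Kx]; [by case: sK | | exact: Kl | exact: Kr].
exact: subspaceB.
Qed.

(** The brackets [S] need not span an L_0-stable space. [W] is therefore spanned by all [a, L_1] for
    the finitely many a in [la] occurring in a finite spanning set of [S]: it is stable since ad L_0
    commutes, and finite-dimensional by [ad_image]. Powers lead from the ideal of L_1 to that of
    [V], then modulo [W] to that of [W], and finally to 0. *)
Lemma odd_ideal_nil : exists2 M, (0 < M)%N & forall z, idl iota (hom true) z -> z ^+ M = 0.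
Proof.
have [m hm] := ad_uniform.
have [P [Q [es [fP fQ hes]]]] := small.
have [fa [hfa cfa]] := fincodim_complement (hom_subspace false) fP.
have [fv [hfv cfv]] := fincodim_complement (hom_subspace true) fQ.
pose A a := hom false a /\ P a.
pose S z := exists a v, [/\ A a, hom true v, Q v & z = sbracket a v].
have [|t [tS _ ht]] := span_exchange (S := S) (t0 := [::]) (es := es).
  by move=> _ [a [v [[ha Pa] hv Qv ->]]]; apply: hes.
have [la [hla tla]] : exists la : seq L, (forall a, a \in la -> A a) /\
    forall z, z \in t -> exists a v, [/\ a \in la, hom true v & z = sbracket a v].
  elim: t tS {ht} => [|z t ih] tS; first by exists [::].
  have [|la [hla tla]] := ih; first by move=> y yt; apply: tS; rewrite inE yt orbT.
  have [a [v [Aa hv Qv ez]]] : S z by apply: tS; rewrite mem_head.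
  exists (a :: la); split=> [b|y]; rewrite inE => /orP[/eqP->//|]; first exact: hla.
    by exists a, v; rewrite mem_head.
  by move=> /tla[b [w [bla hw ->]]]; exists b, w; rewrite inE bla orbT.
pose W := span (fun z => exists a v, [/\ a \in la, hom true v & z = sbracket a v]).
have SW z : S z -> W z.
  by move=> /ht; apply: span_sub => y /tla ?; apply: span_id.
have ht' a v : hom false a -> P a -> hom true v -> Q v -> span (fun z => z \in t) (sbracket a v).
  by move=> ha Pa hv Qv; apply: ht; exists a, v.
have S_odd z : S z -> hom true z.
  by move=> [a [v [[ha _] hv _ ->]]]; apply: (hom_sbracket false true).
have W_odd w : W w -> hom true w.
  move: w; apply: span_min; first exact: hom_subspace.
  by move=> _ [a [v [/hla[ha _] hv ->]]]; apply: (hom_sbracket false true).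
have W_stable a w : hom false a -> W w -> W (sbracket a w).
  move=> ha; elim=> [|c x y [b [v [bla hv ->]]] _ ih]; first by rewrite sb0r; exact: span0.
  rewrite sbracketPr; apply: spanP => //; exists b, (sbracket a v); split=> //.
    exact: (hom_sbracket false true).
  by rewrite (even_comm even_abel) //; have [] := hla b bla.
pose ws := t ++ flatten [seq [seq sbracket a f | f <- fv] | a <- la].
have W_fin w : W w -> span (fun z => z \in ws) w.
  move: w; apply: span_min; first exact: span_subspace.
  move=> _ [a [v [al hv ->]]]; have [ha Pa] := hla a al.
  have := ad_image (P := P) (Q := Q) ha Pa ht' cfv hv; apply: span_mono => z.
  rewrite !mem_cat => /orP[->//|hz]; apply/orP; right.
  by apply/flattenP; exists [seq sbracket a f | f <- fv] => //; apply: map_f.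
pose V v := hom true v /\ forall a, A a -> W (sbracket a v).
have V_stable a v : hom false a -> V v -> V (sbracket a v).
  move=> ha [hv Wv]; split=> [|b Ab]; first exact: (hom_sbracket false true).
  by rewrite (even_comm even_abel) //; [apply/W_stable/Wv | case: Ab].
have hom_stable a v : hom false a -> hom true v -> hom true (sbracket a v).
  exact: (hom_sbracket false true).
have fv_split v : hom true v -> exists v', V v' /\ span (fun z => z \in fv) (v - v').
  move=> /cfv[v' [hv' Qv' sv]]; exists v'; split=> //; split=> // a Aa.
  by apply: SW; exists a, v'.
have fa_split a : hom false a -> exists a', A a' /\ span (fun z => z \in fa) (a - a').
  by move=> /cfa[a' [ha' Pa' sa]]; exists a'.
have powV z : idl iota (hom true) z -> idl iota V (z ^+ (size fv).+1).
  by apply: (idl_power env two0 odd_abel) => // v [].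
have ws_odd w : w \in ws -> hom true w.
  rewrite mem_cat => /orP[/tS/S_odd//|/flattenP[_ /mapP[a al ->] /mapP[v vf ->]]].
  by apply: hom_stable; [case: (hla a al) | exact: hfv].
have powW z : idl iota W z -> z ^+ (size ws).+1 = 0.
  move=> Wz; have : idl iota (fun x => x = 0) (z ^+ (size ws).+1).
    apply: (idl_power env two0 odd_abel) Wz => //.
    - by move=> x ->; case: (hom_subspace (s := L) true).
    - by move=> a x _ ->; rewrite sb0r.
    - by move=> y /W_fin Wy; exists 0; rewrite subr0.
  by elim=> // c x y [v [r [-> ->]]] _ ->; rewrite (env0 env) mul0r scaler0 addr0.
have [N hN] : exists N, forall z, idl iota V z -> idl iota W (z ^+ N).
  have sK := idl_subspace iota W.
  have Kl u x : idl iota W x -> idl iota W (u * x) by exact: (idl_mull env odd_abel).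
  have Kr u x : idl iota W x -> idl iota W (x * u) by exact: idl_mulr.
  have genK := ideal_gen_closed sK Kl Kr.
  (* If the ideal is everything there is no nonzero quotient ring, and the exponent 0 serves. *)
  have [/genK K1|nK1] := pselect (ideal_gen (idl iota W) 1).
    by exists 0%N.
  have [R [pi [piP piM pi1 pi0 pi_surj]]] := ideal_quotient nK1.
  have envR : env_quotient (fun x => pi (iota x)).
    have pi00 : pi 0 = 0 by apply/pi0/IdealGen; case: sK.
    have piD x y : pi (x + y) = pi x + pi y by rewrite -[x]scale1r piP !scale1r.
    have piZ c x : pi (c *: x) = c *: pi x by rewrite -[c *: x]addr0 piP pi00 addr0.
    split=> [c x y|i k a b ha hb|T sT T1 Tx t'].
    - by rewrite (envP env) piP.
    - by rewrite -!piM (envM env ha hb) piD piZ.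
    have [u ->] := pi_surj t'; move: u; apply: (env_ind env).
    + split=> [|c x y hx hy]; first by rewrite pi00; case: sT.
      by rewrite piP; apply: sT.2.
    + by rewrite pi1.
    + by move=> x u hu; rewrite piM; apply: Tx.
  have piX x n : pi (x ^+ n) = pi x ^+ n.
    by elim: n => [|n ih]; rewrite ?expr0 // !exprS piM ih.
  have q0 : (p ^ m)%N = (p ^ m).-1.+1.
    by rewrite prednK // expn_gt0 prime_gt0 // (pcharf_prime charF).
  have [] := @super_nil F L R _ envR two0 even_abel odd_abel p (p ^ m).-1 (chU R) A V fa fv.
  - by move=> a [].
  - by move=> v [].
  - exact: V_stable.
  - move=> a v Aa [hv Wv]; apply/pi0/IdealGen; rewrite -[iota _]mulr1.
    by apply: idl_cons; exact: Wv.
  - exact: hfa.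
  - exact: hfv.
  - exact: fa_split.
  - exact: fv_split.
  - move=> a af t'; rewrite -q0; apply: (even_pow_central envR (chU R) odd_p (hfa _ af)).
    by move=> x; apply: hm; exact: hfa.
  move=> N hN; exists N => z Vz; apply: genK; apply/pi0; rewrite piX; apply: hN.
  elim: Vz => [|c x y [v [r [Vv ->]]] _ ih].
    have -> : pi 0 = 0 by apply/pi0/IdealGen; case: sK.
    exact: span0.
  rewrite piP piM; apply: spanP => //; by exists v, (pi r).
(* [N] may be 0, so 1 is added to keep the exponent positive. *)
exists ((size fv).+1 * N * (size ws).+1 + 1)%N; first by rewrite addn1.
by move=> z /powV/hN/powW; rewrite -!exprM => e; rewrite exprD -mulnA e mul0r.
Qed.
Lemma expr_congr (K : U -> Prop) s z n : subspace K -> (forall u x, K x -> K (u * x)) ->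
  (forall u x, K x -> K (x * u)) -> K z -> K ((s + z) ^+ n - s ^+ n).
Proof.
move=> sK Kl Kr Kz; elim: n => [|n ih]; first by rewrite subrr; case: sK.
rewrite !exprS mulrDl addrAC -mulrBr; apply: subspaceD => //; first exact: Kl.
exact: Kr.
Qed.

Lemma engel_of_small_action : bounded_engel U.
Proof.
have [m hm] := ad_uniform; have [M M0 hM] := odd_ideal_nil.
have p1 : (1 < p)%N := prime_gt1 (pcharf_prime charF).
pose J := idl iota (hom true).
have sJ : subspace J := idl_subspace _ _.
have Jl u x : J x -> J (u * x).
  by apply: (idl_mull env odd_abel) => // a v; exact: (hom_sbracket false true).
have Jr u x : J x -> J (x * u) by exact: idl_mulr.
pose Sw (s : U) := exists2 w : seq L, (forall a, a \in w -> hom false a) & s = \prod_(a <- w) iota a.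
have evC a b : hom false a -> hom false b -> iota a * iota b = iota b * iota a.
  by move=> ha hb; rewrite (env_even_any env) // even_abel // (env0 env) addr0.
have split_u u : exists s z, [/\ span Sw s, J z & u = s + z].
  move: u; apply: (env_ind env).
  - split=> [|c _ _ [s [z [hs hz ->]]] [s' [z' [hs' hz' ->]]]].
      by exists 0, 0; rewrite addr0; split=> //; [exact: span0 | case: sJ].
    exists (c *: s + s'), (c *: z + z'); split; [exact: (span_subspace _).2 | exact: sJ.2 |].
    by rewrite scalerDr addrACA.
  - exists 1, 0; rewrite addr0; split=> //; last by case: sJ.
    by apply: span_id; exists [::]; rewrite ?big_nil.
  move=> x _ [s [z [hs hz ->]]]; have [a [v [ha hv ->]]] := hom_sum x.
  exists (iota a * s), (iota a * z + iota v * (s + z)); split.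
  - elim: hs {hz} => [|c y y' [w hw ->] _ ih]; first by rewrite mulr0; exact: span0.
    rewrite mulrDr -scalerAr; apply: spanP => //; exists (a :: w); last by rewrite big_cons.
    by move=> b; rewrite inE => /orP[/eqP->//|/hw].
  - by apply: subspaceD => //; [exact: Jl | exact: idl_cons].
  - by rewrite (envD env) mulrDl mulrDr addrA.
pose central (u : U) := forall t, u * t = t * u.
have Sw_comm a (w : seq L) : hom false a -> (forall b, b \in w -> hom false b) ->
    iota a * \prod_(b <- w) iota b = \prod_(b <- w) iota b * iota a.
  move=> ha; elim: w => [|b w ih] hw; first by rewrite big_nil mulr1 mul1r.
  have hb : hom false b by apply: hw; rewrite mem_head.
  rewrite big_cons mulrA (evC _ _ ha hb) -!mulrA ih // => c cw.
  by apply: hw; rewrite inE cw orbT.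
have central_s s : span Sw s -> central (s ^+ (p ^ m)).
  move: s; apply: (span_frobenius (chU U)).
  - split=> [t|c x y hx hy t]; first by rewrite mul0r mulr0.
    by rewrite mulrDl mulrDr -scalerAl -scalerAr hx hy.
  - move=> _ _ [w hw ->] [w' hw' ->]; elim: w hw => [|a w ih] hw; first by rewrite big_nil mulr1 mul1r.
    rewrite big_cons -mulrA ih => [|b bw]; last by apply: hw; rewrite inE bw orbT.
    by rewrite mulrA Sw_comm ?mulrA //; apply: hw; rewrite mem_head.
  - move=> _ [w hw ->]; elim: w hw => [|a w ih] hw t; first by rewrite big_nil expr1n mulr1 mul1r.
    have ha : hom false a by apply: hw; rewrite mem_head.
    have hw' b : b \in w -> hom false b by move=> bw; apply: hw; rewrite inE bw orbT.
    rewrite big_cons exprMn_comm; last exact: Sw_comm.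
    have ca := even_pow_central env (chU U) odd_p ha (fun x => hm a x ha).
    by rewrite -mulrA ih // mulrA ca -mulrA.
have Mp : (M <= p ^ M)%N by apply/ltnW/ltn_expl.
apply: (central_engel (chU U) odd_p (N := (p ^ (m + M))%N)) => [||u t].
- by rewrite expn_gt0 ltnW.
- by exists (m + M)%N.
have [s [z [hs hz ->]]] := split_u u.
(* Raising to the power p^m makes the even part central and leaves an error in the ideal [J]. The
   two then commute, so the further power p^M is additive and kills the error. *)
have Jq := expr_congr s (p ^ m)%N sJ Jl Jr hz.
have -> : (s + z) ^+ (p ^ (m + M)) = s ^+ (p ^ (m + M)).
  rewrite expnD !exprM -[(s + z) ^+ _](subrK (s ^+ (p ^ m))).
  rewrite (frobenius_comm M (chU U)); last by apply/commr_sym/central_s.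
  by rewrite -(subnKC Mp) exprD hM // mul0r add0r.
by rewrite expnD exprM; apply/commr_sym/commrX/commr_sym/central_s.
Qed.
End OddIdealNil.

(** * The equivalence *)

Section Equivalence.
Variables (F : fieldType) (p : nat) (charF : p \in [pchar F]) (p_ge3 : (3 <= p)%N).
Variables (L : lieSuperalgType F).
Hypothesis char3 : p = 3%N -> forall y : L, odd_part L y -> sbracket (sbracket y y) y = 0.
Variables (U : algType F) (iota : L -> U).
Hypothesis env : enveloping iota.

Lemma trivial_bracket (H K : L -> Prop) :
  trivial_sp (bracket_sp H K) <-> forall x y, H x -> K y -> sbracket x y = 0.
Proof.
split=> [h x y Hx Ky|h z /lspanE].
  by apply: h; apply/lspanE/span_id; exists x, y.
by elim=> // c x y [u [v [Hu Kv ->]]] _ ->; rewrite h // scaler0 addr0.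
Qed.

Lemma char_odd : odd p.
Proof.
have pr := pcharf_prime charF.
by case/even_prime: pr p_ge3 => [->|].
Qed.

(** The Jacobi identity for y, y, y reads 3 [[y,y],y] = 0, which leaves only p = 3 to the
    hypothesis. *)
Lemma odd_cube (y : L) : hom true y -> sbracket (sbracket y y) y = 0.
Proof.
move=> hy; have [/char3->//|p3] := eqVneq p 3%N.
have hyy : hom false (sbracket y y) := hom_sbracket _ _ _ _ hy hy.
have := sbracketJ _ _ y y y hy hy.
rewrite (sbracketC _ _ _ _ hy hyy) /= expr0 expr1 scale1r scaleN1r opprK => /eqP.
set T := sbracket _ y; rewrite eq_sym -subr_eq0 opprK.
have -> : T + T + T = 3%:R *: T by rewrite scaler_nat !mulrS mulr0n addr0 addrA.
rewrite scaler_eq0 => /orP[|/eqP//].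
rewrite -(dvdn_pcharf charF) dvdn_prime2 ?(pcharf_prime charF) // => /eqP e.
by rewrite e eqxx in p3.
Qed.

Lemma ad_nilpotent_of_nilpotent : nilpotent_alg L ->
  forall x : L, hom false x -> ad_nilpotent x.
Proof.
move=> [n hn] x hx; exists n => y; apply: hn.
have skew z : sbracket x z = - sbracket z x.
  have [z0 [z1 [h0 h1 ->]]] := hom_sum z.
  rewrite sbDr sbDl (sbracketC _ _ _ _ hx h0) (sbracketC _ _ _ _ hx h1).
  by rewrite /= !expr0 !scale1r opprD.
elim: n => [|n ih] //=; rewrite /ad skew; apply/lspanE.
by apply: (subspaceN (span_subspace _)); apply: span_id; exists (iter n (ad x) y), x.
Qed.

(** L_0 is central and any two odd elements are multiples of one vector, so U is commutative and the
    Engel index is 1. *)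
Lemma engel_of_even_central : (forall x y : L, hom false x -> hom false y -> sbracket x y = 0) ->
  (forall x y : L, hom false x -> hom true y -> sbracket x y = 0) ->
  dim_le (odd_part L) 1%N -> bounded_engel U.
Proof.
move=> ee eo [e [_ he]].
have jC x y : iota x * iota y = iota y * iota x.
  have even_C a z : hom false a -> iota a * iota z = iota z * iota a.
    by move=> ha; rewrite (env_even_any env) // even_central // (env0 env) addr0.
  have [x0 [x1 [hx0 hx1 ->]]] := hom_sum x; have [y0 [y1 [hy0 hy1 ->]]] := hom_sum y.
  have [c ex] := he x1 hx1; have [d ey] := he y1 hy1.
  rewrite !(envD env) !mulrDl !mulrDr !(even_C x0) // (even_C y0) // [in RHS](even_C y0) //.
  rewrite addrACA; congr (_ + _ + _).
  rewrite ex ey !big_ord1 !(envZ env) -!scalerAl -!scalerAr !scalerA mulrC.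
  by [].
have cC (x : L) (t : U) : iota x * t = t * iota x.
  move: t; apply: (env_ind env) => [||y t ih].
  - split=> [|c u v hu hv]; first by rewrite mulr0 mul0r.
    by rewrite mulrDr mulrDl -scalerAl -scalerAr hu hv.
  - by rewrite mulr1 mul1r.
  - by rewrite [LHS]mulrA jC -[LHS]mulrA ih mulrA.
exists 1%N => // u v; rewrite /= /comm; apply/eqP; rewrite subr_eq0; apply/eqP.
move: u; apply: (env_ind env) => [||y t ih].
- split=> [|c u w hu hw]; first by rewrite mulr0 mul0r.
  by rewrite mulrDr mulrDl -scalerAl -scalerAr hu hw.
- by rewrite mulr1 mul1r.
- by rewrite -mulrA ih !mulrA cC.
Qed.

Definition odd_condition := trivial_sp (bracket_sp (odd_part L) (odd_part L))
  \/ dim_le (odd_part L) 1%N /\ trivial_sp (bracket_sp (even_part L) (odd_part L)).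

Lemma engel_conditions : bounded_engel U ->
  [/\ is_PI U, trivial_sp (bracket_sp (even_part L) (even_part L)),
      forall x : L, even_part L x -> ad_nilpotent x & odd_condition].
Proof.
have chU : p \in [pchar U] by rewrite (pchar_lalg U).
move=> /(engel_central chU char_odd)[m hm].
have pm : (0 < p ^ m)%N by rewrite expn_gt0 (ltn_trans _ p_ge3).
split.
- exact: central_PI pm hm.
- by apply/trivial_bracket => x y hx hy; exact: (even_abelian charF char_odd env odd_cube hm hx hy).
- by move=> x hx; exists (p ^ m)%N => y; exact: (engel_ad charF char_odd env odd_cube hm y hx).
have [h|[y [hy [eo hv]]]] := odd_dichotomy charF char_odd env odd_cube hm.
  by left; apply/trivial_bracket.
right; split; last exact/trivial_bracket.
exists (fun=> y); split=> // v /hv[c ->]; exists (fun=> c); by rewrite big_ord1.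
Qed.

Lemma nilpotent_of_PI : is_PI U -> trivial_sp (bracket_sp (even_part L) (even_part L)) ->
  (forall x : L, even_part L x -> ad_nilpotent x) -> odd_condition -> nilpotent_alg L.
Proof.
move=> PI /trivial_bracket ee nil [/trivial_bracket oo|[_ /trivial_bracket eo]].
  have small := PI_small_action ee oo nil env PI.
  have [N hN] := even_action_nilpotent ee nil small.
  exact: nilpotent_of_even_action ee oo N hN.
exact: nilpotent_of_even_central ee eo.
Qed.

Lemma engel_of_PI : is_PI U -> trivial_sp (bracket_sp (even_part L) (even_part L)) ->
  nilpotent_alg L -> odd_condition -> bounded_engel U.
Proof.
move=> PI /trivial_bracket ee nilL [/trivial_bracket oo|[dim1 /trivial_bracket eo]].
  have nil := ad_nilpotent_of_nilpotent nilL.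
  have small := PI_small_action ee oo nil env PI.
  exact: (engel_of_small_action charF char_odd env ee oo nil small).
exact: engel_of_even_central.
Qed.
End Equivalence.

Theorem theorem1p2 (F : fieldType) (p : nat) (charF : p \in [pchar F])
    (p_ge3 : (3 <= p)%N) (L : lieSuperalgType F)
    (char3 : p = 3%N ->
       forall y : L, odd_part L y -> sbracket (sbracket y y) y = 0) :
  [<-> bounded_engel (env_alg L);
       [/\ is_PI (env_alg L),
           trivial_sp (bracket_sp (even_part L) (even_part L)),
           forall x : L, even_part L x -> ad_nilpotent x
         & trivial_sp (bracket_sp (odd_part L) (odd_part L))
           \/ dim_le (odd_part L) 1%N
              /\ trivial_sp (bracket_sp (even_part L) (odd_part L))];
       [/\ is_PI (env_alg L),
           trivial_sp (bracket_sp (even_part L) (even_part L)),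
           nilpotent_alg L
         & trivial_sp (bracket_sp (odd_part L) (odd_part L))
           \/ dim_le (odd_part L) 1%N
              /\ trivial_sp (bracket_sp (even_part L) (odd_part L))]].
Proof.
have env := env_alg_enveloping L; tfae.
- exact: (engel_conditions charF p_ge3 char3 env).
- by move=> [PI ee nil odd]; split=> //; exact: (nilpotent_of_PI env PI ee nil odd).
- by move=> [PI ee nil odd]; exact: (engel_of_PI charF p_ge3 env PI ee nil odd).
Qed.
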